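(* Let $g:\mathbb{R}\to\mathbb{R}$ be smooth, $2\pi$-periodic and positive, and fix $k_y>0$. Let $\varphi_*$ be the solution, strictly increasing in $\zeta$, of the stripe-growth system with $c_x=0$, and let $\psi_*(\zeta)=\varphi_*(0,\zeta)-\zeta$, a $2\pi$-periodic function of mean zero. Then $K_x(k_y,0)=k_{x,0}$ with $$k_{x,0}=\frac{1}{2\pi}\int_0^{2\pi}g(\varphi)\,d\varphi,$$ and, as $c_x\to0$ with $c_x\geq 0$, $$K_x(k_y,c_x)=k_{x,0}-\frac{k_{x,0}}{k_y}\,\|\psi_*\|^2_{\mathring H^{1/2}}\,\frac{c_x}{2}+\mathcal{O}(c_x^2).$$
   Context: For parameters $c_x\ge0$, $k_y>0$, the stripe-growth system for a real function $\varphi(x,\zeta)$, $x\le0$, $\zeta\in\mathbb{R}$, and a real number $k_x$ is \begin{align*} 0&=\varphi_{xx}+k_y^2\varphi_{\zeta\zeta}+c_x\varphi_x-k_xc_x\varphi_\zeta, && x<0,\ \zeta\in\mathbb{R},\\ 0&=\varphi(x,\zeta+2\pi)-\varphi(x,\zeta)-2\pi, && x\le 0,\ \zeta\in\mathbb{R},\\ 0&=\varphi_x-g(\varphi), && x=0,\ \zeta\in\mathbb{R},\\ 0&=\lim_{x\to-\infty}|\varphi(x,\zeta)-(k_xx+\zeta)|, && \zeta\in\mathbb{R}. \end{align*} $K_x(k_y,c_x)$ denotes the value of $k_x$ for which this system has a (classical) solution that is strictly increasing in $\zeta$; such a solution exists for all $c_x\ge0$, $k_y>0$, and is unique within the class of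 monotone solutions up to translation in $\zeta$. For a $2\pi$-periodic function $\psi(\zeta)=\sum_{\ell\in\mathbb{Z}}\psi^\ell e^{i\ell\zeta}$, $|\partial_\zeta|$ is the Fourier multiplier with symbol $|\ell|$ and $\|\psi\|^2_{\mathring H^{1/2}}=\frac{1}{2\pi}\int_0^{2\pi}\psi\,|\partial_\zeta|\psi\,d\zeta=\sum_{\ell}|\ell|\,|\psi^\ell|^2$. *)

(* Defs.v *)
From Stdlib Require Import Reals ZArith.
From Coquelicot Require Import Coquelicot.

Open Scope R_scope.

(* Functions of (x, zeta) are total on R * R; only their values on the closed
   half-plane [x <= 0] are ever constrained. *)
Definition half_plane (p : R * R) : Prop := fst p <= 0.

(* [phi] is C^1 up to the boundary [x = 0], with partial derivatives [phix] and
   [phiz]. The x-derivative is relative to [x <= 0]: it is the usual derivative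
   when [x < 0] and the left derivative when [x = 0]. *)
Definition C1_half_plane (phi phix phiz : R -> R -> R) : Prop :=
  (forall x z, x <= 0 ->
     filterdiff (fun s => phi s z) (within (fun s => s <= 0) (locally x))
       (fun h => scal h (phix x z))) /\
  (forall x z, x <= 0 -> is_derive (fun t => phi x t) z (phiz x z)) /\
  continuous_on half_plane (fun p => phi (fst p) (snd p)) /\
  continuous_on half_plane (fun p => phix (fst p) (snd p)) /\
  continuous_on half_plane (fun p => phiz (fst p) (snd p)).

(* Classical solutions: C^2 in the open half-plane, C^1 in the closed one. *)
Definition stripe_solution (g : R -> R) (ky cx kx : R) (phi : R -> R -> R) :
    Prop :=
  (forall x z, x < 0 -> ex_diff_n phi 2 x z) /\
  exists phix phiz : R -> R -> R,
    C1_half_plane phi phix phiz /\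
    (forall x z, x < 0 ->
       0 = Derive_n (fun s => phi s z) 2 x
           + ky ^ 2 * Derive_n (fun t => phi x t) 2 z
           + cx * phix x z - kx * cx * phiz x z) /\
    (forall x z, x <= 0 -> 0 = phi x (z + 2 * PI) - phi x z - 2 * PI) /\
    (forall z, 0 = phix 0 z - g (phi 0 z)) /\
    (forall z, is_lim (fun x => Rabs (phi x z - (kx * x + z))) m_infty 0).

Definition increasing_zeta (phi : R -> R -> R) : Prop :=
  forall x z1 z2, x <= 0 -> z1 < z2 -> phi x z1 < phi x z2.

Definition monotone_stripe_solution (g : R -> R) (ky cx kx : R)
    (phi : R -> R -> R) : Prop :=
  stripe_solution g ky cx kx phi /\ increasing_zeta phi.

Definition stripe_wavenumber (g : R -> R) (ky cx kx : R) : Prop :=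
  exists phi : R -> R -> R, monotone_stripe_solution g ky cx kx phi.

(* psi^l = (1 / 2 pi) \int_0^{2 pi} psi(z) e^{- i l z} dz *)
Definition fourier_coef (psi : R -> R) (l : Z) : C :=
  scal (/ (2 * PI))
    (RInt (V := C_R_CompleteNormedModule)
       (fun z => (psi z * cos (IZR l * z), - (psi z * sin (IZR l * z))))
       0 (2 * PI)).

(* Sums over Z, as the sum over l >= 0 plus the sum over l < 0. *)
Definition ex_seriesZ (a : Z -> R) : Prop :=
  ex_series (fun n : nat => a (Z.of_nat n)) /\
  ex_series (fun n : nat => a (- Z.of_nat (S n))%Z).

Definition SeriesZ (a : Z -> R) : R :=
  Series (fun n : nat => a (Z.of_nat n)) +
  Series (fun n : nat => a (- Z.of_nat (S n))%Z).

Definition Hhalf_term (psi : R -> R) (l : Z) : R :=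
  IZR (Z.abs l) * Cmod (fourier_coef psi l) ^ 2.

Definition in_Hhalf (psi : R -> R) : Prop := ex_seriesZ (Hhalf_term psi).

(* The square of the homogeneous H^{1/2} norm; meaningful under [in_Hhalf],
   since [Series] is total. *)
Definition Hhalf_norm_sq (psi : R -> R) : R := SeriesZ (Hhalf_term psi).

(* Main.v *)
(* Write [phi = k x + z + psi], [u = phi(0, .)] and [l] for the Fourier variable in
   [z]. Each mode of [psi] solves a linear ODE in [x <= 0] and decays at minus
   infinity, so [phi_x(0, .) - k] has coefficients [lambda_l psi^l] with an
   explicit [lambda_l = ky |l| + O(c)] whose imaginary part is
   [sgn(l) k c / (2 ky) + O(c^2)]. Hence [k] is the mean of [g(u)], and pairing
   [g(u) = phi_x(0, .)] with [u'] gives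
   [k_{x,0} - k = sum_l l Im(lambda_l) |psi^l|^2
                = k c / (2 ky) ||psi||^2 + O(c^2)].
   It remains to see that the seminorm of [psi] is [O(c)]-close to its value at
   [c = 0]. In terms of the inverse [a] of [u] the boundary condition becomes
     [g(s) - k = ky / (2 pi) p.v. int_0^{2 pi} cot ((a(s) - a(t)) / 2) dt + O(c)].
   The cotangent is strongly decreasing on [(0, pi)], so the right-hand side is a
   strongly monotone operator of [a]; as [s - a(s)] has mean zero this bounds the
   [L^1] distance of the inverses [a], for [c] and for [0], by [O(c)]. Finally,
   [ky ||psi||^2] is, up to [O(c)], the mean of [psi g(u)], an integral which is
   Lipschitz in [a] after the change of variables [s = u(z)]. The principal value
   is regularized by the conjugate Poisson kernel. *)

Require Import Defs.
From Stdlib Require Import Reals ZArith Lra Lia Psatz.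
From Coquelicot Require Import Coquelicot.

Open Scope R_scope.

(** * Integrals of continuous functions *)


(** As a condition on [u] the boundary condition has no monotone structure, because [g] is an
    arbitrary periodic function. In terms of the inverses, [g s] is common to the conditions for [c]
    and for 0 and cancels on subtraction. What remains of the wavenumbers is the constant [k - k0],
    which is orthogonal to the mean-zero difference of the inverses.

    Uniformity in [c] rests on total variation. Since [u' >= 0] has integral [2 PI] over a period,
    the coefficients of [g(u)] are O(1/l) and those of [u - id] are O(1/l^2), with constants that
    depend on [g] and [ky] only. Bounds on [u'] itself and Lipschitz constants of [g(u)] depend on
    the trace, but they only multiply the regularization parameter [e], which tends to 0 with the
    traces fixed. The choice [r = 1 - e^2] makes the regularization errors linear in [e].

    As [u'] may vanish, the inverses are merely continuous. Integrals over [s] are therefore pulled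
    back along [u], and no derivative of an inverse ever occurs. *)

Lemma ct_plus {U : UniformSpace} (f h : U -> R) (x : U) :
  continuous f x -> continuous h x -> continuous (fun y => f y + h y) x.
Proof. exact (continuous_plus (K := R_AbsRing) (V := R_NormedModule) f h x). Qed.

Lemma ct_minus {U : UniformSpace} (f h : U -> R) (x : U) :
  continuous f x -> continuous h x -> continuous (fun y => f y - h y) x.
Proof. exact (continuous_minus (K := R_AbsRing) (V := R_NormedModule) f h x). Qed.

Lemma ct_opp {U : UniformSpace} (f : U -> R) (x : U) :
  continuous f x -> continuous (fun y => - f y) x.
Proof. exact (continuous_opp (K := R_AbsRing) (V := R_NormedModule) f x). Qed.

Lemma ct_mult {U : UniformSpace} (f h : U -> R) (x : U) :
  continuous f x -> continuous h x -> continuous (fun y => f y * h y) x.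
Proof. exact (continuous_mult (K := R_AbsRing) f h x). Qed.

Lemma ct_pow {U : UniformSpace} (f : U -> R) (n : nat) (x : U) :
  continuous f x -> continuous (fun y => f y ^ n) x.
Proof.
  intros Hf; induction n as [|n IH]; simpl.
  - apply continuous_const.
  - now apply ct_mult.
Qed.

Lemma ct_inv {U : UniformSpace} (f : U -> R) (x : U) :
  continuous f x -> f x <> 0 -> continuous (fun y => / f y) x.
Proof. intros Hf Hx; apply (continuous_comp f Rinv); [exact Hf | now apply continuous_Rinv]. Qed.

Lemma ct_Rabs (x : R) : continuous Rabs x.
Proof. apply continuous_Rabs. Qed.

Lemma ct_derive (f : R -> R) (x l : R) : is_derive f x l -> continuous f x.
Proof. intros H; apply (ex_derive_continuous (K := R_AbsRing) (V := R_NormedModule)); now exists l. Qed.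

Lemma ct_pair (F : R * R -> R) (x y : R) :
  continuous F (x, y) -> continuity_2d_pt (fun u v => F (u, v)) x y.
Proof.
  intros H; apply continuity_2d_pt_filterlim.
  eapply filterlim_ext; [|exact H]. now intros [u v].
Qed.

(** Lemmas on normed modules leave equations typed in the carrier of the structure, whereas [ring]
    and [field] expect them in [R]. *)
Ltac toR := match goal with |- ?a = ?b => change (@eq R a b) end.

Ltac ctn := intros; cbv beta; repeat (first
  [ assumption
  | apply continuous_const
  | apply continuous_id
  | solve [auto]
  | lazymatch goal with
    | |- continuous (fun y => @?f y + @?h y) _ => apply (ct_plus f h)
    | |- continuous (fun y => @?f y - @?h y) _ => apply (ct_minus f h)
    | |- continuous (fun y => - @?f y) _ => apply (ct_opp f)
    | |- continuous (fun y => @?f y * @?h y) _ => apply (ct_mult f h)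
    | |- continuous (fun y => @?f y / @?h y) _ => apply (ct_mult f (fun y => / h y))
    | |- continuous (fun y => @?f y ^ ?n) _ => apply (ct_pow f n)
    | |- continuous (fun y => / @?f y) _ => apply (ct_inv f)
    | |- continuous fst ?p => destruct p; apply continuous_fst
    | |- continuous snd ?p => destruct p; apply continuous_snd
    | |- continuous (fun y => fst y) ?p => destruct p; apply continuous_fst
    | |- continuous (fun y => snd y) ?p => destruct p; apply continuous_snd
    | |- continuous (fun y => sin (@?f y)) _ => apply (continuous_comp f sin); [|apply continuous_sin]
    | |- continuous (fun y => cos (@?f y)) _ => apply (continuous_comp f cos); [|apply continuous_cos]
    | |- continuous (fun y => Rabs (@?f y)) _ => apply (continuous_comp f Rabs); [|apply ct_Rabs]
    | |- continuous (fun y => ?a (@?f y)) _ => apply (continuous_comp f a); [|solve [auto]]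
    end; cbv beta ]).

Lemma rint_ex (f : R -> R) (a b : R) :
  (forall x, continuous f x) -> ex_RInt f a b.
Proof. intros H; apply (ex_RInt_continuous (V := R_CompleteNormedModule)); auto. Qed.

Lemma rint_plus (f h : R -> R) (a b : R) :
  (forall x, continuous f x) -> (forall x, continuous h x) ->
  RInt (fun x => f x + h x) a b = RInt f a b + RInt h a b.
Proof.
  intros Hf Hh.
  exact (RInt_plus (V := R_CompleteNormedModule) f h a b (rint_ex f a b Hf) (rint_ex h a b Hh)).
Qed.

Lemma rint_minus (f h : R -> R) (a b : R) :
  (forall x, continuous f x) -> (forall x, continuous h x) ->
  RInt (fun x => f x - h x) a b = RInt f a b - RInt h a b.
Proof.
  intros Hf Hh.
  exact (RInt_minus (V := R_CompleteNormedModule) f h a b (rint_ex f a b Hf) (rint_ex h a b Hh)).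
Qed.

Lemma rint_scal (f : R -> R) (c a b : R) :
  (forall x, continuous f x) ->
  RInt (fun x => c * f x) a b = c * RInt f a b.
Proof.
  intros Hf.
  exact (RInt_scal (V := R_CompleteNormedModule) f a b c (rint_ex f a b Hf)).
Qed.

Lemma rint_const (c a b : R) : RInt (fun _ => c) a b = (b - a) * c.
Proof. exact (RInt_const (V := R_CompleteNormedModule) a b c). Qed.

Lemma rint_ext (f h : R -> R) (a b : R) :
  (forall x, f x = h x) -> RInt f a b = RInt h a b.
Proof. intros H; apply RInt_ext; auto. Qed.

Lemma rint_le (f h : R -> R) (a b : R) : a <= b ->
  (forall x, continuous f x) -> (forall x, continuous h x) ->
  (forall x, a <= x <= b -> f x <= h x) -> RInt f a b <= RInt h a b.
Proof.
  intros Hab Hf Hh H; apply RInt_le; auto using rint_ex.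
  intros x Hx; apply H; lra.
Qed.

Lemma rint_abs_le (f h : R -> R) (a b : R) : a <= b ->
  (forall x, continuous f x) -> (forall x, continuous h x) ->
  (forall x, a <= x <= b -> Rabs (f x) <= h x) -> Rabs (RInt f a b) <= RInt h a b.
Proof.
  intros Hab Hf Hh H.
  eapply Rle_trans; [apply abs_RInt_le; auto using rint_ex|].
  apply rint_le; auto; ctn.
Qed.

Lemma rint_Chasles (f : R -> R) (a b c : R) :
  (forall x, continuous f x) -> RInt f a b + RInt f b c = RInt f a c.
Proof.
  intros Hf.
  exact (RInt_Chasles (V := R_CompleteNormedModule) f a b c (rint_ex f a b Hf) (rint_ex f b c Hf)).
Qed.

Lemma rint_derive (f df : R -> R) (a b : R) :
  (forall x, is_derive f x (df x)) -> (forall x, continuous df x) ->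
  RInt df a b = f b - f a.
Proof.
  intros Hf Hc. apply is_RInt_unique.
  apply (is_RInt_derive (V := R_CompleteNormedModule)); auto.
Qed.

Lemma rint_upper_derive (f : R -> R) (a x : R) :
  (forall x, continuous f x) -> is_derive (fun y => RInt f a y) x (f x).
Proof.
  intros Hf. apply (is_derive_RInt (V := R_NormedModule) f (fun y => RInt f a y) a x); auto.
  apply filter_forall; intros y; apply (RInt_correct (V := R_CompleteNormedModule)), rint_ex, Hf.
Qed.

Lemma zero_derive_const (f : R -> R) :
  (forall x, is_derive f x 0) -> forall x y, f x = f y.
Proof.
  intros H x y.
  assert (E := rint_derive f (fun _ => 0) x y H (fun z => continuous_const 0 z)).
  rewrite rint_const in E. lra.
Qed.

(** As a function of [x], the integral over [[x, x + T]] has derivative [f (x + T) - f x = 0]. *)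
Lemma rint_period (f : R -> R) (T x : R) :
  (forall x, continuous f x) -> (forall x, f (x + T) = f x) ->
  RInt f x (x + T) = RInt f 0 T.
Proof.
  intros Hf HT.
  assert (Hd : forall x, is_derive (fun x => RInt f 0 (x + T) - RInt f 0 x) x 0).
  { intros y.
    evar_last.
    - apply (is_derive_minus (K := R_AbsRing) (V := R_NormedModule)
        (fun x => RInt f 0 (x + T)) (fun x => RInt f 0 x)).
      + apply (is_derive_comp (K := R_AbsRing) (V := R_NormedModule) (fun z => RInt f 0 z) (fun x => x + T)).
        * now apply rint_upper_derive.
        * auto_derive; [exact I | reflexivity].
      + now apply rint_upper_derive.
    - rewrite HT. unfold minus, plus, opp, scal; simpl; unfold mult; simpl. ring. }
  assert (E := zero_derive_const _ Hd x 0). simpl in E.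
  rewrite Rplus_0_l, RInt_point in E.
  rewrite <- (rint_Chasles f x 0 (x + T) Hf).
  rewrite <- (opp_RInt_swap (V := R_CompleteNormedModule)) by (now apply rint_ex).
  unfold opp; simpl. unfold zero in E; simpl in E. lra.
Qed.

Lemma rint_comp (f u u' : R -> R) (a b : R) :
  (forall x, continuous f x) -> (forall x, is_derive u x (u' x)) ->
  (forall x, continuous u' x) ->
  RInt (fun y => f (u y) * u' y) a b = RInt f (u a) (u b).
Proof.
  intros Hf Hu Hc.
  rewrite <- (RInt_comp (V := R_CompleteNormedModule) f u u'); auto.
  apply rint_ext; intros x; unfold scal; simpl; unfold mult; simpl; ring.
Qed.

Lemma rint_parts_periodic (f f' h h' : R -> R) (T : R) :
  (forall x, is_derive f x (f' x)) -> (forall x, is_derive h x (h' x)) ->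
  (forall x, continuous f' x) -> (forall x, continuous h' x) ->
  f T * h T = f 0 * h 0 ->
  RInt (fun x => f' x * h x) 0 T = - RInt (fun x => f x * h' x) 0 T.
Proof.
  intros Hf Hh Cf Ch HT.
  assert (Cf0 : forall x, continuous f x) by (intros; eapply ct_derive; eauto).
  assert (Ch0 : forall x, continuous h x) by (intros; eapply ct_derive; eauto).
  assert (E := rint_derive (fun x => f x * h x) (fun x => f' x * h x + f x * h' x) 0 T).
  rewrite rint_plus in E by ctn.
  rewrite HT in E.
  assert (E' := E (fun x => Derive.is_derive_mult f h x _ _ (Hf x) (Hh x)) ltac:(ctn)).
  lra.
Qed.

Lemma ct_rint_param (F : R * R -> R) (a b x : R) : a <= b ->
  (forall p, continuous F p) ->
  continuous (fun x => RInt (fun t => F (x, t)) a b) x.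
Proof.
  intros Hab HF.
  assert (Ct : forall x t, continuous (fun t => F (x, t)) t).
  { intros y t. apply (continuous_comp_2 (fun _ => y) (fun t => t) (fun u v => F (u, v))).
    - apply continuous_const.
    - apply continuous_id.
    - eapply continuous_ext; [|apply HF]. now intros [u v]. }
  apply continuity_pt_filterlim.
  intros eps Heps.
  (* The [+ 1] keeps the denominator positive when [a = b]. *)
  destruct (uniform_continuity_2d_1d (fun t x => F (x, t)) a b x) with (eps := mkposreal (eps / (2 * (b - a + 1))) ltac:(apply Rdiv_lt_0_compat; lra)) as [d Hd].
  { intros t _. apply (ct_pair (fun p => F (snd p, fst p))).
    apply (continuous_comp_2 snd fst (fun u v => F (u, v))).
    - apply continuous_snd.
    - apply continuous_fst.
    - eapply continuous_ext; [|apply HF]. now intros [u v]. }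
  simpl in Hd.
  exists d; split; [apply cond_pos|].
  intros y [_ Hy]. simpl in *. unfold R_dist in *.
  assert (Hp := cond_pos d).
  rewrite <- rint_minus by auto.
  apply Rle_lt_trans with ((b - a) * (eps / (2 * (b - a + 1)))).
  - rewrite <- rint_const.
    apply rint_abs_le; auto; ctn.
    left. apply Hd; try lra; try (apply Rabs_def2 in Hy; lra).
    replace (x0 - x0) with 0 by ring. rewrite Rabs_R0. lra.
  - apply Rmult_lt_reg_r with (2 * (b - a + 1)); [lra|].
    field_simplify; try lra. nra.
Qed.

(** Both sides vanish when [b] is replaced by [a], and they have the same derivative with respect to
    that upper limit. *)
Lemma rint_fubini (F : R * R -> R) (a b c d : R) : a <= b -> c <= d ->
  (forall p, continuous F p) ->
  RInt (fun s => RInt (fun t => F (s, t)) c d) a b =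
  RInt (fun t => RInt (fun s => F (s, t)) a b) c d.
Proof.
  intros Hab Hcd HF.
  assert (HF' : forall p, continuous (fun p => F (snd p, fst p)) p).
  { intros [u0 v0]. apply (continuous_comp_2 snd fst (fun u v => F (u, v))).
    - apply continuous_snd.
    - apply continuous_fst.
    - eapply continuous_ext; [|apply HF]. now intros [u v]. }
  assert (C1 : forall y t, continuous (fun t => F (y, t)) t).
  { intros y t. apply (continuous_comp_2 (fun _ => y) (fun t => t) (fun u v => F (u, v))).
    - apply continuous_const.
    - apply continuous_id.
    - eapply continuous_ext; [|apply HF]. now intros [u v]. }
  assert (C2 : forall y t, continuous (fun t => F (t, y)) t).
  { intros y t. apply (continuous_comp_2 (fun t => t) (fun _ => y) (fun u v => F (u, v))).
    - apply continuous_id.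
    - apply continuous_const.
    - eapply continuous_ext; [|apply HF]. now intros [u v]. }
  assert (D : forall x t, is_derive (fun x => RInt (fun s => F (s, t)) a x) x (F (x, t))).
  { intros x t. apply (rint_upper_derive (fun s => F (s, t))). auto. }
  assert (Hd : forall x, is_derive (fun x => RInt (fun s => RInt (fun t => F (s, t)) c d) a x
     - RInt (fun t => RInt (fun s => F (s, t)) a x) c d) x 0).
  { intros x. evar_last.
    - apply (is_derive_minus (K := R_AbsRing) (V := R_NormedModule)
       (fun x => RInt (fun s => RInt (fun t => F (s, t)) c d) a x)
       (fun x => RInt (fun t => RInt (fun s => F (s, t)) a x) c d)).
      + apply (rint_upper_derive (fun s => RInt (fun t => F (s, t)) c d)).
        intros y; now apply ct_rint_param.
      + apply is_derive_RInt_param.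
        * apply filter_forall; intros y t _. eexists; apply D.
        * intros t _. eapply continuity_2d_pt_ext; [|apply (ct_pair F), HF].
          intros u v; simpl. symmetry; apply is_derive_unique, D.
        * apply filter_forall; intros y. apply rint_ex.
          (* Differentiation under the integral asks for integrability at upper limits [y] on both
             sides of [x], possibly to the left of [a]; there the orientation of the inner integral
             is reversed. *)
          destruct (Rle_dec a y) as [Hy|Hy].
          -- intros t. now apply (ct_rint_param (fun p => F (snd p, fst p))).
          -- intros t. eapply (continuous_ext (fun t => opp (RInt (fun s => F (s, t)) y a))).
             ++ intros t'. apply (opp_RInt_swap (V := R_CompleteNormedModule)). now apply rint_ex.
             ++ apply (ct_opp (fun t => RInt (fun s => F (s, t)) y a)).
                apply (ct_rint_param (fun p => F (snd p, fst p))); auto; lra.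
    - rewrite (rint_ext (fun t => Derive (fun u => RInt (fun s => F (s, t)) a u) x) (fun t => F (x, t))).
      + unfold minus, plus, opp; simpl. ring.
      + intros t. apply is_derive_unique, D. }
  assert (E := zero_derive_const _ Hd b a). simpl in E.
  rewrite RInt_point in E.
  rewrite (rint_ext (fun t => RInt (fun s => F (s, t)) a a) (fun _ => 0)), rint_const in E
    by (intros; apply (RInt_point (V := R_CompleteNormedModule))).
  unfold zero in E; simpl in E. lra.
Qed.

(** Weierstrass test: the tail at [x] is at most the tail of [bd], so the partial sums converge
    uniformly and limit and integral commute. *)
Lemma rint_series (f : nat -> R -> R) (F : R -> R) (bd : nat -> R) (a b : R) :
  a <= b ->
  (forall n x, continuous (f n) x) -> (forall x, continuous F x) ->
  (forall n x, Rabs (f n x) <= bd n) -> ex_series bd ->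
  (forall x, is_series (fun n => f n x) (F x)) ->
  is_series (fun n => RInt (f n) a b) (RInt F a b).
Proof.
  intros Hab Hf HF Hb Hs HS.
  assert (Hsum : forall n, is_RInt (fun x => sum_n (fun k => f k x) n) a b (sum_n (fun k => RInt (f k) a b) n)).
  { induction n as [|n IH].
    - rewrite sum_O. eapply is_RInt_ext; [|apply (RInt_correct (V := R_CompleteNormedModule)), (rint_ex (f 0%nat)), Hf].
      intros; now rewrite sum_O.
    - rewrite sum_Sn. eapply is_RInt_ext; [|apply (is_RInt_plus (V := R_NormedModule)); [exact IH|apply (RInt_correct (V := R_CompleteNormedModule)), (rint_ex (f (S n))), Hf]].
      intros; simpl. now rewrite sum_Sn. }
  destruct (filterlim_RInt (V := R_CompleteNormedModule) (fun n x => sum_n (fun k => f k x) n) a b eventually _ F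
     (fun n => sum_n (fun k => RInt (f k) a b) n) Hsum) as [If [H1 H2]].
  - apply filterlim_locally. intros eps.
    destruct Hs as [B HB].
    assert (HB' := proj1 (filterlim_locally _ _) HB eps).
    destruct HB' as [N HN]. exists N. intros n Hn x.
    specialize (HN n Hn).
    unfold ball in *; simpl in *; unfold AbsRing_ball, abs, minus, plus, opp in *; simpl in *.
    assert (T1 := Series_incr_n (fun n => f n x) (S n) ltac:(lia) ltac:(eexists; apply HS)).
    assert (T2 := Series_incr_n bd (S n) ltac:(lia) ltac:(eexists; apply HB)).
    rewrite (is_series_unique _ _ (HS x)) in T1.
    rewrite (is_series_unique _ _ HB) in T2. simpl pred in *.
    rewrite <- sum_n_Reals in T1, T2.
    rewrite T1. rewrite T2 in HN.
    assert (Hex : ex_series (fun k => bd (S n + k)%nat)).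
    { apply (ex_series_incr_n (K := R_AbsRing) (V := R_NormedModule)). now exists B. }
    assert (Hex2 : ex_series (fun k => Rabs (f (S n + k)%nat x))).
    { apply (ex_series_le (K := R_AbsRing) (V := R_CompleteNormedModule) _ (fun k => bd (S n + k)%nat)); [|exact Hex].
      intros k. unfold norm; simpl. unfold abs; simpl. rewrite Rabs_Rabsolu. apply Hb. }
    assert (K1 := Series_Rabs _ Hex2).
    assert (K2 : Series (fun k => Rabs (f (S n + k)%nat x)) <= Series (fun k => bd (S n + k)%nat)).
    { apply Series_le; [|exact Hex]. intros k; split; [apply Rabs_pos|apply Hb]. }
    cbv beta in K1.
    set (TA := Series (fun k => f (S n + k)%nat x)) in *.
    set (TB := Series (fun k => bd (S n + k)%nat)) in *.
    set (SA := sum_n (fun n => f n x) n) in *.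
    set (SB := sum_n bd n) in *.
    replace (SA + - (SA + TA)) with (- TA) by ring.
    assert (HN' : Rabs TB < eps).
    { rewrite <- Rabs_Ropp. replace (- TB) with (SB + - (SB + TB)) by ring. exact HN. }
    rewrite Rabs_Ropp.
    assert (TB <= Rabs TB) by apply Rle_abs. lra.
  - apply is_RInt_unique in H2. rewrite <- H2 in H1. exact H1.
Qed.

(** * Poisson kernels *)


(** Comparison with a telescoping series: $1/m^2 \le 2/(m(m+1))$ for $m \ge 1$. *)
Lemma ex_series_inv_sq : ex_series (fun n : nat => / INR (S n) ^ 2).
Proof.
  apply (ex_series_le (K := R_AbsRing) (V := R_CompleteNormedModule) _
    (fun n => 2 * (/ INR (S n) - / INR (S (S n))))).
  - intros n. unfold norm; simpl norm; unfold abs; simpl abs.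
    assert (H := lt_0_INR (S n) ltac:(lia)).
    rewrite (S_INR (S n)).
    rewrite Rabs_pos_eq by (left; apply Rinv_0_lt_compat, pow_lt, H).
    assert (1 <= INR (S n)) by (rewrite S_INR; assert (h := pos_INR n); lra).
    apply Rmult_le_reg_r with (INR (S n) ^ 2 * (INR (S n) + 1)).
    { apply Rmult_lt_0_compat; [apply pow_lt|]; lra. }
    field_simplify; try lra.
  - exists 2. apply filterlim_ext with (fun n => 2 - 2 * / INR (S (S n))).
    + induction x as [|n IH].
      * rewrite sum_O. simpl. field.
      * rewrite sum_Sn, <- IH.
        match goal with |- _ = plus ?u ?v => change (plus u v) with (u + v) end. ring.
    + change (is_lim_seq (fun n => 2 - 2 * / INR (S (S n))) 2).
      replace (Finite 2) with (Finite (2 - 2 * 0)) by (f_equal; ring).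
      apply is_lim_seq_minus'; [apply is_lim_seq_const|].
      apply (is_lim_seq_scal_l _ 2 (Finite 0)).
      apply (is_lim_seq_incr_1 (fun n => / INR (S n))), (is_lim_seq_incr_1 (fun n => / INR n)).
      replace (Finite 0) with (Rbar_inv p_infty) by reflexivity.
      apply is_lim_seq_inv; [apply is_lim_seq_INR | discriminate].
Qed.

Lemma series_abs_le (x b : nat -> R) :
  (forall n, Rabs (x n) <= b n) -> ex_series b ->
  ex_series x /\ Rabs (Series x) <= Series b.
Proof.
  intros H Hb.
  assert (H1 : ex_series (fun n => Rabs (x n))).
  { apply (ex_series_le (K := R_AbsRing) (V := R_CompleteNormedModule) _ b); [|exact Hb].
    intros n. unfold norm; simpl; unfold abs; simpl. rewrite Rabs_Rabsolu. apply H. }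
  split; [now apply ex_series_Rabs|].
  eapply Rle_trans; [now apply Series_Rabs|].
  apply Series_le; [|exact Hb]. intros n; split; [apply Rabs_pos|apply H].
Qed.

Lemma ex_series_cmul (c : R) (x : nat -> R) : ex_series x -> ex_series (fun n => c * x n).
Proof. exact (ex_series_scal (K := R_AbsRing) (V := R_NormedModule) c x). Qed.

(* [2 sum_{l >= 1} r^l cos (l t)] and [2 sum_{l >= 1} r^l sin (l t)] are
   [pois r t - 1] and [cpois r t]. *)
Definition pden (r t : R) : R := 1 - 2 * r * cos t + r ^ 2.
Definition pois (r t : R) : R := (1 - r ^ 2) / pden r t.
Definition cpois (r t : R) : R := 2 * r * sin t / pden r t.

Lemma pden_ge (r t : R) : 0 <= r -> (1 - r) ^ 2 <= pden r t.
Proof. intros Hr; unfold pden. destruct (COS_bound t). nra. Qed.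

Lemma pden_pos (r t : R) : 0 <= r < 1 -> 0 < pden r t.
Proof. intros Hr; eapply Rlt_le_trans; [|now apply pden_ge]. apply pow_lt; lra. Qed.

Lemma ct_pden (r t : R) : continuous (pden r) t.
Proof. unfold pden; ctn. Qed.

Lemma ct_pois (r t : R) : 0 <= r < 1 -> continuous (pois r) t.
Proof.
  intros Hr; unfold pois; unfold Rdiv. apply ct_mult; [ctn|]. apply ct_inv; [apply ct_pden|].
  apply Rgt_not_eq, pden_pos, Hr.
Qed.

Lemma ct_cpois (r t : R) : 0 <= r < 1 -> continuous (cpois r) t.
Proof.
  intros Hr; unfold cpois; unfold Rdiv. apply ct_mult; [ctn|]. apply ct_inv; [apply ct_pden|].
  apply Rgt_not_eq, pden_pos, Hr.
Qed.

Lemma is_lim_pow_bounded (r : R) (b : nat -> R) : 0 <= r < 1 ->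
  (forall n, Rabs (b n) <= 1) -> is_lim_seq (fun n => r ^ n * b n) 0.
Proof.
  intros Hr Hb. apply is_lim_seq_abs_0.
  apply is_lim_seq_le_le with (fun _ => 0) (fun n => r ^ n).
  - intros n; split; [apply Rabs_pos|].
    rewrite Rabs_mult, (Rabs_pos_eq (r ^ n)) by (apply pow_le; lra).
    assert (0 <= r ^ n) by (apply pow_le; lra). specialize (Hb n). nra.
  - apply is_lim_seq_const.
  - apply is_lim_seq_geom. rewrite Rabs_pos_eq; lra.
Qed.

(** For geometric-trigonometric series, multiplying a partial sum by the denominator [D] of the
    expected sum makes everything telescope except a boundary term [t n]. *)
Lemma is_series_of_tail (x t : nat -> R) (D l : R) : 0 < D ->
  (forall n, D * sum_n x n = l - t n) -> is_lim_seq t 0 -> is_series x (l / D).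
Proof.
  intros HD H Ht. unfold is_series.
  change (is_lim_seq (sum_n x) (l / D)).
  apply is_lim_seq_ext with (fun n => (l - t n) * / D).
  - intros n; rewrite <- H. field. lra.
  - replace (Finite (l / D)) with (Finite ((l - 0) * / D)) by (f_equal; field; lra).
    apply (is_lim_seq_scal_r (fun n => l - t n) (/ D) (Finite (l - 0))).
    apply is_lim_seq_minus'; [apply is_lim_seq_const | exact Ht].
Qed.

Lemma sin_series (r t : R) : 0 <= r < 1 ->
  is_series (fun n => r ^ S n * sin (INR (S n) * t)) (r * sin t / pden r t).
Proof.
  intros Hr. apply is_series_of_tail with
    (* By $\sin((m+1)t) = 2\cos t\,\sin(mt) - \sin((m-1)t)$, only the two top terms survive
       multiplication by [pden r t]. *)
    (t := fun n => r ^ 2 * (r ^ n * sin (INR (S (S n)) * t)) - r ^ 3 * (r ^ n * sin (INR (S n) * t))).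
  - now apply pden_pos.
  - induction n as [|n IH].
    + rewrite sum_O. unfold pden. simpl INR.
      replace ((1 + 1) * t) with (2 * t) by ring. rewrite sin_2a.
      replace (1 * t) with t by ring. simpl. ring.
    + rewrite sum_Sn.
      match goal with |- _ * plus ?u ?v = _ => change (plus u v) with (u + v) end.
      rewrite Rmult_plus_distr_l, IH. unfold pden.
      assert (E : sin (INR (S (S (S n))) * t) = 2 * cos t * sin (INR (S (S n)) * t) - sin (INR (S n) * t)).
      { replace (INR (S (S (S n))) * t) with (INR (S (S n)) * t + t) by (rewrite (S_INR (S (S n))); ring).
        replace (INR (S n) * t) with (INR (S (S n)) * t - t) by (rewrite (S_INR (S n)); ring).
        rewrite sin_plus, sin_minus. ring. }
      rewrite E.
      change (r ^ S (S n)) with (r * (r * r ^ n)). change (r ^ S n) with (r * r ^ n). ring.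
  - replace (Finite 0) with (Finite (r ^ 2 * 0 - r ^ 3 * 0)) by (f_equal; ring).
    apply is_lim_seq_minus'.
    + apply (is_lim_seq_scal_l _ (r ^ 2) (Finite 0)), is_lim_pow_bounded; auto.
      intros n; apply Rabs_le; apply SIN_bound.
    + apply (is_lim_seq_scal_l _ (r ^ 3) (Finite 0)), is_lim_pow_bounded; auto.
      intros n; apply Rabs_le; apply SIN_bound.
Qed.

Lemma cos_series (r t : R) : 0 <= r < 1 ->
  is_series (fun n => r ^ S n * cos (INR (S n) * t)) ((r * cos t - r ^ 2) / pden r t).
Proof.
  intros Hr. apply is_series_of_tail with
    (t := fun n => r ^ 2 * (r ^ n * cos (INR (S (S n)) * t)) - r ^ 3 * (r ^ n * cos (INR (S n) * t))).
  - now apply pden_pos.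
  - induction n as [|n IH].
    + rewrite sum_O. unfold pden. simpl INR.
      replace ((1 + 1) * t) with (2 * t) by ring. rewrite cos_2a_cos.
      replace (1 * t) with t by ring. simpl. ring.
    + rewrite sum_Sn.
      match goal with |- _ * plus ?u ?v = _ => change (plus u v) with (u + v) end.
      rewrite Rmult_plus_distr_l, IH. unfold pden.
      assert (E : cos (INR (S (S (S n))) * t) = 2 * cos t * cos (INR (S (S n)) * t) - cos (INR (S n) * t)).
      { replace (INR (S (S (S n))) * t) with (INR (S (S n)) * t + t) by (rewrite (S_INR (S (S n))); ring).
        replace (INR (S n) * t) with (INR (S (S n)) * t - t) by (rewrite (S_INR (S n)); ring).
        rewrite cos_plus, cos_minus. ring. }
      rewrite E.
      change (r ^ S (S n)) with (r * (r * r ^ n)). change (r ^ S n) with (r * r ^ n). ring.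
  - replace (Finite 0) with (Finite (r ^ 2 * 0 - r ^ 3 * 0)) by (f_equal; ring).
    apply is_lim_seq_minus'.
    + apply (is_lim_seq_scal_l _ (r ^ 2) (Finite 0)), is_lim_pow_bounded; auto.
      intros n; apply Rabs_le; apply COS_bound.
    + apply (is_lim_seq_scal_l _ (r ^ 3) (Finite 0)), is_lim_pow_bounded; auto.
      intros n; apply Rabs_le; apply COS_bound.
Qed.

(** Fourier integrals without the usual factor [1 / PI]; this is the origin of the factors [PI] in
    the Parseval identities. *)
Definition fcos (f : R -> R) (n : nat) : R := RInt (fun z => f z * cos (INR n * z)) 0 (2 * PI).
Definition fsin (f : R -> R) (n : nat) : R := RInt (fun z => f z * sin (INR n * z)) 0 (2 * PI).

Lemma two_pi_pos : 0 < 2 * PI.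
Proof. assert (H := PI_RGT_0); lra. Qed.

Lemma ex_series_pow_S (r B : R) : 0 <= r < 1 -> ex_series (fun n => r ^ S n * B).
Proof.
  intros Hr. apply (ex_series_ext (fun n => (r * B) * r ^ n)).
  - intros n; simpl; ring.
  - apply ex_series_cmul, ex_series_geom. rewrite Rabs_pos_eq; lra.
Qed.

Lemma rabs_pow_bound (r B x y : R) (n : nat) : 0 <= r < 1 -> Rabs x <= 1 -> Rabs y <= B ->
  Rabs (r ^ n * x * y) <= r ^ n * B.
Proof.
  intros Hr Hx Hy. assert (0 <= r ^ n) by (apply pow_le; lra).
  rewrite !Rabs_mult, (Rabs_pos_eq (r ^ n)) by lra.
  assert (h := Rabs_pos x). assert (h' := Rabs_pos y).
  rewrite Rmult_assoc. apply Rmult_le_compat_l; [lra|]. nra.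
Qed.

(** Abel sums of the Fourier series: the geometric factor allows [cos_series], taken at [x - z], to
    be integrated term by term against [f]. *)
Lemma poisson_series (f : R -> R) (B r x : R) : 0 <= r < 1 ->
  (forall z, continuous f z) -> (forall z, Rabs (f z) <= B) ->
  is_series (fun n => r ^ S n * (fcos f (S n) * cos (INR (S n) * x) + fsin f (S n) * sin (INR (S n) * x)))
    ((RInt (fun z => pois r (x - z) * f z) 0 (2 * PI) - RInt f 0 (2 * PI)) / 2).
Proof.
  intros Hr Hf HB.
  assert (Hp := fun t => ct_pois r t Hr).
  assert (E : (RInt (fun z => pois r (x - z) * f z) 0 (2 * PI) - RInt f 0 (2 * PI)) / 2
    = RInt (fun z => (r * cos (x - z) - r ^ 2) / pden r (x - z) * f z) 0 (2 * PI)).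
  { rewrite <- rint_minus by ctn. unfold Rdiv at 1. rewrite Rmult_comm, <- rint_scal by ctn.
    apply rint_ext; intros z. unfold pois. assert (H := pden_pos r (x - z) Hr).
    field_simplify; try lra. unfold pden. field. unfold pden in H. lra. }
  rewrite E.
  eapply is_series_ext; [|apply (rint_series (fun n z => r ^ S n * cos (INR (S n) * (x - z)) * f z)
    (fun z => (r * cos (x - z) - r ^ 2) / pden r (x - z) * f z) (fun n => r ^ S n * B) 0 (2 * PI))].
  - intros n. cbv beta. unfold fcos, fsin.
    rewrite !(Rmult_comm (RInt _ _ _)), <- !rint_scal, <- rint_plus, <- rint_scal by ctn.
    apply rint_ext; intros z.
    rewrite Rmult_minus_distr_l, cos_minus. ring.
  - left; apply two_pi_pos.
  - intros n z; ctn.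
  - intros z. apply ct_mult; [|ctn].
    apply ct_mult; [ctn|]. apply ct_inv; [apply (continuous_comp (fun z => x - z) (pden r)); [ctn|apply ct_pden]|].
    apply Rgt_not_eq, pden_pos, Hr.
  - intros n z. apply rabs_pow_bound; auto. apply Rabs_le, COS_bound.
  - now apply ex_series_pow_S.
  - intros z. rewrite Rmult_comm.
    eapply is_series_ext; [|apply (is_series_scal (K := R_AbsRing) (V := R_NormedModule) (f z)), (cos_series r (x - z) Hr)].
    intros n; unfold scal; simpl; unfold mult; simpl. ring.
Qed.

Lemma cpoisson_series (f : R -> R) (B r x : R) : 0 <= r < 1 ->
  (forall z, continuous f z) -> (forall z, Rabs (f z) <= B) ->
  is_series (fun n => r ^ S n * (fcos f (S n) * sin (INR (S n) * x) - fsin f (S n) * cos (INR (S n) * x)))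
    (RInt (fun z => cpois r (x - z) * f z) 0 (2 * PI) / 2).
Proof.
  intros Hr Hf HB.
  assert (Hp := fun t => ct_cpois r t Hr).
  assert (E : RInt (fun z => cpois r (x - z) * f z) 0 (2 * PI) / 2
    = RInt (fun z => (r * sin (x - z)) / pden r (x - z) * f z) 0 (2 * PI)).
  { unfold Rdiv at 1. rewrite Rmult_comm, <- rint_scal by ctn.
    apply rint_ext; intros z. unfold cpois. assert (H := pden_pos r (x - z) Hr).
    field. lra. }
  rewrite E.
  eapply is_series_ext; [|apply (rint_series (fun n z => r ^ S n * sin (INR (S n) * (x - z)) * f z)
    (fun z => (r * sin (x - z)) / pden r (x - z) * f z) (fun n => r ^ S n * B) 0 (2 * PI))].
  - intros n. cbv beta. unfold fcos, fsin.
    rewrite !(Rmult_comm (RInt _ _ _)), <- !rint_scal, <- rint_minus, <- rint_scal by ctn.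
    apply rint_ext; intros z.
    rewrite Rmult_minus_distr_l, sin_minus. ring.
  - left; apply two_pi_pos.
  - intros n z; ctn.
  - intros z. apply ct_mult; [|ctn].
    apply ct_mult; [ctn|]. apply ct_inv; [apply (continuous_comp (fun z => x - z) (pden r)); [ctn|apply ct_pden]|].
    apply Rgt_not_eq, pden_pos, Hr.
  - intros n z. apply rabs_pow_bound; auto. apply Rabs_le, SIN_bound.
  - now apply ex_series_pow_S.
  - intros z. rewrite Rmult_comm.
    eapply is_series_ext; [|apply (is_series_scal (K := R_AbsRing) (V := R_NormedModule) (f z)), (sin_series r (x - z) Hr)].
    intros n; unfold scal; simpl; unfold mult; simpl. ring.
Qed.

Lemma sin_nat_2pi (n : nat) : sin (INR n * (2 * PI)) = 0.
Proof.
  replace (INR n * (2 * PI)) with (0 + 2 * INR n * PI) by ring.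
  now rewrite sin_period, sin_0.
Qed.

Lemma cos_nat_2pi (n : nat) : cos (INR n * (2 * PI)) = 1.
Proof.
  replace (INR n * (2 * PI)) with (0 + 2 * INR n * PI) by ring.
  now rewrite cos_period, cos_0.
Qed.

Lemma rint_cos_nat (n : nat) : RInt (fun z => cos (INR (S n) * z)) 0 (2 * PI) = 0.
Proof.
  assert (H : INR (S n) <> 0) by (apply not_0_INR; lia).
  rewrite (rint_derive (fun z => / INR (S n) * sin (INR (S n) * z)) (fun z => cos (INR (S n) * z))).
  - toR. rewrite sin_nat_2pi, (Rmult_0_r (INR (S n))), sin_0. ring.
  - intros z. generalize dependent (INR (S n)). intros k Hk. auto_derive; [exact I|]. field. exact Hk.
  - intros; ctn.
Qed.

Lemma rint_sin_nat (n : nat) : RInt (fun z => sin (INR (S n) * z)) 0 (2 * PI) = 0.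
Proof.
  assert (H : INR (S n) <> 0) by (apply not_0_INR; lia).
  rewrite (rint_derive (fun z => - / INR (S n) * cos (INR (S n) * z)) (fun z => sin (INR (S n) * z))).
  - toR. rewrite cos_nat_2pi, (Rmult_0_r (INR (S n))), cos_0. ring.
  - intros z. generalize dependent (INR (S n)). intros k Hk. auto_derive; [exact I|]. field. exact Hk.
  - intros; ctn.
Qed.

(** The constant function 1 has no Fourier coefficient of positive index, so its Abel sum in
    [poisson_series] is zero. *)
Lemma rint_pois (r x : R) : 0 <= r < 1 ->
  RInt (fun z => pois r (x - z)) 0 (2 * PI) = 2 * PI.
Proof.
  intros Hr.
  assert (H := poisson_series (fun _ => 1) 1 r x Hr (fun z => continuous_const 1 z)
     (fun _ => Req_le _ _ Rabs_R1)).
  apply is_series_unique in H.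
  (* The zero term is written as a product so that [Series_scal_l] evaluates the sum. *)
  rewrite (Series_ext _ (fun _ => 0 * 0)) in H.
  - rewrite Series_scal_l, rint_const, Rmult_0_l in H.
    rewrite (rint_ext (fun z => pois r (x - z)) (fun z => pois r (x - z) * 1)) by (intros; ring).
    lra.
  - intros n. unfold fcos, fsin.
    rewrite (rint_ext (fun z => 1 * cos (INR (S n) * z)) (fun z => cos (INR (S n) * z))) by (intros; ring).
    rewrite (rint_ext (fun z => 1 * sin (INR (S n) * z)) (fun z => sin (INR (S n) * z))) by (intros; ring).
    rewrite rint_cos_nat, rint_sin_nat. ring.
Qed.

Lemma pois_pos (r t : R) : 0 <= r < 1 -> 0 <= pois r t.
Proof.
  intros Hr. unfold pois. apply Rdiv_le_0_compat; [nra|now apply pden_pos].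
Qed.

(* [pden r t = (1 - r)^2 + 2 r (1 - cos t)] turns [pois * (1 - cos)] into a
   combination of [1] and [pois]. *)
Lemma rint_pois_cos (r x : R) : 0 < r < 1 ->
  RInt (fun z => pois r (x - z) * (1 - cos (x - z))) 0 (2 * PI) = 2 * PI * (1 - r).
Proof.
  intros Hr. assert (Hr' : 0 <= r < 1) by lra.
  assert (Hp := fun t => ct_pois r t Hr').
  rewrite (rint_ext _ (fun z => (1 - r ^ 2) / (2 * r) - (1 - r) ^ 2 / (2 * r) * pois r (x - z))).
  - rewrite rint_minus, rint_scal, rint_const, rint_pois by first [lra | ctn].
    toR. field. lra.
  - intros z. unfold pois. assert (H := pden_pos r (x - z) Hr').
    unfold pden in *. field. split; lra.
Qed.

(** The arithmetic-geometric inequality gives $|f(z)-f(x)| \le e + |f(z)-f(x)|^2/(4e)$. The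
    hypothesis bounds the square by a multiple of $1-\cos$, whose integral against the kernel is
    exactly $2\pi(1-r) = 2\pi e^2$, so both parts are O(e). *)
Lemma poisson_approx (f : R -> R) (L e x : R) : 0 < e < 1 ->
  (forall z, continuous f z) ->
  (forall y z, (f y - f z) ^ 2 <= L * (1 - cos (y - z))) ->
  Rabs (RInt (fun z => pois (1 - e ^ 2) (x - z) * f z) 0 (2 * PI) - 2 * PI * f x)
    <= 2 * PI * ((1 + L / 4) * e).
Proof.
  intros He Hf HL. set (r := 1 - e ^ 2).
  assert (Hr : 0 < r < 1) by (unfold r; nra). assert (Hr' : 0 <= r < 1) by lra.
  assert (Hp := fun t => ct_pois r t Hr').
  rewrite <- (rint_pois r x) at 2 by exact Hr'.
  rewrite (Rmult_comm (RInt _ _ _)), <- rint_scal, <- rint_minus by ctn.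
  eapply Rle_trans.
  - apply (rint_abs_le _ (fun z => e * pois r (x - z) + L / (4 * e) * (pois r (x - z) * (1 - cos (x - z))))).
    + left; apply two_pi_pos.
    + ctn.
    + ctn.
    + intros z _.
      replace (pois r (x - z) * f z - f x * pois r (x - z)) with (pois r (x - z) * (f z - f x)) by ring.
      assert (H0 := pois_pos r (x - z) Hr').
      rewrite Rabs_mult, Rabs_pos_eq by exact H0.
      replace (e * pois r (x - z) + L / (4 * e) * (pois r (x - z) * (1 - cos (x - z)))) with
        (pois r (x - z) * (e + L * (1 - cos (x - z)) / (4 * e))) by (field; lra).
      apply Rmult_le_compat_l; [exact H0|].
      specialize (HL x z).
      assert (HL' : Rabs (f z - f x) ^ 2 <= L * (1 - cos (x - z))).
      { rewrite pow2_abs. replace ((f z - f x) ^ 2) with ((f x - f z) ^ 2) by ring. exact HL. }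
      set (A := Rabs (f z - f x)) in *. set (K := L * (1 - cos (x - z))) in *.
      apply Rmult_le_reg_r with (4 * e); [lra|].
      replace ((e + K / (4 * e)) * (4 * e)) with (4 * e * e + K) by (field; lra).
      assert (0 <= (A - 2 * e) ^ 2) by apply pow2_ge_0. nra.
  - rewrite rint_plus, !rint_scal, rint_pois, rint_pois_cos by first [lra | ctn].
    replace (1 - r) with (e ^ 2) by (unfold r; ring).
    apply Req_le. field. lra.
Qed.

(** The Abel sum is the pairing of [h] with half the Poisson integral of [f] minus [RInt f].
    Replacing the Poisson integral by [2 PI f] costs the error of [poisson_approx]. Regularity is
    asked of [f] alone, so [h] may be [u' - 1]. *)
Lemma abel_parseval (f h : R -> R) (L Bf Bh e : R) : 0 < e < 1 ->
  (forall z, continuous f z) -> (forall z, continuous h z) ->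
  (forall z, Rabs (f z) <= Bf) -> (forall z, Rabs (h z) <= Bh) ->
  (forall y z, (f y - f z) ^ 2 <= L * (1 - cos (y - z))) ->
  Rabs (Series (fun n => (1 - e ^ 2) ^ S n * (fcos f (S n) * fcos h (S n) + fsin f (S n) * fsin h (S n)))
     - (PI * RInt (fun z => f z * h z) 0 (2 * PI) - RInt f 0 (2 * PI) * RInt h 0 (2 * PI) / 2))
   <= 2 * PI * (PI * ((1 + L / 4) * e) * Bh).
Proof.
  intros He Hf Hh HBf HBh HL. set (r := 1 - e ^ 2).
  assert (Hr : 0 < r < 1) by (unfold r; nra). assert (Hr' : 0 <= r < 1) by lra.
  assert (Hp := fun t => ct_pois r t Hr').
  assert (H2 := two_pi_pos).
  assert (CP : forall x, continuous (fun x => RInt (fun z => pois r (x - z) * f z) 0 (2 * PI)) x).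
  { intros x. apply (ct_rint_param (fun p => pois r (fst p - snd p) * f (snd p))); [lra|].
    ctn. }
  assert (Bc : forall n, Rabs (fcos f n) <= 2 * PI * Bf).
  { intros n. unfold fcos. replace (2 * PI * Bf) with ((2 * PI - 0) * Bf) by ring.
    apply abs_RInt_le_const; [lra|apply rint_ex; ctn|]. intros t _.
    rewrite Rabs_mult. assert (Hc := Rabs_le _ _ (COS_bound (INR n * t))).
    assert (q := Rabs_pos (f t)). assert (q' := Rabs_pos (cos (INR n * t))). specialize (HBf t).
    rewrite <- (Rmult_1_r Bf). apply Rmult_le_compat; assumption. }
  assert (Bs : forall n, Rabs (fsin f n) <= 2 * PI * Bf).
  { intros n. unfold fsin. replace (2 * PI * Bf) with ((2 * PI - 0) * Bf) by ring.
    apply abs_RInt_le_const; [lra|apply rint_ex; ctn|]. intros t _.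
    rewrite Rabs_mult. assert (Hc := Rabs_le _ _ (SIN_bound (INR n * t))).
    assert (q := Rabs_pos (f t)). assert (q' := Rabs_pos (sin (INR n * t))). specialize (HBf t).
    rewrite <- (Rmult_1_r Bf). apply Rmult_le_compat; assumption. }
  assert (HS : is_series (fun n => r ^ S n * (fcos f (S n) * fcos h (S n) + fsin f (S n) * fsin h (S n)))
    (RInt (fun x => (RInt (fun z => pois r (x - z) * f z) 0 (2 * PI) - RInt f 0 (2 * PI)) / 2 * h x) 0 (2 * PI))).
  { eapply is_series_ext; [|apply (rint_series
      (fun n x => r ^ S n * (fcos f (S n) * cos (INR (S n) * x) + fsin f (S n) * sin (INR (S n) * x)) * h x)
      _ (fun n => r ^ S n * (4 * PI * Bf * Bh)))].
    - intros n. cbv beta.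
      unfold fcos at 3, fsin at 3. rewrite <- !rint_scal, <- rint_plus, <- rint_scal by ctn.
      apply rint_ext; intros z. ring.
    - lra.
    - intros; ctn.
    - intros; apply ct_mult; [|ctn]. apply ct_mult; [|ctn]. apply ct_minus; ctn.
    - intros n x.
      replace (r ^ S n * (fcos f (S n) * cos (INR (S n) * x) + fsin f (S n) * sin (INR (S n) * x)) * h x)
       with (r ^ S n * ((fcos f (S n) * cos (INR (S n) * x) + fsin f (S n) * sin (INR (S n) * x)) * h x)) by ring.
      assert (0 <= r ^ S n) by (apply pow_le; lra).
      rewrite Rabs_mult, Rabs_pos_eq by assumption. apply Rmult_le_compat_l; [assumption|].
      rewrite Rabs_mult. specialize (HBh x). assert (q := Rabs_pos (h x)).
      apply Rmult_le_compat; try apply Rabs_pos; [|exact HBh].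
      eapply Rle_trans; [apply Rabs_triang|]. rewrite !Rabs_mult.
      assert (Hc := Rabs_le _ _ (COS_bound (INR (S n) * x))).
      assert (Hs := Rabs_le _ _ (SIN_bound (INR (S n) * x))).
      specialize (Bc (S n)). specialize (Bs (S n)).
      assert (Rabs (fcos f (S n)) * Rabs (cos (INR (S n) * x)) <= 2 * PI * Bf * 1)
        by (apply Rmult_le_compat; try apply Rabs_pos; assumption).
      assert (Rabs (fsin f (S n)) * Rabs (sin (INR (S n) * x)) <= 2 * PI * Bf * 1)
        by (apply Rmult_le_compat; try apply Rabs_pos; assumption).
      lra.
    - now apply ex_series_pow_S.
    - intros x. rewrite Rmult_comm.
      eapply is_series_ext; [|apply (is_series_scal (K := R_AbsRing) (V := R_NormedModule) (h x)), (poisson_series f Bf r x Hr' Hf HBf)].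
      intros n; unfold scal; simpl; unfold mult; simpl. ring. }
  rewrite (is_series_unique _ _ HS).
  assert (E : PI * RInt (fun z => f z * h z) 0 (2 * PI) - RInt f 0 (2 * PI) * RInt h 0 (2 * PI) / 2
     = RInt (fun z => PI * (f z * h z) - RInt f 0 (2 * PI) / 2 * h z) 0 (2 * PI)).
  { rewrite rint_minus, !rint_scal by ctn. field. }
  rewrite E, <- rint_minus.
  2: { intros; apply ct_mult; [|ctn]. apply ct_mult; [|ctn]. apply ct_minus; ctn. }
  2: { ctn. }
  replace (2 * PI * (PI * ((1 + L / 4) * e) * Bh)) with ((2 * PI - 0) * (PI * ((1 + L / 4) * e) * Bh)) by ring.
  apply abs_RInt_le_const; [lra|apply rint_ex|].
  { intros. apply ct_minus; [apply ct_mult; [|ctn]; apply ct_mult; [|ctn]; apply ct_minus; ctn|ctn]. }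
  intros x _.
  match goal with |- Rabs ?t <= _ => replace t with
    ((RInt (fun z => pois r (x - z) * f z) 0 (2 * PI) - 2 * PI * f x) / 2 * h x) by field end.
  rewrite Rabs_mult. apply Rmult_le_compat; try apply Rabs_pos; [|apply HBh].
  unfold Rdiv. rewrite Rabs_mult, (Rabs_pos_eq (/ 2)) by lra.
  assert (H := poisson_approx f L e x He Hf HL). fold r in H. lra.
Qed.

(** * Parseval identity and the conjugate Poisson kernel *)


(** The form in which limits [e -> 0] are taken in later estimates; [K] has no prescribed sign and
    may depend on everything but [e]. *)
Lemma le_0_of_small (X K : R) : (forall e, 0 < e < 1 -> X <= K * e) -> X <= 0.
Proof.
  intros H. destruct (Rle_dec X 0) as [|Hn]; [assumption|]. exfalso.
  assert (HX : 0 < X) by lra. assert (h := Rle_abs K). assert (h0 := Rabs_pos K).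
  (* Chosen so that [e < 1] and [K * e < X]. *)
  set (e := X / (2 * (X + Rabs K + 1))).
  assert (He : 0 < e) by (apply Rdiv_lt_0_compat; lra).
  assert (E : e * (2 * (X + Rabs K + 1)) = X) by (unfold e; field; lra).
  assert (e < 1) by nra.
  specialize (H e ltac:(lra)). nra.
Qed.

(** Cubic decay makes $\sum_n n|x_n|$ finite. As $1 - r^n \le n e^2$ by Bernoulli, removing the Abel
    factor costs only $O(e^2)$, and [e -> 0] in [abel_parseval] gives the exact identity. *)
Lemma parseval_cubic (f h : R -> R) (L Bf Bh B : R) :
  (forall z, continuous f z) -> (forall z, continuous h z) ->
  (forall z, Rabs (f z) <= Bf) -> (forall z, Rabs (h z) <= Bh) ->
  (forall y z, (f y - f z) ^ 2 <= L * (1 - cos (y - z))) ->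
  (forall n, Rabs (fcos f (S n) * fcos h (S n) + fsin f (S n) * fsin h (S n)) <= B / INR (S n) ^ 3) ->
  Series (fun n => fcos f (S n) * fcos h (S n) + fsin f (S n) * fsin h (S n)) =
  PI * RInt (fun z => f z * h z) 0 (2 * PI) - RInt f 0 (2 * PI) * RInt h 0 (2 * PI) / 2.
Proof.
  intros Hf Hh HBf HBh HL HB.
  set (x := fun n => fcos f (S n) * fcos h (S n) + fsin f (S n) * fsin h (S n)) in *.
  set (T := PI * RInt (fun z => f z * h z) 0 (2 * PI) - RInt f 0 (2 * PI) * RInt h 0 (2 * PI) / 2).
  assert (HI : forall n, 1 <= INR (S n)).
  { intros n. rewrite S_INR. assert (q := pos_INR n). lra. }
  assert (HB2 : forall n, INR (S n) * Rabs (x n) <= B * / INR (S n) ^ 2).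
  { intros n. specialize (HB n). specialize (HI n). fold (x n) in HB.
    replace (B * / INR (S n) ^ 2) with (INR (S n) * (B / INR (S n) ^ 3)) by (field; lra).
    apply Rmult_le_compat_l; [lra|exact HB]. }
  assert (Hx : ex_series x).
  { apply (series_abs_le x (fun n => B * / INR (S n) ^ 2)).
    - intros n. eapply Rle_trans; [|apply HB2]. specialize (HI n). assert (q := Rabs_pos (x n)). nra.
    - apply ex_series_cmul, ex_series_inv_sq. }
  set (Z2 := Series (fun n => B * / INR (S n) ^ 2)).
  set (K := Z2 + 2 * PI * (PI * (1 + L / 4) * Bh)).
  enough (H : Rabs (Series x - T) <= 0).
  { assert (q := Rabs_pos (Series x - T)). apply Rminus_diag_uniq.
    destruct (Req_dec (Series x - T) 0) as [|Hn]; [assumption|]. apply Rabs_pos_lt in Hn. lra. }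
  apply le_0_of_small with K. intros e He.
  set (r := 1 - e ^ 2). assert (Hr : 0 < r < 1) by (unfold r; nra).
  assert (A := abel_parseval f h L Bf Bh e He Hf Hh HBf HBh HL). fold r T in A.
  change (fun n => r ^ S n * (fcos f (S n) * fcos h (S n) + fsin f (S n) * fsin h (S n)))
    with (fun n => r ^ S n * x n) in A.
  assert (Hpow : forall n, 0 <= 1 - r ^ n <= INR n * e ^ 2).
  { induction n as [|n IH].
    - simpl. lra.
    - rewrite S_INR. change (r ^ S n) with (r * r ^ n).
      assert (P0 : 0 <= r ^ n) by (apply pow_le; lra).
      assert (P1 : r ^ n <= 1) by lra.
      replace (1 - r * r ^ n) with ((1 - r ^ n) + e ^ 2 * r ^ n) by (unfold r; ring).
      assert (0 <= e ^ 2) by apply pow2_ge_0. nra. }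
  assert (D : forall n, Rabs (x n - r ^ S n * x n) <= e ^ 2 * (B * / INR (S n) ^ 2)).
  { intros n. replace (x n - r ^ S n * x n) with ((1 - r ^ S n) * x n) by ring.
    rewrite Rabs_mult. specialize (Hpow (S n)). rewrite (Rabs_pos_eq (1 - r ^ S n)) by lra.
    specialize (HB2 n). assert (q := Rabs_pos (x n)).
    apply Rle_trans with (INR (S n) * e ^ 2 * Rabs (x n)).
    - apply Rmult_le_compat_r; lra.
    - assert (0 <= e ^ 2) by apply pow2_ge_0. nra. }
  assert (D' := series_abs_le _ _ D (ex_series_cmul _ _ (ex_series_cmul _ _ ex_series_inv_sq))).
  rewrite Series_scal_l in D'. fold Z2 in D'. destruct D' as [D1 D2].
  assert (Hrx : ex_series (fun n => r ^ S n * x n)).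
  { apply (ex_series_ext (fun n => x n - (x n - r ^ S n * x n))).
    - intros n; toR; ring.
    - exact (ex_series_minus (K := R_AbsRing) (V := R_NormedModule) _ _ Hx D1). }
  rewrite Series_minus in D2 by assumption.
  assert (0 <= Z2).
  { eapply Rle_trans; [apply (Rabs_pos (Series x))|]. apply series_abs_le.
    - intros n. eapply Rle_trans; [|apply HB2]. specialize (HI n). assert (q := Rabs_pos (x n)). nra.
    - apply ex_series_cmul, ex_series_inv_sq. }
  replace (Series x - T) with ((Series x - Series (fun n => r ^ S n * x n)) + (Series (fun n => r ^ S n * x n) - T)) by ring.
  eapply Rle_trans; [apply Rabs_triang|].
  unfold K. assert (e ^ 2 * Z2 <= e * Z2) by (apply Rmult_le_compat_r; nra).
  lra.
Qed.

(** From $\sin h \ge h - h^3/6$ and $h^2 \le 4$, the latter by the crude bound $\pi \le 4$. *)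
Lemma sin_ge_third (h : R) : 0 <= h <= PI / 2 -> h <= 3 * sin h.
Proof.
  intros Hh. assert (H4 := PI_4). assert (H0 := PI_RGT_0).
  destruct (sin_bound h 0 ltac:(lra) ltac:(lra)) as [H _].
  unfold sin_approx, sin_term in H. simpl in H.
  assert (E : h - h * h * h / 6 <= sin h) by (eapply Rle_trans; [|exact H]; apply Req_le; field).
  assert (h * h <= 4) by nra. nra.
Qed.

(** The difference $\sin h - h\cos h$ is the integral of $t \sin t$ over $[0,h]$. *)
Lemma mul_cos_le_sin (h : R) : 0 <= h <= PI -> h * cos h <= sin h.
Proof.
  intros Hh.
  assert (E : RInt (fun t => t * sin t) 0 h = (sin h - h * cos h) - (sin 0 - 0 * cos 0)).
  { apply (rint_derive (fun t => sin t - t * cos t)).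
    - intros x. auto_derive; [exact I|]. ring.
    - ctn. }
  assert (P : 0 <= RInt (fun t => t * sin t) 0 h).
  { apply RInt_ge_0; [lra|apply rint_ex; ctn|]. intros x Hx.
    apply Rmult_le_pos; [lra|]. apply sin_ge_0; lra. }
  rewrite E, sin_0 in P. lra.
Qed.

(** It equals [(1 - r) / (1 + r) * pois r t]: of order 1 near [t = 0], where the regularized
    cotangent is no longer decreasing, but small in the mean. *)
Definition eta (r t : R) : R := (1 - r) ^ 2 / pden r t.

Lemma pden_half (r t : R) : pden r t = (1 - r) ^ 2 + 4 * r * sin (t / 2) ^ 2.
Proof.
  unfold pden. replace (cos t) with (cos (2 * (t / 2))) by (f_equal; field).
  rewrite cos_2a_sin. ring.
Qed.

(** At $r = 1$ this is $\cot(\alpha/2) - \cot(\beta/2) = \sin((\beta-\alpha)/2) /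
    (\sin(\alpha/2)\sin(\beta/2))$; the term with $(1-r)^2$ is the effect of the regularization. *)
Lemma cpois_sub (r al be : R) : 0 <= r < 1 ->
  cpois r al - cpois r be =
  4 * r * sin ((be - al) / 2) *
   (4 * r * sin (al / 2) * sin (be / 2) - (1 - r) ^ 2 * cos ((al + be) / 2)) / (pden r al * pden r be).
Proof.
  intros Hr. assert (H1 := pden_pos r al Hr). assert (H2 := pden_pos r be Hr).
  unfold cpois.
  replace (2 * r * sin al / pden r al - 2 * r * sin be / pden r be) with
    ((2 * r * sin al * pden r be - 2 * r * sin be * pden r al) / (pden r al * pden r be)) by (field; lra).
  f_equal. rewrite !pden_half.
  replace (sin al) with (sin (2 * (al / 2))) by (f_equal; field).
  replace (sin be) with (sin (2 * (be / 2))) by (f_equal; field).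
  replace ((be - al) / 2) with (be / 2 - al / 2) by field.
  replace ((al + be) / 2) with (al / 2 + be / 2) by field.
  rewrite !sin_2a, sin_minus, cos_plus.
  assert (E1 := sin2_cos2 (al / 2)). assert (E2 := sin2_cos2 (be / 2)). unfold Rsqr in *.
  set (sa := sin (al / 2)) in *. set (ca := cos (al / 2)) in *.
  set (sb := sin (be / 2)) in *. set (cb := cos (be / 2)) in *.
  (* The product formula for $\sin\alpha - \sin\beta$, halved and written in half angles. *)
  assert (F1 : sa * ca - sb * cb = (ca * cb - sa * sb) * (sa * cb - ca * sb)).
  { replace ((ca * cb - sa * sb) * (sa * cb - ca * sb)) with
     (sa * ca * (sb * sb + cb * cb) - sb * cb * (sa * sa + ca * ca)) by ring.
    rewrite E1, E2. ring. }
  assert (F2 : sa * ca = sb * cb + (ca * cb - sa * sb) * (sa * cb - ca * sb)) by lra.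
  replace (2 * r * (2 * sa * ca) * ((1 - r) ^ 2 + 4 * r * sb ^ 2) - 2 * r * (2 * sb * cb) * ((1 - r) ^ 2 + 4 * r * sa ^ 2))
   with (4 * r * ((1 - r) ^ 2 * (sa * ca - sb * cb) + 4 * r * sa * sb * (ca * sb - cb * sa))) by ring.
  rewrite F1. ring.
Qed.

(* On [0, 2 PI] the conjugate kernel is strongly decreasing, up to an error
   which is negligible in the mean as [r] tends to 1. *)
Lemma cpois_strongly_decreasing (r al be : R) : 0 < r < 1 -> 0 <= al <= be -> be <= 2 * PI ->
  (be - al) ^ 2 / 2 - 38 * (eta r al + eta r be) <= (cpois r al - cpois r be) * (be - al).
Proof.
  intros Hr Ha Hb. assert (Hr' : 0 <= r < 1) by lra.
  assert (H4 := PI_4). assert (H0 := PI_RGT_0).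
  assert (HDa := pden_pos r al Hr'). assert (HDb := pden_pos r be Hr').
  rewrite cpois_sub by exact Hr'. unfold eta.
  assert (Ea := pden_half r al). assert (Eb := pden_half r be).
  assert (Sa : 0 <= sin (al / 2)) by (apply sin_ge_0; lra).
  assert (Sb : 0 <= sin (be / 2)) by (apply sin_ge_0; lra).
  assert (Sd : 0 <= sin ((be - al) / 2)) by (apply sin_ge_0; lra).
  (* With $\delta = (\beta-\alpha)/4$, the product of sines is at most $\cos^2\delta$, and $\sin
     2\delta = 2\sin\delta\cos\delta \ge 2\delta\cos^2\delta$. *)
  assert (S1 : (be - al) / 2 * (sin (al / 2) * sin (be / 2)) <= sin ((be - al) / 2)).
  { assert (P : sin (al / 2) * sin (be / 2) <= cos ((be - al) / 4) ^ 2).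
    { assert (E1 := cos_minus (be / 2) (al / 2)). assert (E2 := cos_plus (be / 2) (al / 2)).
      replace (be / 2 - al / 2) with (2 * ((be - al) / 4)) in E1 by field.
      rewrite cos_2a_cos in E1. destruct (COS_bound (be / 2 + al / 2)). nra. }
    replace (sin ((be - al) / 2)) with (sin (2 * ((be - al) / 4))) by (f_equal; field).
    rewrite sin_2a.
    assert (Q := mul_cos_le_sin ((be - al) / 4) ltac:(lra)).
    assert (Cp : 0 <= cos ((be - al) / 4)) by (apply cos_ge_0; lra).
    apply Rle_trans with ((be - al) / 2 * cos ((be - al) / 4) ^ 2).
    - apply Rmult_le_compat_l; lra.
    - nra. }
  (* The cosine is nonpositive for $\pi \le \alpha+\beta \le 3\pi$. Otherwise both angles lie near
     the same end of $[0,2\pi]$ and $\beta-\alpha$ is controlled by the sine of the half angle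
     farther from that end. *)
  assert (S2 : (be - al) * sin ((be - al) / 2) * cos ((al + be) / 2) <= 6 * (sin (al / 2) ^ 2 + sin (be / 2) ^ 2)).
  { assert (C := COS_bound ((al + be) / 2)).
    assert (Rhs : 0 <= 6 * (sin (al / 2) ^ 2 + sin (be / 2) ^ 2)) by nra.
    assert (Pd : 0 <= (be - al) * sin ((be - al) / 2)) by (apply Rmult_le_pos; lra).
    destruct (Rle_dec (al + be) PI) as [C1|C1].
    - assert (U1 := sin_ge_third (be / 2) ltac:(lra)).
      assert (U2 : sin ((be - al) / 2) <= sin (be / 2)) by (apply sin_incr_1; lra).
      apply Rle_trans with ((be - al) * sin ((be - al) / 2)); [nra|].
      apply Rle_trans with ((6 * sin (be / 2)) * sin (be / 2)); [apply Rmult_le_compat; lra|]. nra.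
    - destruct (Rle_dec (3 * PI) (al + be)) as [C2|C2].
      + assert (U1 := sin_ge_third (PI - al / 2) ltac:(lra)).
        assert (U2 : sin ((be - al) / 2) <= sin (PI - al / 2)) by (apply sin_incr_1; lra).
        rewrite sin_PI_x in U1, U2.
        apply Rle_trans with ((be - al) * sin ((be - al) / 2)); [nra|].
        apply Rle_trans with ((6 * sin (al / 2)) * sin (al / 2)); [apply Rmult_le_compat; lra|]. nra.
      + assert (cos ((al + be) / 2) <= 0) by (apply cos_le_0; lra). nra. }
  set (sa := sin (al / 2)) in *. set (sb := sin (be / 2)) in *.
  set (sd := sin ((be - al) / 2)) in *. set (cy := cos ((al + be) / 2)) in *.
  set (Da := pden r al) in *. set (Db := pden r be) in *. set (d := be - al) in *.
  assert (Hd : 0 <= d <= 8) by (unfold d; lra). set (q := (1 - r) ^ 2) in *.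
  assert (Hq : 0 <= q) by (unfold q; apply pow2_ge_0).
  (* The constant 38 is 32 + 6: here $d^2/2 \le 32$ since $d \le 8$, and [T2] contributes the 6 of
     [S2]. *)
  assert (T1 : d ^ 2 / 2 * (Da * Db) - 32 * q * (Da + Db) <= d * (4 * r * sd * (4 * r * sa * sb))).
  { apply Rle_trans with (d ^ 2 / 2 * ((Da - q) * (Db - q))).
    - replace ((Da - q) * (Db - q)) with (Da * Db - q * (Da + Db) + q * q) by ring.
      assert (d ^ 2 / 2 <= 32) by nra. assert (0 <= d ^ 2 / 2) by nra.
      assert (0 <= q * (Da + Db)) by (apply Rmult_le_pos; lra). nra.
    - replace (Da - q) with (4 * r * sa ^ 2) by lra. replace (Db - q) with (4 * r * sb ^ 2) by lra.
      replace (d ^ 2 / 2 * (4 * r * sa ^ 2 * (4 * r * sb ^ 2))) with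
        ((16 * r * r * (d * (sa * sb))) * (d / 2 * (sa * sb))) by field.
      replace (d * (4 * r * sd * (4 * r * sa * sb))) with ((16 * r * r * (d * (sa * sb))) * sd) by ring.
      apply Rmult_le_compat_l; [|exact S1].
      repeat apply Rmult_le_pos; lra. }
  assert (T2 : d * (4 * r * sd * (q * cy)) <= 6 * q * (Da + Db)).
  { replace (d * (4 * r * sd * (q * cy))) with (q * (4 * r * (d * sd * cy))) by ring.
    replace (6 * q * (Da + Db)) with (q * (6 * (Da + Db))) by ring.
    apply Rmult_le_compat_l; [exact Hq|].
    apply Rle_trans with (4 * r * (6 * (sa ^ 2 + sb ^ 2))); [apply Rmult_le_compat_l; lra|]. nra. }
  apply Rmult_le_reg_r with (Da * Db); [apply Rmult_lt_0_compat; lra|].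
  replace ((d ^ 2 / 2 - 38 * (q / Da + q / Db)) * (Da * Db)) with
    (d ^ 2 / 2 * (Da * Db) - 38 * q * (Da + Db)) by (field; lra).
  replace (4 * r * sd * (4 * r * sa * sb - q * cy) / (Da * Db) * d * (Da * Db)) with
    (d * (4 * r * sd * (4 * r * sa * sb)) - d * (4 * r * sd * (q * cy))) by (field; lra).
  lra.
Qed.

Lemma cpois_odd (r t : R) : cpois r (- t) = - cpois r t.
Proof. unfold cpois, pden. rewrite sin_neg, cos_neg. unfold Rdiv; ring. Qed.

Lemma eta_even (r t : R) : eta r (- t) = eta r t.
Proof. unfold eta, pden. now rewrite cos_neg. Qed.

(** * Bounds and Lipschitz estimates for periodic functions *)

Lemma reduce_period (T x : R) : 0 < T -> exists n : Z, 0 <= x + IZR n * T < T.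
Proof.
  intros HT. destruct (archimed (x / T)) as [H1 H2].
  exists (1 - up (x / T))%Z. rewrite minus_IZR.
  assert (E : x = x / T * T) by (field; lra).
  set (y := x / T) in *. set (u := IZR (up y)) in *. rewrite E. split; nra.
Qed.

Lemma periodic_Z (f : R -> R) (T : R) : (forall x, f (x + T) = f x) ->
  forall (n : Z) x, f (x + IZR n * T) = f x.
Proof.
  intros H.
  assert (N : forall (n : nat) x, f (x + INR n * T) = f x).
  { induction n as [|n IH]; intros x.
    - simpl. f_equal; ring.
    - rewrite S_INR. replace (x + (INR n + 1) * T) with ((x + INR n * T) + T) by ring. now rewrite H. }
  intros n x. destruct (Z_le_dec 0 n) as [Hn|Hn].
  - rewrite <- (Z2Nat.id n) by assumption. rewrite <- INR_IZR_INZ. apply N.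
  - rewrite <- (N (Z.to_nat (- n)) (x + IZR n * T)).
    rewrite INR_IZR_INZ, Z2Nat.id, opp_IZR by lia. f_equal; ring.
Qed.

Lemma periodic_bounded (f : R -> R) (T : R) : 0 < T -> (forall x, continuous f x) ->
  (forall x, f (x + T) = f x) -> exists B, 0 <= B /\ forall x, Rabs (f x) <= B.
Proof.
  intros HT Hc Hp.
  destruct (continuity_ab_maj (fun x => Rabs (f x)) 0 T) as [m [Hm _]]; [lra|..].
  - intros c _. apply continuity_pt_filterlim. change (continuous (fun x => Rabs (f x)) c). ctn.
  - exists (Rabs (f m)). split; [apply Rabs_pos|]. intros x.
    destruct (reduce_period T x HT) as [n Hn].
    rewrite <- (periodic_Z f T Hp n x). apply Hm. lra.
Qed.

Lemma lipschitz_of_derive (f f' : R -> R) (B : R) :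
  (forall x, is_derive f x (f' x)) -> (forall x, Rabs (f' x) <= B) ->
  forall x y, Rabs (f x - f y) <= B * Rabs (x - y).
Proof.
  intros Hd HB x y.
  destruct (MVT_gen f y x f') as [c [_ Hc]].
  - intros z _; apply Hd.
  - intros z _. apply continuity_pt_filterlim. apply (ct_derive f z _ (Hd z)).
  - rewrite Hc, Rabs_mult. apply Rmult_le_compat_r; [apply Rabs_pos|apply HB].
Qed.

(** Periodicity reduces [x - y] to some [t] in $[-\pi,\pi]$, where $|t| \le 6\sin(|t|/2)$; hence
    $t^2 \le 36\sin^2(t/2) = 18(1-\cos t)$. *)
Lemma periodic_lip_cos (f f' : R -> R) (B : R) :
  (forall x, is_derive f x (f' x)) -> (forall x, Rabs (f' x) <= B) ->
  (forall x, f (x + 2 * PI) = f x) ->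
  forall x y, (f x - f y) ^ 2 <= 18 * B ^ 2 * (1 - cos (x - y)).
Proof.
  intros Hd HB Hp x y.
  assert (HL := lipschitz_of_derive f f' B Hd HB).
  destruct (reduce_period (2 * PI) (x - y + PI) two_pi_pos) as [n Hn].
  set (t := x - y + IZR n * (2 * PI)).
  assert (Ex : f x = f (y + t)).
  { unfold t. replace (y + (x - y + IZR n * (2 * PI))) with (x + IZR n * (2 * PI)) by ring.
    symmetry; apply (periodic_Z f _ Hp). }
  assert (Ec : cos (x - y) = cos t).
  { unfold t. symmetry. apply (periodic_Z cos). intros z.
    replace (z + 2 * PI) with (z + 2 * INR 1 * PI) by (simpl; ring). apply cos_period. }
  rewrite Ex, Ec.
  assert (Ht : Rabs t <= PI) by (apply Rabs_le; unfold t; lra).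
  assert (HB0 : 0 <= B) by (eapply Rle_trans; [apply Rabs_pos|apply (HB 0)]).
  specialize (HL (y + t) y). replace (y + t - y) with t in HL by ring.
  assert (S3 := sin_ge_third (Rabs t / 2) ltac:(split; [assert (q := Rabs_pos t)|]; lra)).
  replace (cos t) with (cos (Rabs t)).
  2: { unfold Rabs; destruct (Rcase_abs t); [apply cos_neg|reflexivity]. }
  replace (Rabs t) with (2 * (Rabs t / 2)) at 1 by field.
  rewrite cos_2a_sin.
  replace ((f (y + t) - f y) ^ 2) with (Rabs (f (y + t) - f y) ^ 2) by apply pow2_abs.
  apply Rle_trans with ((B * Rabs t) ^ 2).
  - apply pow_incr; split; [apply Rabs_pos|exact HL].
  - assert (q := Rabs_pos t). assert (0 <= B ^ 2) by apply pow2_ge_0.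
    replace ((B * Rabs t) ^ 2) with (B ^ 2 * Rabs t ^ 2) by ring.
    assert (Rabs t ^ 2 <= 36 * sin (Rabs t / 2) ^ 2).
    { replace (36 * sin (Rabs t / 2) ^ 2) with ((6 * sin (Rabs t / 2)) ^ 2) by ring.
      apply pow_incr. lra. }
    nra.
Qed.

(** * Decaying modes *)


Definition vanishes_at_minus_infty (f : R -> R) : Prop :=
  forall e, 0 < e -> exists X, X < 0 /\ forall x, x < X -> Rabs (f x) <= e.

(** Clamping the argument at 0 expresses one-sided continuity as ordinary continuity, so that the
    usual calculus of continuous functions applies. *)
Definition left_continuous_at_0 (f : R -> R) : Prop :=
  continuous (fun x => f (Rmin x 0)) 0.

Lemma left_continuous_zero (f : R -> R) :
  left_continuous_at_0 f -> (forall x, x < 0 -> f x = 0) -> f 0 = 0.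
Proof.
  intros Hc H0.
  assert (E0 : Rmin 0 0 = 0) by (apply Rmin_left; lra).
  apply cond_eq. intros e He. rewrite Rminus_0_r.
  unfold left_continuous_at_0 in Hc.
  apply continuity_pt_filterlim in Hc. destruct (Hc e He) as [d [Hd H]].
  specialize (H (- (d / 2))). simpl in H. unfold R_dist in H.
  rewrite E0, Rmin_left, H0 in H by lra.
  rewrite <- Rabs_Ropp. replace (- f 0) with (0 - f 0) by ring. apply H.
  split.
  - split; [exact I|lra].
  - rewrite Rabs_left; lra.
Qed.

Lemma linear_ode_neg (f : R -> R) (a : R) :
  (forall x, x < 0 -> is_derive f x (a * f x)) ->
  forall x y, x < 0 -> y < 0 -> f y = f x * exp (a * (y - x)).
Proof.
  intros Hd x y Hx Hy.
  assert (D : forall z, z < 0 -> is_derive (fun z => f z * exp (- a * z)) z 0).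
  { intros z Hz. evar_last.
    - apply (Derive.is_derive_mult f (fun z => exp (- a * z)) z _ (- a * exp (- a * z)) (Hd z Hz)).
      auto_derive; [exact I|]. ring.
    - unfold plus, mult; simpl. ring. }
  destruct (MVT_gen (fun z => f z * exp (- a * z)) x y (fun _ => 0)) as [z [_ Hz]].
  - intros z Hz. apply D. eapply Rlt_trans; [apply Hz|]. now apply Rmax_lub_lt.
  - intros z Hz. apply continuity_pt_filterlim, (ct_derive (fun z => f z * exp (- a * z)) z 0), D.
    eapply Rle_lt_trans; [apply Hz|]. now apply Rmax_lub_lt.
  - cbv beta in Hz. rewrite Rmult_0_l in Hz.
    replace (a * (y - x)) with (- a * x + a * y) by ring. rewrite exp_plus.
    rewrite <- Rmult_assoc. replace (f x * exp (- a * x)) with (f y * exp (- a * y)) by lra.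
    rewrite Rmult_assoc, <- exp_plus. replace (- a * y + a * y) with 0 by ring.
    rewrite exp_0. ring.
Qed.

(* With [M = C - i S] and [lambda = p + i q], the equation factors through
   [Z = M' - lambda M] and [W = M' + (lambda + c) M]: here |Z|^2 decreases and
   |W|^2 increases in [x]. Decay of [M] forces [Z = 0]. *)
Lemma decaying_mode (C S CX SX : R -> R) (c A B p q : R) :
  0 <= c -> 0 < p -> p ^ 2 - q ^ 2 + c * p = A -> 2 * p * q + c * q = B ->
  (forall x, x < 0 -> is_derive C x (CX x)) ->
  (forall x, x < 0 -> is_derive S x (SX x)) ->
  (forall x, x < 0 -> is_derive CX x (- c * CX x + A * C x + B * S x)) ->
  (forall x, x < 0 -> is_derive SX x (- c * SX x + A * S x - B * C x)) ->
  vanishes_at_minus_infty C -> vanishes_at_minus_infty S ->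
  left_continuous_at_0 C -> left_continuous_at_0 S ->
  left_continuous_at_0 CX -> left_continuous_at_0 SX ->
  CX 0 = p * C 0 + q * S 0 /\ SX 0 = p * S 0 - q * C 0.
Proof.
  intros Hc Hp HA HB DC DS DCX DSX VC VS LC LS LCX LSX.
  set (Z1 := fun x => CX x - p * C x - q * S x).
  set (Z2 := fun x => SX x - p * S x + q * C x).
  set (W1 := fun x => CX x + (p + c) * C x + q * S x).
  set (W2 := fun x => SX x + (p + c) * S x - q * C x).
  assert (DZ : forall x, x < 0 -> is_derive (fun x => Z1 x ^ 2 + Z2 x ^ 2) x (- 2 * (p + c) * (Z1 x ^ 2 + Z2 x ^ 2))).
  { intros x Hx. specialize (DC x Hx); specialize (DS x Hx); specialize (DCX x Hx); specialize (DSX x Hx).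
    unfold Z1, Z2.
    assert (E1 := is_derive_unique _ _ _ DC). assert (E2 := is_derive_unique _ _ _ DS).
    assert (E3 := is_derive_unique _ _ _ DCX). assert (E4 := is_derive_unique _ _ _ DSX).
    auto_derive.
    - repeat split; eexists; eassumption.
    - change (Derive (fun x => C x) x) with (Derive C x).
      change (Derive (fun x => S x) x) with (Derive S x).
      change (Derive (fun x => CX x) x) with (Derive CX x).
      change (Derive (fun x => SX x) x) with (Derive SX x).
      rewrite E1, E2, E3, E4, <- HA, <- HB. ring. }
  assert (DW : forall x, x < 0 -> is_derive (fun x => W1 x ^ 2 + W2 x ^ 2) x (2 * p * (W1 x ^ 2 + W2 x ^ 2))).
  { intros x Hx. specialize (DC x Hx); specialize (DS x Hx); specialize (DCX x Hx); specialize (DSX x Hx).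
    unfold W1, W2.
    assert (E1 := is_derive_unique _ _ _ DC). assert (E2 := is_derive_unique _ _ _ DS).
    assert (E3 := is_derive_unique _ _ _ DCX). assert (E4 := is_derive_unique _ _ _ DSX).
    auto_derive.
    - repeat split; eexists; eassumption.
    - change (Derive (fun x => C x) x) with (Derive C x).
      change (Derive (fun x => S x) x) with (Derive S x).
      change (Derive (fun x => CX x) x) with (Derive CX x).
      change (Derive (fun x => SX x) x) with (Derive SX x).
      rewrite E1, E2, E3, E4, <- HA, <- HB. ring. }
  assert (EZ := linear_ode_neg _ _ DZ). assert (EW := linear_ode_neg _ _ DW). cbv beta in EZ, EW.
  assert (Zero : forall y, y < 0 -> Z1 y ^ 2 + Z2 y ^ 2 <= 0).
  (* [Lam] is $|2\lambda+c|^2$: as $Z = W - (2\lambda+c)M$, one has $|Z|^2 \le 2|W|^2 +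
     2|2\lambda+c|^2|M|^2$. Both terms are O(e) at a point [x] far to the left, and $|Z|^2$ at [y]
     is no larger than at [x]. *)
  { intros y Hy. set (Lam := (2 * p + c) ^ 2 + 4 * q ^ 2).
    apply le_0_of_small with (2 * (W1 y ^ 2 + W2 y ^ 2) + 4 * Lam).
    intros e He. destruct (VC e ltac:(lra)) as [X1 [HX1 H1]]. destruct (VS e ltac:(lra)) as [X2 [HX2 H2]].
    (* Far enough left for the decay of [C] and [S], and for $e^{2p(x-y)} \le e^{-1/e} \le e$, where
       the last [e] is the small parameter. *)
    set (x := Rmin (Rmin X1 X2 - 1) (y - / (2 * p * e))).
    assert (Hi : 0 < / (2 * p * e)) by (apply Rinv_0_lt_compat; nra).
    assert (x <= Rmin X1 X2 - 1) by apply Rmin_l.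
    assert (x <= y - / (2 * p * e)) by apply Rmin_r.
    assert (Rmin X1 X2 <= X1) by apply Rmin_l. assert (Rmin X1 X2 <= X2) by apply Rmin_r.
    specialize (H1 x ltac:(lra)). specialize (H2 x ltac:(lra)).
    assert (Hx : x < 0) by lra.
    rewrite (EZ x y Hx Hy).
    assert (X3 : exp (- 2 * (p + c) * (y - x)) <= 1).
    { rewrite <- exp_0. destruct (Req_dec (- 2 * (p + c) * (y - x)) 0) as [->|Hn]; [lra|].
      left. apply exp_increasing. assert (0 <= 2 * (p + c) * (y - x)) by (apply Rmult_le_pos; lra). lra. }
    assert (X4 : exp (2 * p * (x - y)) <= e).
    { assert (G : 1 + / e <= exp (/ e)) by (left; apply exp_ineq1; apply Rgt_not_eq, Rinv_0_lt_compat; lra).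
      apply Rle_trans with (exp (- / e)).
      - destruct (Req_dec (2 * p * (x - y)) (- / e)) as [->|Hn]; [lra|].
        left. apply exp_increasing.
        assert (2 * p * (x - y) <= - / e).
        { replace (- / e) with (2 * p * (- / (2 * p * e))) by (field; lra). apply Rmult_le_compat_l; lra. }
        lra.
      - rewrite exp_Ropp. assert (0 < / e) by (apply Rinv_0_lt_compat; lra).
        rewrite <- (Rinv_inv e) at 2. apply Rinv_le_contravar; lra. }
    assert (PZ : 0 <= Z1 x ^ 2 + Z2 x ^ 2) by nra.
    assert (PW : 0 <= W1 y ^ 2 + W2 y ^ 2) by nra.
    apply Rle_trans with (Z1 x ^ 2 + Z2 x ^ 2); [nra|].
    assert (SC : C x ^ 2 <= e). { rewrite <- (pow2_abs (C x)). assert (q0 := Rabs_pos (C x)). nra. }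
    assert (SS : S x ^ 2 <= e). { rewrite <- (pow2_abs (S x)). assert (q0 := Rabs_pos (S x)). nra. }
    assert (PL : 0 <= Lam) by (unfold Lam; nra).
    apply Rle_trans with (2 * (W1 x ^ 2 + W2 x ^ 2) + 2 * (Lam * (C x ^ 2 + S x ^ 2))).
    - assert (F1 : Z1 x = W1 x - ((2 * p + c) * C x + 2 * q * S x)) by (unfold Z1, W1; ring).
      assert (F2 : Z2 x = W2 x - ((2 * p + c) * S x - 2 * q * C x)) by (unfold Z2, W2; ring).
      rewrite F1, F2. unfold Lam.
      set (a1 := (2 * p + c) * C x + 2 * q * S x). set (a2 := (2 * p + c) * S x - 2 * q * C x).
      replace (((2 * p + c) ^ 2 + 4 * q ^ 2) * (C x ^ 2 + S x ^ 2)) with (a1 ^ 2 + a2 ^ 2) by (unfold a1, a2; ring).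
      assert (0 <= (W1 x + a1) ^ 2) by apply pow2_ge_0. assert (0 <= (W2 x + a2) ^ 2) by apply pow2_ge_0. nra.
    - rewrite (EW y x Hy Hx).
      assert ((W1 y ^ 2 + W2 y ^ 2) * exp (2 * p * (x - y)) <= (W1 y ^ 2 + W2 y ^ 2) * e) by (apply Rmult_le_compat_l; lra).
      assert (Lam * (C x ^ 2 + S x ^ 2) <= Lam * (2 * e)) by (apply Rmult_le_compat_l; lra).
      lra. }
  assert (Q1 : Z1 0 = 0).
  { apply left_continuous_zero.
    - unfold left_continuous_at_0, Z1 in *. ctn.
    - intros x Hx. specialize (Zero x Hx). nra. }
  assert (Q2 : Z2 0 = 0).
  { apply left_continuous_zero.
    - unfold left_continuous_at_0, Z2 in *. ctn.
    - intros x Hx. specialize (Zero x Hx). nra. }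
  unfold Z1, Z2 in *. lra.
Qed.

(** The mode $l=0$ has no positive decay rate, so it is treated apart. Here [N + c M] is a constant,
    and decay forces that constant to be 0. Then [M' = - c M], whose solutions do not shrink to the
    left, so [M] vanishes. *)
Lemma decaying_mean (M N : R -> R) (c : R) : 0 <= c ->
  (forall x, x < 0 -> is_derive M x (N x)) ->
  (forall x, x < 0 -> is_derive N x (- c * N x)) ->
  vanishes_at_minus_infty M -> left_continuous_at_0 M -> left_continuous_at_0 N ->
  M 0 = 0 /\ N 0 = 0.
Proof.
  intros Hc DM DN VM LM LN.
  set (K := N (-1) + c * M (-1)).
  assert (HK : forall x, x < 0 -> N x + c * M x = K).
  { intros x Hx. assert (E := linear_ode_neg (fun x => N x + c * M x) 0).
    specialize (E ltac:(intros z Hz; evar_last;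
      [apply (is_derive_plus (K := R_AbsRing) (V := R_NormedModule) N (fun x => c * M x) z _ _ (DN z Hz) (is_derive_scal M z c _ (DM z Hz)))
      | unfold plus, scal; simpl; unfold mult; simpl; ring]) (-1) x ltac:(lra) Hx).
    cbv beta in E. rewrite Rmult_0_l, exp_0 in E. unfold K. lra. }
  assert (K0 : K = 0).
  { enough (Rabs K <= 0).
    { destruct (Req_dec K 0) as [|Hn]; [assumption|]. apply Rabs_pos_lt in Hn. lra. }
    apply le_0_of_small with (2 + c). intros e He.
    destruct (VM e ltac:(lra)) as [X [HX H]].
    (* Far to the left [M] is small, hence so is its mean slope over a unit interval; this yields a
       point at which [M] and [N] are both small. *)
    destruct (MVT_gen M (X - 2) (X - 1) N) as [z [Hz E]].
    - intros z Hz. apply DM. rewrite Rmax_right in Hz by lra. lra.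
    - intros z Hz. rewrite Rmax_right in Hz by lra.
      apply continuity_pt_filterlim, (ct_derive M z (N z)), DM. lra.
    - rewrite Rmin_left, Rmax_right in Hz by lra.
      assert (E' := HK z ltac:(lra)).
      assert (H1 := H z ltac:(lra)). assert (H2 := H (X - 1) ltac:(lra)). assert (H3 := H (X - 2) ltac:(lra)).
      apply Rabs_le_between in H1. apply Rabs_le_between in H2. apply Rabs_le_between in H3.
      assert (- (c * e) <= c * M z <= c * e) by (split; nra).
      apply Rabs_le. lra. }
  assert (M0 : forall x, x < 0 -> M x = 0).
  { assert (DM' : forall x, x < 0 -> is_derive M x (- c * M x)).
    { intros x Hx. replace (- c * M x) with (N x); [now apply DM|]. specialize (HK x Hx). lra. }
    assert (E := linear_ode_neg M (- c) DM').
    intros y Hy. enough (Rabs (M y) <= 0).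
    { destruct (Req_dec (M y) 0) as [|Hn]; [assumption|]. apply Rabs_pos_lt in Hn. lra. }
    apply le_0_of_small with 1. intros e He.
    destruct (VM e ltac:(lra)) as [X [HX H]].
    set (x := Rmin (X - 1) y). assert (x <= X - 1) by apply Rmin_l. assert (x <= y) by apply Rmin_r.
    rewrite (E x y ltac:(lra) Hy), Rabs_mult.
    assert (P1 : Rabs (exp (- c * (y - x))) <= 1).
    { rewrite Rabs_pos_eq by (left; apply exp_pos). rewrite <- exp_0.
      destruct (Req_dec (- c * (y - x)) 0) as [->|Hn]; [lra|].
      left. apply exp_increasing. assert (0 <= c * (y - x)) by (apply Rmult_le_pos; lra). lra. }
    assert (P2 := H x ltac:(lra)). assert (P3 := Rabs_pos (M x)). assert (P4 := Rabs_pos (exp (- c * (y - x)))). nra. }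
  split; apply left_continuous_zero; auto.
  intros x Hx. specialize (HK x Hx). rewrite (M0 x Hx) in HK. lra.
Qed.

(** For $\lambda = p + iq$ the equations read $(\lambda + c/2)^2 = A + c^2/4 + iB$. The root is the
    explicit complex square root, and $A > 0$ makes its real part exceed $c/2$. *)
Lemma mode_root_exists (c A B : R) : 0 <= c -> 0 < A ->
  exists p q, 0 < p /\ p ^ 2 - q ^ 2 + c * p = A /\ 2 * p * q + c * q = B.
Proof.
  intros Hc HA. set (A' := A + c ^ 2 / 4).
  set (Rt := sqrt (A' ^ 2 + B ^ 2)).
  assert (HA' : 0 < A') by (unfold A'; nra).
  assert (HR2 : Rt * Rt = A' ^ 2 + B ^ 2) by (apply sqrt_sqrt; nra).
  assert (HR0 : 0 <= Rt) by apply sqrt_pos.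
  assert (HRA : A' <= Rt) by nra.
  set (P := sqrt ((A' + Rt) / 2)).
  assert (HP2 : P * P = (A' + Rt) / 2) by (apply sqrt_sqrt; lra).
  assert (HP0 : 0 < P) by (apply sqrt_lt_R0; lra).
  assert (HPc : c / 2 < P).
  { apply Rnot_le_lt; intros Hn. unfold A' in *. nra. }
  assert (Hq : (B / (2 * P)) ^ 2 = (Rt - A') / 2).
  { replace ((B / (2 * P)) ^ 2) with (B ^ 2 / (4 * (P * P))) by (field; lra).
    rewrite HP2. replace (B ^ 2) with ((Rt - A') * (Rt + A')) by (ring_simplify; lra). field. lra. }
  exists (P - c / 2), (B / (2 * P)). split; [lra|split].
  - rewrite Hq. replace ((P - c / 2) ^ 2) with (P * P - c * P + c ^ 2 / 4) by field.
    rewrite HP2. unfold A'. field.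
  - field. lra.
Qed.

(** Composition with the projection onto the closed half-plane turns relative continuity into
    continuity on the whole plane. *)
Lemma ct_clamp (F : R * R -> R) : continuous_on half_plane F ->
  forall p, continuous (fun p => F (Rmin (fst p) 0, snd p)) p.
Proof.
  intros HF [x z].
  assert (Hm : half_plane (Rmin x 0, z)) by (unfold half_plane; simpl; apply Rmin_r).
  assert (Cm : continuous (fun p : R * R => (Rmin (fst p) 0, snd p)) (x, z)).
  { apply (continuous_comp_2 (fun p : R * R => Rmin (fst p) 0) snd (fun a b => (a, b))).
    - apply (continuous_ext (fun p : R * R => (fst p + 0 - Rabs (fst p - 0)) / 2)).
      + intros [a b]. toR. unfold Rmin, Rabs; simpl. destruct (Rle_dec a 0), (Rcase_abs (a - 0)); lra.
      + unfold Rdiv. ctn.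
    - apply continuous_snd.
    - apply (continuous_ext (fun p : R * R => p)); [now intros []|apply continuous_id]. }
  intros P HP. specialize (HF (Rmin x 0, z) Hm P HP).
  unfold filtermap in *. unfold within in HF.
  specialize (Cm _ HF). unfold filtermap in Cm. simpl in Cm.
  apply (filter_imp (fun p : R * R => half_plane (Rmin (fst p) 0, snd p) -> P (F (Rmin (fst p) 0, snd p)))); [|exact Cm].
  intros p Hp; apply Hp. unfold half_plane; simpl; apply Rmin_r.
Qed.

Lemma locally_neg (x : R) : x < 0 -> locally x (fun s => s < 0).
Proof.
  intros H. exists (mkposreal (- x) ltac:(lra)). intros s Hs.
  unfold ball in Hs; simpl in Hs; unfold AbsRing_ball, abs, minus, plus, opp in Hs; simpl in Hs.
  apply Rabs_def2 in Hs. lra.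
Qed.

Lemma is_derive_of_within (f : R -> R) (x l : R) : x < 0 ->
  filterdiff f (within (fun s => s <= 0) (locally x)) (fun h => scal h l) ->
  is_derive f x l.
Proof.
  intros Hx [Hl Hd]. split; [exact Hl|].
  intros y Hy eps.
  assert (Hy' : is_filter_lim (within (fun s : R => s <= 0) (locally x)) y).
  { intros P HP. apply filter_le_within. now apply Hy. }
  specialize (Hd y Hy' eps).
  assert (Hn : locally x (fun s => s <= 0)).
  { generalize (locally_neg x Hx). apply filter_imp. intros; lra. }
  unfold within in Hd.
  generalize (filter_and _ _ Hn Hd). apply filter_imp. intros s [H1 H2]. now apply H2.
Qed.

Lemma is_derive_mode (F Fx : R -> R -> R) (e : R -> R) (x : R) : x < 0 ->
  (forall y z, y < 0 -> is_derive (fun y => F y z) y (Fx y z)) ->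
  (forall z, continuity_2d_pt Fx x z) ->
  (forall y z, y < 0 -> continuous (F y) z) ->
  (forall z, continuous e z) ->
  is_derive (fun y => RInt (fun z => F y z * e z) 0 (2 * PI)) x (RInt (fun z => Fx x z * e z) 0 (2 * PI)).
Proof.
  intros Hx HF HFx HFc He.
  assert (Hn := locally_neg x Hx).
  assert (D : forall y z, y < 0 -> is_derive (fun y => F y z * e z) y (Fx y z * e z)).
  { intros y z Hy. evar_last.
    - apply (Derive.is_derive_mult (fun y => F y z) (fun _ => e z) y _ _ (HF y z Hy) (is_derive_const (K := R_AbsRing) (V := R_NormedModule) (e z) y)).
    - unfold plus, mult, zero; simpl. ring. }
  rewrite (rint_ext (fun z => Fx x z * e z) (fun z => Derive (fun y => F y z * e z) x)).
  - apply is_derive_RInt_param.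
    + revert Hn. apply filter_imp. intros y Hy t _. eexists; now apply D.
    + intros t _.
      apply continuity_2d_pt_ext_loc with (fun u v => Fx u v * e v).
      * destruct Hn as [d Hd]. exists d. intros u v Hu Hv.
        symmetry. apply is_derive_unique, D, Hd. exact Hu.
      * apply continuity_2d_pt_mult; [apply HFx|].
        apply (ct_pair (fun p => e (snd p))). ctn.
    + revert Hn. apply filter_imp. intros y Hy. apply rint_ex. intros z; apply ct_mult; auto.
  - intros z. symmetry. now apply is_derive_unique, D.
Qed.

Lemma finite_uniform_below (P : nat -> R -> Prop) (N : nat) :
  (forall j, exists X, X < 0 /\ forall x, x < X -> P j x) ->
  exists X, X < 0 /\ forall j x, (j <= N)%nat -> x < X -> P j x.
Proof.
  intros H. induction N as [|N [X [HX IH]]].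
  - destruct (H 0%nat) as [X [HX H0]]. exists X; split; [exact HX|].
    intros j x Hj Hx. replace j with 0%nat by lia. auto.
  - destruct (H (S N)) as [Y [HY H0]]. exists (Rmin X Y). split; [apply Rmin_case; lra|].
    intros j x Hj Hx. assert (Rmin X Y <= X) by apply Rmin_l. assert (Rmin X Y <= Y) by apply Rmin_r.
    destruct (Nat.eq_dec j (S N)) as [->|Hn]; [apply H0; lra|apply IH; [lia|lra]].
Qed.

(** The limit is assumed for each [z] separately. Monotonicity in [z] makes it uniform on a period:
    control on a finite grid of mesh [e / 2] squeezes the values in between. *)
Lemma monotone_uniform_decay (phi : R -> R -> R) (k : R) :
  increasing_zeta phi ->
  (forall z, is_lim (fun x => Rabs (phi x z - (k * x + z))) m_infty 0) ->
  forall e, 0 < e -> exists X, X < 0 /\ forall x z, x < X -> 0 <= z <= 2 * PI ->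
    Rabs (phi x z - (k * x + z)) <= e.
Proof.
  intros Hi Hl e He. assert (H2 := two_pi_pos).
  destruct (nfloor_ex (4 * PI / e)) as [N HN]; [apply Rdiv_le_0_compat; lra|].
  set (h := e / 2).
  assert (HNh : 2 * PI <= (INR N + 1) * h).
  { unfold h. destruct HN as [_ HN]. apply Rmult_le_reg_r with (2 / e); [apply Rdiv_lt_0_compat; lra|].
    field_simplify; lra. }
  assert (G : forall j, exists X, X < 0 /\ forall x, x < X -> Rabs (phi x (INR j * h) - (k * x + INR j * h)) <= h).
  { intros j. specialize (Hl (INR j * h)). apply is_lim_spec in Hl.
    destruct (Hl (mkposreal h ltac:(unfold h; lra))) as [X HX]. simpl in HX.
    exists (Rmin X (-1)). split; [assert (Rmin X (-1) <= -1) by apply Rmin_r; lra|].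
    intros x Hx. assert (Rmin X (-1) <= X) by apply Rmin_l.
    specialize (HX x ltac:(lra)). rewrite Rminus_0_r, Rabs_Rabsolu in HX. lra. }
  (* A point of the period lies between the grid points [j] and [S j] with [j <= S N], so the index
     [S (S N)] can occur. *)
  destruct (finite_uniform_below _ (S (S N)) G) as [X [HX HG]].
  exists X; split; [exact HX|]. intros x z Hx Hz.
  destruct (nfloor_ex (z / h)) as [j Hj]; [apply Rdiv_le_0_compat; unfold h; lra|].
  assert (Hh : 0 < h) by (unfold h; lra).
  assert (Ez : z / h * h = z) by (field; lra).
  assert (J1 : INR j * h <= z) by (rewrite <- Ez; apply Rmult_le_compat_r; lra).
  assert (J2 : z < INR (S j) * h).
  { rewrite <- Ez, S_INR. apply Rmult_lt_compat_r; lra. }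
  assert (JN : (j <= S N)%nat).
  { apply INR_le. rewrite S_INR. apply Rmult_le_reg_r with h; [exact Hh|]. lra. }
  assert (B1 := HG j x ltac:(lia) Hx). assert (B2 := HG (S j) x ltac:(lia) Hx).
  apply Rabs_le_between in B1. apply Rabs_le_between in B2.
  rewrite S_INR in *.
  assert (M1 : phi x (INR j * h) <= phi x z).
  { destruct (Req_dec (INR j * h) z) as [->|Hn]; [lra|]. left; apply Hi; lra. }
  assert (M2 : phi x z < phi x ((INR j + 1) * h)) by (apply Hi; lra).
  apply Rabs_le. assert (e = 2 * h) by (unfold h; field). lra.
Qed.

(** * The boundary trace of a solution *)


(* What the trace [u = phi 0] of a solution retains of the half-plane problem:
   [p + i q] is the exponential rate of the mode [l = n], so that the Fourier
   coefficients of [phi_x - k] at [x = 0] are those of [u - id] times [p + i q]. *)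
Record boundary_trace (g : R -> R) (ky c k : R) (u u' : R -> R) : Prop := {
  trace_derive : forall z, is_derive u z (u' z);
  trace_ct : forall z, continuous u' z;
  trace_nonneg : forall z, 0 <= u' z;
  trace_incr : forall y z, y < z -> u y < u z;
  trace_shift : forall z, u (z + 2 * PI) = u z + 2 * PI;
  trace_mean : RInt (fun z => u z - z) 0 (2 * PI) = 0;
  trace_mean_g : RInt (fun z => g (u z)) 0 (2 * PI) = 2 * PI * k;
  trace_mode : forall n, exists p q, 0 < p /\
    p ^ 2 - q ^ 2 + c * p = ky ^ 2 * INR (S n) ^ 2 /\
    2 * p * q + c * q = k * c * INR (S n) /\
    fcos (fun z => g (u z)) (S n) =
      p * fcos (fun z => u z - z) (S n) + q * fsin (fun z => u z - z) (S n) /\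
    fsin (fun z => g (u z)) (S n) =
      p * fsin (fun z => u z - z) (S n) - q * fcos (fun z => u z - z) (S n)
}.

Lemma rint_derive_cos (h h' : R -> R) (n : nat) :
  (forall z, is_derive h z (h' z)) -> (forall z, continuous h' z) -> h (2 * PI) = h 0 ->
  RInt (fun z => h' z * cos (INR n * z)) 0 (2 * PI) = INR n * RInt (fun z => h z * sin (INR n * z)) 0 (2 * PI).
Proof.
  intros Hd Hc Hp.
  assert (Ch : forall z, continuous h z) by (intros; eapply ct_derive; eauto).
  rewrite (rint_parts_periodic h h' (fun z => cos (INR n * z)) (fun z => - INR n * sin (INR n * z))); auto.
  - rewrite (rint_ext _ (fun z => - INR n * (h z * sin (INR n * z)))) by (intros; ring).
    rewrite rint_scal by ctn. toR. ring.
  - intros z. generalize (INR n); intros m. auto_derive; [exact I|]. ring.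
  - ctn.
  - rewrite Hp, cos_nat_2pi, Rmult_0_r, cos_0. reflexivity.
Qed.

Lemma rint_derive_sin (h h' : R -> R) (n : nat) :
  (forall z, is_derive h z (h' z)) -> (forall z, continuous h' z) -> h (2 * PI) = h 0 ->
  RInt (fun z => h' z * sin (INR n * z)) 0 (2 * PI) = - INR n * RInt (fun z => h z * cos (INR n * z)) 0 (2 * PI).
Proof.
  intros Hd Hc Hp.
  assert (Ch : forall z, continuous h z) by (intros; eapply ct_derive; eauto).
  rewrite (rint_parts_periodic h h' (fun z => sin (INR n * z)) (fun z => INR n * cos (INR n * z))); auto.
  - rewrite (rint_ext _ (fun z => INR n * (h z * cos (INR n * z)))) by (intros; ring).
    rewrite rint_scal by ctn. toR. ring.
  - intros z. generalize (INR n); intros m. auto_derive; [exact I|]. ring.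
  - ctn.
  - rewrite Hp, sin_nat_2pi, (Rmult_0_r (INR n)), sin_0. ring.
Qed.

Lemma periodic_derive (h h' : R -> R) (T : R) :
  (forall z, is_derive h z (h' z)) -> (forall z, h (z + T) = h z) ->
  forall z, h' (z + T) = h' z.
Proof.
  intros Hd Hp z.
  rewrite <- (is_derive_unique _ _ _ (Hd z)).
  rewrite <- (Derive_ext (fun z => h (z + T)) h z Hp).
  symmetry. apply is_derive_unique. evar_last.
  - apply (is_derive_comp (K := R_AbsRing) (V := R_NormedModule) h (fun z => z + T)); [apply Hd|].
    auto_derive; [exact I|reflexivity].
  - unfold scal; simpl; unfold mult; simpl. ring.
Qed.

Lemma derive_nonneg_of_increasing (u u' : R -> R) :
  (forall z, is_derive u z (u' z)) -> (forall y z, y < z -> u y < u z) -> forall z, 0 <= u' z.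
Proof.
  intros Hd Hi z.
  rewrite <- (is_derive_unique _ _ _ (Hd z)).
  apply Rnot_lt_le; intros Hn.
  assert (H := Hd z). rewrite <- (is_derive_unique _ _ _ H) in H.
  apply is_derive_Reals in H. destruct (H (- Derive u z) ltac:(lra)) as [d Hlim].
  specialize (Hlim (d / 2) ltac:(assert (q := cond_pos d); lra)
    ltac:(assert (q := cond_pos d); rewrite Rabs_pos_eq; lra)).
  apply Rabs_def2 in Hlim. destruct Hlim as [H1 _].
  assert (q := cond_pos d).
  assert (Hu : u z < u (z + d / 2)) by (apply Hi; lra).
  assert (0 < (u (z + d / 2) - u z) / (d / 2)) by (apply Rdiv_lt_0_compat; lra).
  lra.
Qed.

(** * Fourier modes of a half-plane solution *)

Section Trace.

Variables (g : R -> R) (ky c k : R) (phi phix phiz : R -> R -> R).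
Hypothesis (ky_pos : 0 < ky) (c_ge : 0 <= c).
Hypothesis (interior : forall x z, x < 0 -> ex_diff_n phi 2 x z).
Hypothesis (Hx : forall x z, x <= 0 ->
     filterdiff (fun s => phi s z) (within (fun s => s <= 0) (locally x))
       (fun h => scal h (phix x z))).
Hypothesis (Hz : forall x z, x <= 0 -> is_derive (fun t => phi x t) z (phiz x z)).
Hypothesis (C0 : continuous_on half_plane (fun p => phi (fst p) (snd p))).
Hypothesis (Cx : continuous_on half_plane (fun p => phix (fst p) (snd p))).
Hypothesis (Cz : continuous_on half_plane (fun p => phiz (fst p) (snd p))).
Hypothesis (Heq : forall x z, x < 0 ->
       0 = Derive_n (fun s => phi s z) 2 x
           + ky ^ 2 * Derive_n (fun t => phi x t) 2 z
           + c * phix x z - k * c * phiz x z).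
Hypothesis (Hper : forall x z, x <= 0 -> 0 = phi x (z + 2 * PI) - phi x z - 2 * PI).
Hypothesis (Hbc : forall z, 0 = phix 0 z - g (phi 0 z)).
Hypothesis (Hlim : forall z, is_lim (fun x => Rabs (phi x z - (k * x + z))) m_infty 0).
Hypothesis (Hinc : increasing_zeta phi).

Let psi (x z : R) : R := phi x z - (k * x + z).
Let psix (x z : R) : R := phix x z - k.
Let psiz (x z : R) : R := phiz x z - 1.
Let psixx (x z : R) : R := Derive_n (fun s => phi s z) 2 x.
Let psizz (x z : R) : R := Derive_n (fun t => phi x t) 2 z.

Let mode (F : R -> R -> R) (e : nat -> R -> R) (n : nat) (x : R) : R :=
  RInt (fun z => F x z * e n z) 0 (2 * PI).
Let ecos (n : nat) (z : R) : R := cos (INR n * z).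
Let esin (n : nat) (z : R) : R := sin (INR n * z).

Let ct_ecos (n : nat) (z : R) : continuous (ecos n) z.
Proof. unfold ecos; ctn. Qed.

Let ct_esin (n : nat) (z : R) : continuous (esin n) z.
Proof. unfold esin; ctn. Qed.

Let dphix x z : x < 0 -> is_derive (fun s => phi s z) x (phix x z).
Proof. intros H. apply is_derive_of_within; [exact H|]. apply Hx; lra. Qed.

Let dpsi y z : y < 0 -> is_derive (fun y => psi y z) y (psix y z).
Proof.
  intros H. unfold psi, psix.
  apply (is_derive_minus (K := R_AbsRing) (V := R_NormedModule) (fun y => phi y z) (fun y => k * y + z)).
  - now apply dphix.
  - auto_derive; [exact I|]. ring.
Qed.

Let dpsix y z : y < 0 -> is_derive (fun y => psix y z) y (psixx y z).
Proof.
  intros H. unfold psix, psixx.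
  replace (Derive_n (fun s => phi s z) 2 y) with (minus (Derive_n (fun s => phi s z) 2 y) 0)
    by (unfold minus, plus, opp; simpl; ring).
  apply (is_derive_minus (K := R_AbsRing) (V := R_NormedModule) (fun y => phix y z) (fun y => k)).
  - destruct (interior y z H) as [_ [_ [_ [[_ [Hd _]] _]]]].
    apply Derive_correct in Hd.
    apply (is_derive_ext_loc (fun x => Derive (fun s => phi s z) x)); [|exact Hd].
    generalize (locally_neg y H). apply filter_imp. intros s Hs. now apply is_derive_unique, dphix.
  - apply (is_derive_const (K := R_AbsRing) (V := R_NormedModule)).
Qed.

Let dpsiz x z : x <= 0 -> is_derive (psi x) z (psiz x z).
Proof.
  intros H. unfold psi, psiz.
  apply (is_derive_minus (K := R_AbsRing) (V := R_NormedModule) (phi x) (fun z => k * x + z)).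
  - now apply Hz.
  - auto_derive; [exact I|]. ring.
Qed.

Let dpsizz x z : x < 0 -> is_derive (psiz x) z (psizz x z).
Proof.
  intros H. unfold psiz, psizz.
  replace (Derive_n (fun t => phi x t) 2 z) with (minus (Derive_n (fun t => phi x t) 2 z) 0)
    by (unfold minus, plus, opp; simpl; ring).
  apply (is_derive_minus (K := R_AbsRing) (V := R_NormedModule) (phiz x) (fun y => 1)).
  - destruct (interior x z H) as [_ [_ [_ [_ [_ [_ [Hd _]]]]]]].
    apply Derive_correct in Hd.
    apply (is_derive_ext (fun z => Derive (fun t => phi x t) z)); [|exact Hd].
    intros s. apply is_derive_unique, Hz. lra.
  - apply (is_derive_const (K := R_AbsRing) (V := R_NormedModule)).
Qed.

Let ct_row (F : R * R -> R) (x z : R) : continuous F (x, z) -> continuous (fun z => F (x, z)) z.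
Proof.
  intros H. apply (continuous_comp_2 (fun _ => x) (fun z => z) (fun a b => F (a, b))).
  - apply continuous_const.
  - apply continuous_id.
  - eapply continuous_ext; [|exact H]. now intros [a b].
Qed.

Let ct2_psixx x z : x < 0 -> continuity_2d_pt psixx x z.
Proof.
  intros H. destruct (interior x z H) as [_ [_ [_ [[_ [_ [_ [[Hc _] _]]]] _]]]]. exact Hc.
Qed.

Let ct2_psizz x z : x < 0 -> continuity_2d_pt psizz x z.
Proof.
  intros H. destruct (interior x z H) as [_ [_ [_ [_ [_ [_ [_ [_ [Hc _]]]]]]]]]. exact Hc.
Qed.

Let ct_of_2d (F : R -> R -> R) x z : continuity_2d_pt F x z -> continuous (F x) z.
Proof.
  intros H. apply continuity_2d_pt_filterlim in H.
  now apply (ct_row (fun p => F (fst p) (snd p))).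
Qed.

Let clamp_psi p : continuous (fun p => psi (Rmin (fst p) 0) (snd p)) p.
Proof.
  unfold psi. apply ct_minus; [exact (ct_clamp _ C0 p)|].
  apply ct_plus; [|ctn]. apply ct_mult; [apply continuous_const|].
  apply (ct_clamp fst). intros q _ P HP.
  apply filter_le_within. destruct q; exact (continuous_fst _ _ P HP).
Qed.

Let clamp_psix p : continuous (fun p => psix (Rmin (fst p) 0) (snd p)) p.
Proof. unfold psix. apply ct_minus; [exact (ct_clamp _ Cx p)|ctn]. Qed.

Let clamp_psiz p : continuous (fun p => psiz (Rmin (fst p) 0) (snd p)) p.
Proof. unfold psiz. apply ct_minus; [exact (ct_clamp _ Cz p)|ctn]. Qed.

Let ct_of_clamp (F : R -> R -> R) x z : x <= 0 ->
  (forall p, continuous (fun p => F (Rmin (fst p) 0) (snd p)) p) -> continuous (F x) z.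
Proof.
  intros H HF. apply (continuous_ext (fun z => F (Rmin x 0) z)).
  - intros t. now rewrite Rmin_left.
  - apply (ct_row (fun p => F (Rmin (fst p) 0) (snd p)) x z), HF.
Qed.

Let ct2_of_clamp (F : R -> R -> R) x z : x < 0 ->
  (forall p, continuous (fun p => F (Rmin (fst p) 0) (snd p)) p) -> continuity_2d_pt F x z.
Proof.
  intros H HF. destruct (locally_neg x H) as [d Hd].
  apply continuity_2d_pt_ext_loc with (fun u v => F (Rmin u 0) v).
  - exists d. intros u v Hu Hv. rewrite Rmin_left; [reflexivity|]. left. now apply Hd.
  - apply (ct_pair (fun p => F (Rmin (fst p) 0) (snd p))), HF.
Qed.

Let left_ct_mode (F : R -> R -> R) (e : nat -> R -> R) n :
  (forall p, continuous (fun p => F (Rmin (fst p) 0) (snd p)) p) ->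
  (forall z, continuous (e n) z) -> left_continuous_at_0 (mode F e n).
Proof.
  intros HF He. unfold left_continuous_at_0, mode.
  apply (ct_rint_param (fun p => F (Rmin (fst p) 0) (snd p) * e n (snd p))).
  - left; apply two_pi_pos.
  - intros p. apply ct_mult; [apply HF|ctn].
Qed.

Let psi_per x z : x <= 0 -> psi x (z + 2 * PI) = psi x z.
Proof. intros H. unfold psi. assert (E := Hper x z H). lra. Qed.

Let psiz_per x z : x <= 0 -> psiz x (z + 2 * PI) = psiz x z.
Proof.
  intros H. apply (periodic_derive (psi x)); intros; [now apply dpsiz|now apply psi_per].
Qed.

Let modes_psiz n x : x <= 0 ->
  mode psiz ecos n x = INR n * mode psi esin n x /\
  mode psiz esin n x = - INR n * mode psi ecos n x.
Proof.
  intros H. assert (E : psi x (2 * PI) = psi x 0).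
  { rewrite <- (psi_per x 0 H). f_equal; ring. }
  unfold mode, ecos, esin. split.
  - apply rint_derive_cos; auto.
  - apply rint_derive_sin; auto.
Qed.

Let modes_psizz n x : x < 0 ->
  mode psizz ecos n x = - INR n ^ 2 * mode psi ecos n x /\
  mode psizz esin n x = - INR n ^ 2 * mode psi esin n x.
Proof.
  intros H. destruct (modes_psiz n x ltac:(lra)) as [E1 E2].
  assert (E : psiz x (2 * PI) = psiz x 0).
  { rewrite <- (psiz_per x 0 ltac:(lra)). f_equal; ring. }
  assert (D1 : mode psizz ecos n x = INR n * mode psiz esin n x).
  { apply (rint_derive_cos (psiz x) (psizz x)); auto. }
  assert (D2 : mode psizz esin n x = - INR n * mode psiz ecos n x).
  { apply (rint_derive_sin (psiz x) (psizz x)); auto. }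
  rewrite D1, D2, E1, E2. split; ring.
Qed.

Let mode_eq (e : nat -> R -> R) n x : (forall z, continuous (e n) z) -> x < 0 ->
  mode psixx e n x = - ky ^ 2 * mode psizz e n x - c * mode psix e n x + k * c * mode psiz e n x.
Proof.
  intros He H. unfold mode.
  assert (K1 : forall z, continuous (psizz x) z) by (intros; auto).
  assert (K2 : forall z, continuous (psix x) z) by (intros; apply ct_of_clamp; auto; lra).
  assert (K3 : forall z, continuous (psiz x) z) by (intros; apply ct_of_clamp; auto; lra).
  rewrite <- !rint_scal, <- rint_minus, <- rint_plus by ctn.
  apply rint_ext. intros z. assert (E := Heq x z H).
  unfold psixx, psizz, psix, psiz.
  replace (Derive_n (fun s => phi s z) 2 x) with
   (- ky ^ 2 * Derive_n (fun t => phi x t) 2 z - c * phix x z + k * c * phiz x z) by lra.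
  ring.
Qed.

Let d_mode (e : nat -> R -> R) n x : (forall z, continuous (e n) z) -> x < 0 ->
  is_derive (mode psi e n) x (mode psix e n x).
Proof.
  intros He H. apply (is_derive_mode psi psix (e n) x H); auto.
Qed.

Let d_modex (e : nat -> R -> R) n x : (forall z, continuous (e n) z) -> x < 0 ->
  is_derive (mode psix e n) x (mode psixx e n x).
Proof.
  intros He H. apply (is_derive_mode psix psixx (e n) x H); auto.
Qed.

Let mode_decay (e : nat -> R -> R) n : (forall z, continuous (e n) z) -> (forall z, Rabs (e n z) <= 1) ->
  vanishes_at_minus_infty (mode psi e n).
Proof.
  intros He Hb eps Heps. assert (H2 := two_pi_pos).
  destruct (monotone_uniform_decay phi k Hinc Hlim (eps / (2 * PI))) as [X [HX H]].
  { apply Rdiv_lt_0_compat; lra. }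
  exists X; split; [exact HX|]. intros x Hx0. unfold mode.
  replace eps with ((2 * PI - 0) * (eps / (2 * PI))) by (field; lra).
  apply abs_RInt_le_const; [lra|apply rint_ex|].
  - intros z. apply ct_mult; [apply ct_of_clamp; auto; lra|apply He].
  - intros z Hz0. rewrite Rabs_mult. specialize (H x z Hx0 Hz0). fold (psi x z) in H.
    rewrite <- (Rmult_1_r (eps / (2 * PI))).
    apply Rmult_le_compat; try apply Rabs_pos; auto.
Qed.

Let cos_abs n z : Rabs (ecos n z) <= 1.
Proof. apply Rabs_le, COS_bound. Qed.

Let sin_abs n z : Rabs (esin n z) <= 1.
Proof. apply Rabs_le, SIN_bound. Qed.

Lemma boundary_trace_of_solution : boundary_trace g ky c k (phi 0) (phiz 0).
Proof.
  assert (H2 := two_pi_pos).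
  assert (Hg : forall z, g (phi 0 z) = phix 0 z) by (intros z; specialize (Hbc z); lra).
  assert (E0 : forall z, psi 0 z = phi 0 z - z) by (intros z; unfold psi; ring).
  assert (Kx : forall z, continuous (psix 0) z) by (intros; apply ct_of_clamp; auto; lra).
  assert (Kp : forall z, continuous (phix 0) z).
  { intros z. apply (continuous_ext (fun z => psix 0 z + k)); [intros t; unfold psix; toR; ring|ctn]. }
  (* [ecos 0] is the constant 1, and the factors [INR 0] remove both terms with derivatives in [z],
     which leaves the equation of [decaying_mean]. *)
  assert (Mean : mode psi ecos 0 0 = 0 /\ mode psix ecos 0 0 = 0).
  { apply (decaying_mean _ _ c c_ge).
    - intros x H. now apply d_mode.
    - intros x H. replace (- c * mode psix ecos 0 x) with (mode psixx ecos 0 x); [now apply d_modex|].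
      rewrite mode_eq by auto. destruct (modes_psizz 0 x H) as [-> _].
      destruct (modes_psiz 0 x ltac:(lra)) as [-> _]. simpl. ring.
    - now apply mode_decay.
    - now apply left_ct_mode.
    - now apply left_ct_mode. }
  destruct Mean as [M1 M2].
  constructor.
  - intros z. apply Hz. lra.
  - intros z. apply (continuous_ext (fun z => psiz 0 z + 1)); [intros t; unfold psiz; toR; ring|].
    apply ct_plus; [apply ct_of_clamp; auto; lra|apply continuous_const].
  - apply (derive_nonneg_of_increasing (phi 0)).
    + intros z. apply Hz; lra.
    + intros; apply Hinc; lra.
  - intros; apply Hinc; lra.
  - intros z. specialize (Hper 0 z ltac:(lra)). lra.
  - etransitivity; [|exact M1]. apply rint_ext. intros z. rewrite E0. unfold ecos. simpl. rewrite Rmult_0_l, cos_0. ring.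
  - unfold mode in M2.
    rewrite (rint_ext _ (fun z => phix 0 z - k)) in M2.
    + rewrite rint_minus, rint_const in M2 by ctn.
      rewrite (rint_ext (fun z => g (phi 0 z)) (phix 0) _ _ Hg). lra.
    + intros z. unfold psix, ecos. simpl. rewrite Rmult_0_l, cos_0. toR. ring.
  - intros n.
    assert (HS : 0 < INR (S n)) by (apply lt_0_INR; lia).
    destruct (mode_root_exists c (ky ^ 2 * INR (S n) ^ 2) (k * c * INR (S n)) c_ge) as [p [q [Hp [HA HB]]]].
    { apply Rmult_lt_0_compat; apply pow_lt; assumption. }
    exists p, q. split; [exact Hp|]. split; [exact HA|]. split; [exact HB|].
    destruct (decaying_mode (mode psi ecos (S n)) (mode psi esin (S n)) (mode psix ecos (S n)) (mode psix esin (S n))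
      c _ _ p q c_ge Hp HA HB) as [R1 R2]; auto.
    + intros x H.
      match goal with |- is_derive _ _ ?r => replace r with (mode psixx ecos (S n) x); [now apply d_modex|] end.
      rewrite mode_eq by auto. destruct (modes_psizz (S n) x H) as [-> _].
      destruct (modes_psiz (S n) x ltac:(lra)) as [-> _]. ring.
    + intros x H.
      match goal with |- is_derive _ _ ?r => replace r with (mode psixx esin (S n) x); [now apply d_modex|] end.
      rewrite mode_eq by auto. destruct (modes_psizz (S n) x H) as [_ ->].
      destruct (modes_psiz (S n) x ltac:(lra)) as [_ ->]. ring.
    + assert (F1 : fcos (fun z => phi 0 z - z) (S n) = mode psi ecos (S n) 0).
      { apply rint_ext; intros z. now rewrite E0. }
      assert (F2 : fsin (fun z => phi 0 z - z) (S n) = mode psi esin (S n) 0).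
      { apply rint_ext; intros z. now rewrite E0. }
      (* [g(u)] and [psix 0] differ by the constant [k], which has no coefficient of index [S n]. *)
      rewrite F1, F2, <- R1, <- R2. unfold mode, psix, fcos, fsin, ecos, esin. split.
      * rewrite (rint_ext (fun z => (phix 0 z - k) * cos (INR (S n) * z)) (fun z => phix 0 z * cos (INR (S n) * z) - k * cos (INR (S n) * z))) by (intros; toR; ring).
        rewrite rint_minus, rint_scal, rint_cos_nat by ctn.
        rewrite (rint_ext (fun z => g (phi 0 z) * cos (INR (S n) * z)) (fun z => phix 0 z * cos (INR (S n) * z))) by (intros; now rewrite Hg). now rewrite Rmult_0_r, Rminus_0_r.
      * rewrite (rint_ext (fun z => (phix 0 z - k) * sin (INR (S n) * z)) (fun z => phix 0 z * sin (INR (S n) * z) - k * sin (INR (S n) * z))) by (intros; toR; ring).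
        rewrite rint_minus, rint_scal, rint_sin_nat by ctn.
        rewrite (rint_ext (fun z => g (phi 0 z) * sin (INR (S n) * z)) (fun z => phix 0 z * sin (INR (S n) * z))) by (intros; now rewrite Hg). now rewrite Rmult_0_r, Rminus_0_r.
Qed.

End Trace.

Lemma solution_boundary_trace (g : R -> R) (ky c k : R) (phi : R -> R -> R) :
  0 < ky -> 0 <= c -> monotone_stripe_solution g ky c k phi ->
  exists u', boundary_trace g ky c k (phi 0) u'.
Proof.
  intros Hky Hc [[Hi [phix [phiz [[H1 [H2 [H3 [H4 H5]]]] [H6 [H7 [H8 H9]]]]]]] Hm].
  exists (phiz 0). now apply boundary_trace_of_solution with (phix := phix).
Qed.

(** * Estimates on one trace *)


Definition zeta2 : R := Series (fun n => / INR (S n) ^ 2).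

Lemma series_inv_sq_bound (x : nat -> R) (K : R) :
  (forall n, Rabs (x n) <= K * / INR (S n) ^ 2) -> ex_series x /\ Rabs (Series x) <= K * zeta2.
Proof.
  intros H. unfold zeta2. rewrite <- Series_scal_l.
  apply series_abs_le; [exact H|]. apply ex_series_cmul, ex_series_inv_sq.
Qed.

Lemma INR_S_ge_1 (n : nat) : 1 <= INR (S n).
Proof. rewrite S_INR. assert (H := pos_INR n). lra. Qed.

Section Estimates.

Variables (g g' : R -> R) (G0 G1 ky : R).
Hypothesis (g_derive : forall s, is_derive g s (g' s)).
Hypothesis (ct_g' : forall s, continuous g' s).
Hypothesis (g_bound : forall s, Rabs (g s) <= G0).
Hypothesis (g'_bound : forall s, Rabs (g' s) <= G1).
Hypothesis (g_periodic : forall s, g (s + 2 * PI) = g s).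
Hypothesis (ky_pos : 0 < ky).

(** With [l = INR (S n)], these constants serve in $|q| \le Qc$, $|p - k_y l| \le Ec$, $|q -
    kc/(2k_y)| \le Fc^2$, and in the bound $B/l^2$ for the coefficients of [u - id]. They involve
    [g] and [ky] only, hence are uniform over all traces. *)
Let Q : R := G0 / (2 * ky).
Let E : R := 3 / 4 + Q ^ 2.
Let F : R := Q * (1 / 4 + Q ^ 2) / ky.
Let B : R := 6 * PI * G1 / ky.

Let ct_g s : continuous g s.
Proof. eapply ct_derive, g_derive. Qed.

Let G0_ge : 0 <= G0.
Proof. eapply Rle_trans; [apply Rabs_pos|apply (g_bound 0)]. Qed.

Let G1_ge : 0 <= G1.
Proof. eapply Rle_trans; [apply Rabs_pos|apply (g'_bound 0)]. Qed.

Let Q_ge : 0 <= Q.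
Proof. unfold Q. apply Rdiv_le_0_compat; lra. Qed.

(** For $P = p + c/2$ the mode equations are $P^2 = k_y^2l^2 + c^2/4 + q^2$ and $2Pq = kcl$. So $P
    \ge k_y l$, which bounds [q], and then $P - k_y l = (c^2/4 + q^2)/(P + k_y l)$ is small. The
    range $c \le k_y$ gives $p \ge k_y l/2$ and turns $c^2/k_y$ into $c$. *)
Lemma mode_rate_bounds (c k p q l : R) : 0 <= c <= ky -> Rabs k <= G0 -> 1 <= l -> 0 < p ->
  p ^ 2 - q ^ 2 + c * p = ky ^ 2 * l ^ 2 -> 2 * p * q + c * q = k * c * l ->
  ky * l / 2 <= p /\ Rabs q <= Q * c /\ Rabs (p - ky * l) <= E * c /\
  Rabs (q - k * c / (2 * ky)) <= F * c ^ 2.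
Proof.
  intros Hc Hk Hl Hp H1 H2. set (P := p + c / 2).
  assert (HP : 0 < P) by (unfold P; lra).
  assert (HP2 : P ^ 2 = (ky * l) ^ 2 + (c ^ 2 / 4 + q ^ 2)) by (unfold P; nra).
  assert (Hq : 2 * P * q = k * c * l) by (unfold P; nra).
  assert (Hkl : ky <= ky * l) by nra.
  assert (HPl : ky * l <= P).
  { apply Rnot_lt_le; intros Hn. assert (0 <= c ^ 2 / 4 + q ^ 2) by nra. nra. }
  assert (Eq : q = k * c * l / (2 * P)) by (rewrite <- Hq; field; lra).
  assert (Bq : Rabs q <= Q * c).
  { rewrite Eq. unfold Rdiv. rewrite !Rabs_mult, (Rabs_pos_eq c), (Rabs_pos_eq l), Rabs_inv, (Rabs_pos_eq (2 * P)) by lra.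
    apply Rmult_le_reg_r with (2 * P); [lra|].
    replace (Rabs k * c * l * / (2 * P) * (2 * P)) with (Rabs k * c * l) by (field; lra).
    apply Rle_trans with (G0 * c * l).
    - apply Rmult_le_compat_r; [lra|]. apply Rmult_le_compat_r; lra.
    - replace (G0 * c * l) with (Q * c * (2 * (ky * l))) by (unfold Q; field; lra).
      apply Rmult_le_compat_l; [apply Rmult_le_pos; lra|lra]. }
  assert (Bq2 : q ^ 2 <= Q ^ 2 * c ^ 2).
  { rewrite <- (pow2_abs q). replace (Q ^ 2 * c ^ 2) with ((Q * c) ^ 2) by ring.
    apply pow_incr; split; [apply Rabs_pos|exact Bq]. }
  assert (HD : 0 <= (P - ky * l) * ky <= (1 / 4 + Q ^ 2) * c ^ 2).
  { split; [apply Rmult_le_pos; lra|].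
    apply Rle_trans with ((P - ky * l) * (P + ky * l)); [apply Rmult_le_compat_l; lra|]. nra. }
  assert (HD' : P - ky * l <= (1 / 4 + Q ^ 2) * c).
  { apply Rmult_le_reg_r with ky; [lra|]. eapply Rle_trans; [apply HD|].
    assert (0 <= (1 / 4 + Q ^ 2) * c) by (apply Rmult_le_pos; nra).
    replace ((1 / 4 + Q ^ 2) * c ^ 2) with ((1 / 4 + Q ^ 2) * c * c) by ring.
    apply Rmult_le_compat_l; lra. }
  split; [unfold P in *; nra|split; [exact Bq|split]].
  - unfold E. apply Rabs_le. unfold P in *. assert (0 <= Q ^ 2 * c) by (apply Rmult_le_pos; nra). lra.
  - assert (Ed : q - k * c / (2 * ky) = - (k * c * (P - ky * l)) / (2 * ky * P)) by (rewrite Eq; field; lra).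
    rewrite Ed. unfold Rdiv. rewrite Rabs_mult, Rabs_Ropp, !Rabs_mult, Rabs_inv, (Rabs_pos_eq c), (Rabs_pos_eq (P - ky * l)),
     (Rabs_pos_eq (2 * ky * P)) by nra.
    apply Rmult_le_reg_r with (2 * ky * P); [nra|].
    replace (Rabs k * c * (P - ky * l) * / (2 * ky * P) * (2 * ky * P)) with (Rabs k * c * (P - ky * l)) by (field; lra).
    apply Rle_trans with (G0 * c * ((1 / 4 + Q ^ 2) * c)).
    + apply Rmult_le_compat; try lra.
      * apply Rmult_le_pos; [apply Rabs_pos|lra].
      * apply Rmult_le_compat_r; lra.
    + replace (G0 * c * ((1 / 4 + Q ^ 2) * c)) with (F * c ^ 2 * (2 * ky * ky)) by (unfold F, Q; field; lra).
      apply Rmult_le_compat_l; [|apply Rmult_le_compat_l; lra].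
      unfold F. apply Rmult_le_pos; [|apply pow2_ge_0]. apply Rdiv_le_0_compat; [|lra].
      apply Rmult_le_pos; [exact Q_ge|nra].
Qed.

(** * Estimates uniform over the traces with [0 <= c <= ky] *)

Section OneTrace.

Variables (c k : R) (u u' : R -> R).
Hypothesis (c_range : 0 <= c <= ky).
Hypothesis (T : boundary_trace g ky c k u u').

Let du := trace_derive _ _ _ _ _ _ T.
Let ct_u' := trace_ct _ _ _ _ _ _ T.
Let u'_ge := trace_nonneg _ _ _ _ _ _ T.
Let u_incr := trace_incr _ _ _ _ _ _ T.
Let u_shift := trace_shift _ _ _ _ _ _ T.

Let ct_u z : continuous u z.
Proof. eapply ct_derive, du. Qed.

Let psi (z : R) : R := u z - z.
Let w (z : R) : R := g (u z).
Let w' (z : R) : R := g' (u z) * u' z.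
Let C (n : nat) : R := fcos psi (S n).
Let D (n : nat) : R := fsin psi (S n).

Lemma trace_dev_periodic z : u (z + 2 * PI) - (z + 2 * PI) = u z - z.
Proof. rewrite u_shift. ring. Qed.

Let dw z : is_derive w z (w' z).
Proof.
  unfold w, w'. evar_last.
  - apply (is_derive_comp (K := R_AbsRing) (V := R_NormedModule) g u z _ _ (g_derive _) (du z)).
  - unfold scal; simpl; unfold mult; simpl. ring.
Qed.

Let dpsi z : is_derive psi z (u' z - 1).
Proof.
  unfold psi. apply (is_derive_minus (K := R_AbsRing) (V := R_NormedModule) u (fun z => z) z _ 1 (du z)).
  apply (is_derive_id (K := R_AbsRing)).
Qed.

Let ct_w z : continuous w z.
Proof. eapply ct_derive, dw. Qed.

Let ct_w' z : continuous w' z.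
Proof. unfold w'. ctn. Qed.

Let ct_psi z : continuous psi z.
Proof. eapply ct_derive, dpsi. Qed.

Let w_per z : w (z + 2 * PI) = w z.
Proof. unfold w. now rewrite u_shift, g_periodic. Qed.

Let u'_per z : u' (z + 2 * PI) = u' z.
Proof.
  assert (H := periodic_derive psi (fun z => u' z - 1) (2 * PI) dpsi trace_dev_periodic z).
  cbv beta in H. lra.
Qed.

Lemma trace_wavenumber_bound : Rabs k <= G0.
Proof.
  assert (H2 := two_pi_pos). assert (H := trace_mean_g _ _ _ _ _ _ T).
  assert (H1 : Rabs (RInt (fun z => g (u z)) 0 (2 * PI)) <= (2 * PI - 0) * G0).
  { apply abs_RInt_le_const; [lra|apply rint_ex; exact ct_w|]. intros; apply g_bound. }
  rewrite H, Rabs_mult, (Rabs_pos_eq (2 * PI)) in H1 by lra.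
  apply Rmult_le_reg_l with (2 * PI); lra.
Qed.

(** Over a period starting at [z], both [u] and the identity grow by [2 PI], so [psi] stays within
    [2 PI] of [psi z]; and its mean is zero. *)
Lemma trace_dev_bound z : Rabs (u z - z) <= 2 * PI.
Proof.
  assert (H2 := two_pi_pos).
  assert (E0 : RInt psi z (z + 2 * PI) = 0).
  { rewrite rint_period; [apply (trace_mean _ _ _ _ _ _ T)|exact ct_psi|exact trace_dev_periodic]. }
  assert (W : forall y, z <= y <= z + 2 * PI -> u z - z - 2 * PI <= psi y <= u z - z + 2 * PI).
  { intros y Hy. unfold psi.
    assert (u z <= u y) by (destruct (Req_dec z y) as [->|]; [lra|left; apply u_incr; lra]).
    assert (u y <= u (z + 2 * PI)) by (destruct (Req_dec y (z + 2 * PI)) as [->|]; [lra|left; apply u_incr; lra]).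
    rewrite u_shift in *. lra. }
  assert (L1 : RInt (fun _ => u z - z - 2 * PI) z (z + 2 * PI) <= RInt psi z (z + 2 * PI)).
  { apply rint_le; auto; [lra|ctn|]. intros; now apply W. }
  assert (L2 : RInt psi z (z + 2 * PI) <= RInt (fun _ => u z - z + 2 * PI) z (z + 2 * PI)).
  { apply rint_le; auto; [lra|ctn|]. intros; now apply W. }
  rewrite E0, rint_const in L1, L2.
  apply Rabs_le. split; nra.
Qed.

(** Integration by parts against the total variation of [w]: as [u' >= 0] integrates to [2 PI], the
    integral of $|w'|$ is at most [2 PI G1], with no pointwise bound on [u']. *)
Let coef_w n : Rabs (fcos w (S n)) <= 2 * PI * G1 / INR (S n) /\ Rabs (fsin w (S n)) <= 2 * PI * G1 / INR (S n).
Proof.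
  assert (H2 := two_pi_pos). assert (Hl := INR_S_ge_1 n).
  assert (Ew : w (2 * PI) = w 0) by (rewrite <- (w_per 0); f_equal; ring).
  assert (K : forall e : R -> R, (forall z, continuous e z) -> (forall z, Rabs (e z) <= 1) ->
    Rabs (RInt (fun z => w' z * e z) 0 (2 * PI)) <= 2 * PI * G1).
  { intros e He He1. eapply Rle_trans.
    - apply (rint_abs_le _ (fun z => G1 * u' z)); [lra|ctn|ctn|].
      intros z _. unfold w'. rewrite !Rabs_mult, (Rabs_pos_eq (u' z)) by apply u'_ge.
      specialize (He1 z). specialize (g'_bound (u z)). specialize (u'_ge z).
      assert (q1 := Rabs_pos (e z)). assert (q2 := Rabs_pos (g' (u z))).
      rewrite <- (Rmult_1_r (G1 * u' z)). apply Rmult_le_compat; try lra.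
      + apply Rmult_le_pos; lra.
      + apply Rmult_le_compat_r; lra.
    - rewrite rint_scal, (rint_derive u u') by auto.
      replace (u (2 * PI)) with (u 0 + 2 * PI) by (rewrite <- u_shift; f_equal; ring).
      apply Req_le. toR. ring. }
  assert (E1 := rint_derive_cos w w' (S n) dw ct_w' Ew).
  assert (E2 := rint_derive_sin w w' (S n) dw ct_w' Ew).
  assert (K1 := K (fun z => cos (INR (S n) * z)) ltac:(ctn) (fun z => Rabs_le _ _ (COS_bound _))).
  assert (K2 := K (fun z => sin (INR (S n) * z)) ltac:(ctn) (fun z => Rabs_le _ _ (SIN_bound _))).
  cbv beta in K1, K2. rewrite E1 in K1. rewrite E2 in K2. fold (fsin w (S n)) in K1. fold (fcos w (S n)) in K2.
  rewrite Rabs_mult, (Rabs_pos_eq (INR (S n))) in K1 by lra.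
  rewrite Rabs_mult, Rabs_Ropp, (Rabs_pos_eq (INR (S n))) in K2 by lra.
  split; apply Rmult_le_reg_l with (INR (S n)); try lra;
   (eapply Rle_trans; [eassumption|]); apply Req_le; field; lra.
Qed.

(** The coefficients of [w] are those of [psi] times a complex rate of modulus at least $k_y l/2$,
    which gains a power of $l$ over [coef_w]. The 6 in [B] is chosen for $8 \le 6^2/4$. *)
Lemma trace_coef_sq n : C n ^ 2 + D n ^ 2 <= B ^ 2 / INR (S n) ^ 4.
Proof.
  assert (H0 := PI_RGT_0). assert (Hl := INR_S_ge_1 n).
  destruct (trace_mode _ _ _ _ _ _ T n) as [p [q [Hp [HA [HB [M1 M2]]]]]].
  destruct (mode_rate_bounds c k p q (INR (S n)) c_range trace_wavenumber_bound Hl Hp HA HB) as [R1 _].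
  destruct (coef_w n) as [K1 K2].
  change (fcos w (S n) = p * C n + q * D n) in M1.
  change (fsin w (S n) = p * D n - q * C n) in M2.
  set (l := INR (S n)) in *. set (A := 2 * PI * G1 / l) in *.
  assert (HA0 : 0 <= A) by (eapply Rle_trans; [apply Rabs_pos|exact K1]).
  assert (S1 : fcos w (S n) ^ 2 <= A ^ 2) by (rewrite <- pow2_abs; apply pow_incr; split; [apply Rabs_pos|exact K1]).
  assert (S2 : fsin w (S n) ^ 2 <= A ^ 2) by (rewrite <- pow2_abs; apply pow_incr; split; [apply Rabs_pos|exact K2]).
  rewrite M1 in S1. rewrite M2 in S2.
  assert (S3 : p ^ 2 * (C n ^ 2 + D n ^ 2) <= 2 * A ^ 2).
  { apply Rle_trans with ((p ^ 2 + q ^ 2) * (C n ^ 2 + D n ^ 2)); [nra|].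
    replace ((p ^ 2 + q ^ 2) * (C n ^ 2 + D n ^ 2)) with ((p * C n + q * D n) ^ 2 + (p * D n - q * C n) ^ 2) by ring. lra. }
  assert (S4 : (ky * l / 2) ^ 2 <= p ^ 2) by (apply pow_incr; nra).
  assert (HX : 0 <= C n ^ 2 + D n ^ 2) by nra.
  assert (S5 : (ky * l / 2) ^ 2 * (C n ^ 2 + D n ^ 2) <= 2 * A ^ 2).
  { eapply Rle_trans; [|exact S3]. apply Rmult_le_compat_r; assumption. }
  apply Rmult_le_reg_l with ((ky * l / 2) ^ 2); [apply pow_lt; nra|].
  eapply Rle_trans; [exact S5|]. unfold A, B.
  replace (2 * (2 * PI * G1 / l) ^ 2) with (8 * (PI * G1) ^ 2 / l ^ 2) by (field; lra).
  replace ((ky * l / 2) ^ 2 * ((6 * PI * G1 / ky) ^ 2 / l ^ 4)) with (9 * (PI * G1) ^ 2 / l ^ 2) by (field; lra).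
  apply Rmult_le_compat_r; [left; apply Rinv_0_lt_compat, pow_lt; lra|].
  assert (0 <= (PI * G1) ^ 2) by apply pow2_ge_0. lra.
Qed.

Let B_ge : 0 <= B.
Proof.
  assert (H0 := PI_RGT_0). unfold B. apply Rdiv_le_0_compat; [|exact ky_pos].
  apply Rmult_le_pos; lra.
Qed.

Let coef_abs n : Rabs (C n) <= B * / INR (S n) ^ 2 /\ Rabs (D n) <= B * / INR (S n) ^ 2.
Proof.
  assert (Hl := INR_S_ge_1 n). assert (H := trace_coef_sq n).
  assert (Hb : 0 <= B * / INR (S n) ^ 2).
  { apply Rmult_le_pos; [exact B_ge|]. left; apply Rinv_0_lt_compat, pow_lt; lra. }
  replace (B ^ 2 / INR (S n) ^ 4) with ((B * / INR (S n) ^ 2) ^ 2) in H by (field; lra).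
  rewrite <- (Rabs_pos_eq (B * / INR (S n) ^ 2)) by exact Hb.
  split; apply Rsqr_le_abs_0; unfold Rsqr; nra.
Qed.

Lemma trace_energy_term n : 0 <= INR (S n) * (C n ^ 2 + D n ^ 2) <= B ^ 2 / INR (S n) ^ 3.
Proof.
  assert (Hl := INR_S_ge_1 n). assert (H := trace_coef_sq n). split.
  - apply Rmult_le_pos; [lra|nra].
  - replace (B ^ 2 / INR (S n) ^ 3) with (INR (S n) * (B ^ 2 / INR (S n) ^ 4)) by (field; lra).
    apply Rmult_le_compat_l; lra.
Qed.

Let inv3_le n K : 0 <= K -> K / INR (S n) ^ 3 <= K * / INR (S n) ^ 2.
Proof.
  intros HK. assert (Hl := INR_S_ge_1 n). apply Rmult_le_compat_l; [exact HK|].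
  apply Rinv_le_contravar; [apply pow_lt; lra|].
  replace (INR (S n) ^ 3) with (INR (S n) ^ 2 * INR (S n)) by ring.
  assert (0 < INR (S n) ^ 2) by (apply pow_lt; lra). nra.
Qed.

(* [2 pi^2] times the squared [H^{1/2}] seminorm of [u - id]. *)
Definition trace_energy : R := Series (fun n => INR (S n) * (C n ^ 2 + D n ^ 2)).

Lemma trace_energy_summable :
  ex_series (fun n => INR (S n) * (C n ^ 2 + D n ^ 2)) /\ Rabs trace_energy <= B ^ 2 * zeta2.
Proof.
  apply series_inv_sq_bound. intros n. assert (H := trace_energy_term n).
  rewrite Rabs_pos_eq by lra. eapply Rle_trans; [apply H|]. apply inv3_le, pow2_ge_0.
Qed.

(** This [L], like the bound [U] of [u'], depends on the trace; it only enters error terms that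
    vanish with [e]. *)
Let w_lip : exists L, forall y z, (w y - w z) ^ 2 <= L * (1 - cos (y - z)).
Proof.
  destruct (periodic_bounded w' (2 * PI) two_pi_pos ct_w') as [L [_ HL]].
  - apply (periodic_derive w w' (2 * PI) dw w_per).
  - exists (18 * L ^ 2). now apply (periodic_lip_cos w w').
Qed.

Let u'_bounded : exists U, 0 <= U /\ forall z, Rabs (u' z) <= U.
Proof. exact (periodic_bounded u' (2 * PI) two_pi_pos ct_u' u'_per). Qed.

Let psi_2pi : psi (2 * PI) = psi 0.
Proof. rewrite <- (trace_dev_periodic 0 : psi (0 + 2 * PI) = psi 0). f_equal; ring. Qed.

Let coef_dpsi n : fcos (fun z => u' z - 1) (S n) = INR (S n) * D n /\
  fsin (fun z => u' z - 1) (S n) = - INR (S n) * C n.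
Proof.
  split.
  - apply (rint_derive_cos psi (fun z => u' z - 1)); auto. ctn.
  - apply (rint_derive_sin psi (fun z => u' z - 1)); auto. ctn.
Qed.

(** Pairing with [u'] eliminates the unknown trace by a change of variables; this is how the mean of
    [g] enters. *)
Let rint_w_u' : RInt (fun z => w z * u' z) 0 (2 * PI) = RInt g 0 (2 * PI).
Proof.
  unfold w. rewrite (rint_comp g u u') by auto.
  replace (u (2 * PI)) with (u 0 + 2 * PI) by (rewrite <- u_shift; f_equal; ring).
  now apply rint_period.
Qed.

(* The boundary condition paired with [psi']: only the imaginary parts of the
   mode rates contribute. *)
Lemma wavenumber_defect :
  Rabs (PI * (RInt g 0 (2 * PI) - 2 * PI * k) - k * c / (2 * ky) * trace_energy) <= F * c ^ 2 * B ^ 2 * zeta2.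
Proof.
  destruct w_lip as [L HL]. destruct u'_bounded as [U [HU0 HU]].
  set (x := fun n => fcos w (S n) * fcos (fun z => u' z - 1) (S n) + fsin w (S n) * fsin (fun z => u' z - 1) (S n)).
  (* In the pairing of [w] with [psi'] the contributions of [p] cancel between the cosine and sine
     terms. *)
  assert (Hx : forall n, exists q, Rabs q <= Q * c /\ Rabs (q - k * c / (2 * ky)) <= F * c ^ 2 /\
     x n = q * (INR (S n) * (C n ^ 2 + D n ^ 2))).
  { intros n. destruct (trace_mode _ _ _ _ _ _ T n) as [p [q [Hp [HA [HB [M1 M2]]]]]].
    destruct (mode_rate_bounds c k p q (INR (S n)) c_range trace_wavenumber_bound (INR_S_ge_1 n) Hp HA HB) as [_ [R2 [_ R4]]].
    exists q. split; [exact R2|split; [exact R4|]].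
    change (fcos w (S n) = p * C n + q * D n) in M1. change (fsin w (S n) = p * D n - q * C n) in M2.
    unfold x. destruct (coef_dpsi n) as [-> ->]. rewrite M1, M2. ring. }
  assert (HS : Series x = PI * (RInt g 0 (2 * PI) - 2 * PI * k)).
  { unfold x. rewrite (parseval_cubic w (fun z => u' z - 1) L G0 (U + 1) (Q * c * B ^ 2)).
    - rewrite (rint_ext (fun z => w z * (u' z - 1)) (fun z => w z * u' z - w z)) by (intros; ring).
      rewrite rint_minus, rint_w_u', (trace_mean_g _ _ _ _ _ _ T : RInt w 0 (2 * PI) = _) by ctn.
      rewrite (rint_derive psi (fun z => u' z - 1)), psi_2pi by first [assumption|ctn].
      field.
    - exact ct_w.
    - ctn.
    - intros; apply g_bound.
    - intros z. eapply Rle_trans; [apply Rabs_triang|]. rewrite Rabs_Ropp, Rabs_R1. specialize (HU z). lra.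
    - exact HL.
    - intros n. fold (x n). destruct (Hx n) as [q [R2 [_ ->]]]. assert (H := trace_energy_term n).
      rewrite Rabs_mult, (Rabs_pos_eq (INR (S n) * _)) by lra.
      replace (Q * c * B ^ 2 / INR (S n) ^ 3) with (Q * c * (B ^ 2 / INR (S n) ^ 3)) by (unfold Rdiv; ring).
      apply Rmult_le_compat; [apply Rabs_pos|lra|exact R2|lra]. }
  assert (Bx : forall n, Rabs (x n - k * c / (2 * ky) * (INR (S n) * (C n ^ 2 + D n ^ 2))) <= F * c ^ 2 * B ^ 2 * / INR (S n) ^ 2).
  { intros n. destruct (Hx n) as [q [_ [R4 ->]]]. assert (H := trace_energy_term n).
    rewrite <- Rmult_minus_distr_r, Rabs_mult, (Rabs_pos_eq (INR (S n) * _)) by lra.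
    rewrite (Rmult_assoc (F * c ^ 2)).
    apply Rmult_le_compat; [apply Rabs_pos|lra|exact R4|].
    eapply Rle_trans; [apply H|]. apply inv3_le, pow2_ge_0. }
  destruct (series_inv_sq_bound _ _ Bx) as [X1 X2].
  destruct trace_energy_summable as [Y1 _].
  assert (Ex : ex_series x).
  { apply (ex_series_ext (fun n => (x n - k * c / (2 * ky) * (INR (S n) * (C n ^ 2 + D n ^ 2))) + k * c / (2 * ky) * (INR (S n) * (C n ^ 2 + D n ^ 2)))).
    - intros n; toR; ring.
    - apply (ex_series_plus (K := R_AbsRing) (V := R_NormedModule) _ _ X1). now apply ex_series_cmul. }
  rewrite Series_minus, Series_scal_l, HS in X2 by (try assumption; now apply ex_series_cmul).
  exact X2.
Qed.

(** Pairing with [psi] itself cancels the imaginary parts [q] instead, and the real parts [p] are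
    [ky l] up to O(c). *)
Lemma energy_pairing :
  Rabs (PI * RInt (fun z => (u z - z) * g (u z)) 0 (2 * PI) - ky * trace_energy) <= E * c * B ^ 2 * zeta2.
Proof.
  destruct w_lip as [L HL]. assert (E_ge : 0 <= E) by (unfold E; nra).
  set (x := fun n => fcos w (S n) * fcos psi (S n) + fsin w (S n) * fsin psi (S n)).
  assert (Hx : forall n, exists p, 0 <= p /\ Rabs (p - ky * INR (S n)) <= E * c /\
     x n = p * (C n ^ 2 + D n ^ 2)).
  { intros n. destruct (trace_mode _ _ _ _ _ _ T n) as [p [q [Hp [HA [HB [M1 M2]]]]]].
    destruct (mode_rate_bounds c k p q (INR (S n)) c_range trace_wavenumber_bound (INR_S_ge_1 n) Hp HA HB) as [_ [_ [R3 _]]].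
    exists p. split; [lra|split; [exact R3|]].
    change (fcos w (S n) = p * C n + q * D n) in M1. change (fsin w (S n) = p * D n - q * C n) in M2.
    unfold x. rewrite M1, M2. fold (C n) (D n). ring. }
  assert (HS : Series x = PI * RInt (fun z => (u z - z) * g (u z)) 0 (2 * PI)).
  { unfold x. rewrite (parseval_cubic w psi L G0 (2 * PI) ((ky + E * c) * B ^ 2)).
    - rewrite (trace_mean _ _ _ _ _ _ T : RInt psi 0 (2 * PI) = 0).
      rewrite (rint_ext (fun z => w z * psi z) (fun z => (u z - z) * g (u z))) by (intros; unfold w, psi; ring).
      unfold Rdiv. rewrite Rmult_0_r, Rmult_0_l. ring.
    - exact ct_w.
    - exact ct_psi.
    - intros; apply g_bound.
    - exact trace_dev_bound.
    - exact HL.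
    - intros n. fold (x n). destruct (Hx n) as [p [R1 [R3 ->]]]. assert (H := trace_coef_sq n).
      assert (Hl := INR_S_ge_1 n). apply Rabs_le_between in R3.
      assert (0 <= C n ^ 2 + D n ^ 2) by nra.
      rewrite Rabs_pos_eq by (apply Rmult_le_pos; lra).
      apply Rle_trans with ((ky + E * c) * INR (S n) * (B ^ 2 / INR (S n) ^ 4)).
      + apply Rmult_le_compat; try lra. assert (0 <= E * c) by (apply Rmult_le_pos; lra). nra.
      + apply Req_le. field. lra. }
  assert (Bx : forall n, Rabs (x n - ky * (INR (S n) * (C n ^ 2 + D n ^ 2))) <= E * c * B ^ 2 * / INR (S n) ^ 2).
  { intros n. destruct (Hx n) as [p [_ [R3 ->]]]. assert (H := trace_coef_sq n). assert (Hl := INR_S_ge_1 n).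
    assert (0 <= C n ^ 2 + D n ^ 2) by nra.
    replace (p * (C n ^ 2 + D n ^ 2) - ky * (INR (S n) * (C n ^ 2 + D n ^ 2))) with
      ((p - ky * INR (S n)) * (C n ^ 2 + D n ^ 2)) by ring.
    rewrite Rabs_mult, (Rabs_pos_eq (_ + _)) by lra.
    rewrite (Rmult_assoc (E * c)).
    apply Rmult_le_compat; [apply Rabs_pos|lra|exact R3|].
    eapply Rle_trans; [exact H|]. apply Rmult_le_compat_l; [apply pow2_ge_0|].
    apply Rinv_le_contravar; [apply pow_lt; lra|].
    replace (INR (S n) ^ 4) with (INR (S n) ^ 2 * INR (S n) ^ 2) by ring.
    assert (1 <= INR (S n) ^ 2) by nra. nra. }
  destruct (series_inv_sq_bound _ _ Bx) as [X1 X2].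
  destruct trace_energy_summable as [Y1 _].
  assert (Ex : ex_series x).
  { apply (ex_series_ext (fun n => (x n - ky * (INR (S n) * (C n ^ 2 + D n ^ 2))) + ky * (INR (S n) * (C n ^ 2 + D n ^ 2)))).
    - intros n; toR; ring.
    - apply (ex_series_plus (K := R_AbsRing) (V := R_NormedModule) _ _ X1). now apply ex_series_cmul. }
  rewrite Series_minus, Series_scal_l, HS in X2 by (try assumption; now apply ex_series_cmul).
  exact X2.
Qed.

(* Up to [O(c)], the boundary condition reads [g(u) - k = ky H u'] with the
   periodic Hilbert transform [H], here regularized by [r = 1 - e^2]. *)
Lemma trace_conjugate :
  exists K, 0 <= K /\ forall e z, 0 < e < 1 ->
   Rabs (2 * PI * (g (u z) - k) - ky * RInt (fun y => cpois (1 - e ^ 2) (z - y) * u' y) 0 (2 * PI))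
    <= 4 * (E + Q) * B * zeta2 * c + K * e.
Proof.
  destruct w_lip as [L HL]. destruct u'_bounded as [U [HU0 HU]]. assert (H2 := two_pi_pos).
  assert (E_ge : 0 <= E) by (unfold E; nra).
  (* The absolute value is taken because [w_lip] says nothing about the sign of [L]. *)
  exists (Rabs (2 * PI * (1 + L / 4))). split; [apply Rabs_pos|]. intros e z He.
  set (r := 1 - e ^ 2). assert (Hr : 0 <= r < 1) by (unfold r; nra).
  assert (A1 := poisson_approx w L e z He ct_w HL). fold r in A1.
  assert (S1 := poisson_series w G0 r z Hr ct_w (fun y => g_bound (u y))).
  assert (S2 := cpoisson_series u' U r z Hr ct_u' HU).
  rewrite (trace_mean_g _ _ _ _ _ _ T : RInt w 0 (2 * PI) = _) in S1.
  set (P1 := RInt (fun z0 => pois r (z - z0) * w z0) 0 (2 * PI)) in *.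
  set (P2 := RInt (fun y => cpois r (z - y) * u' y) 0 (2 * PI)) in *.
  (* The coefficients of [u'] are [l D] and [- l C], so its conjugate Abel sum is that of [psi] with
     the multiplier $|l|$. *)
  assert (S3 : is_series (fun n => r ^ S n * (INR (S n) * (C n * cos (INR (S n) * z) + D n * sin (INR (S n) * z)))) (P2 / 2)).
  { eapply is_series_ext; [|exact S2]. intros n. cbv beta.
    destruct (coef_dpsi n) as [F1 F2].
    assert (F3 : fcos u' (S n) = INR (S n) * D n).
    { rewrite <- F1. unfold fcos.
      rewrite (rint_ext (fun z => (u' z - 1) * cos (INR (S n) * z)) (fun z => u' z * cos (INR (S n) * z) - cos (INR (S n) * z))) by (intros; toR; ring).
      rewrite rint_minus, rint_cos_nat by ctn. now rewrite Rminus_0_r. }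
    assert (F4 : fsin u' (S n) = - INR (S n) * C n).
    { rewrite <- F2. unfold fsin.
      rewrite (rint_ext (fun z => (u' z - 1) * sin (INR (S n) * z)) (fun z => u' z * sin (INR (S n) * z) - sin (INR (S n) * z))) by (intros; toR; ring).
      rewrite rint_minus, rint_sin_nat by ctn. now rewrite Rminus_0_r. }
    rewrite F3, F4. toR; ring. }
  assert (S4 := is_series_minus (K := R_AbsRing) (V := R_NormedModule) _ _ _ _ S1 (is_series_scal (K := R_AbsRing) (V := R_NormedModule) ky _ _ S3)).
  (* The rates differ from [ky l] by O(c) uniformly in [l], and the coefficients of [psi] are
     O(1/l^2); hence the difference is absolutely summable, uniformly in [z] and [r]. *)
  assert (Bd : forall n, Rabs (minus
     (r ^ S n * (fcos w (S n) * cos (INR (S n) * z) + fsin w (S n) * sin (INR (S n) * z)))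
     (scal ky (r ^ S n * (INR (S n) * (C n * cos (INR (S n) * z) + D n * sin (INR (S n) * z)))))) <= 2 * (E + Q) * c * B * / INR (S n) ^ 2).
  { intros n. destruct (trace_mode _ _ _ _ _ _ T n) as [p [q [Hp [HA [HB [M1 M2]]]]]].
    destruct (mode_rate_bounds c k p q (INR (S n)) c_range trace_wavenumber_bound (INR_S_ge_1 n) Hp HA HB) as [_ [R2 [R3 _]]].
    change (fcos w (S n) = p * C n + q * D n) in M1. change (fsin w (S n) = p * D n - q * C n) in M2.
    rewrite M1, M2. destruct (coef_abs n) as [Ca Da].
    set (l := INR (S n)) in *. set (cs := cos (l * z)). set (sn := sin (l * z)).
    assert (Hcs : Rabs cs <= 1) by apply Rabs_le, COS_bound.
    assert (Hsn : Rabs sn <= 1) by apply Rabs_le, SIN_bound.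
    set (b := B * / l ^ 2) in *.
    match goal with |- Rabs ?t <= _ => replace t with
      (r ^ S n * ((p - ky * l) * (C n * cs + D n * sn) + q * (D n * cs - C n * sn)))
      by (unfold minus, plus, opp, scal; simpl; unfold mult; simpl; ring) end.
    assert (Hrn : 0 <= r ^ S n <= 1).
    { split; [apply pow_le; lra|]. rewrite <- (pow1 (S n)). apply pow_incr. lra. }
    assert (Hb : 0 <= b) by (eapply Rle_trans; [apply Rabs_pos|exact Ca]).
    assert (T1 : forall x y, Rabs x <= b -> Rabs y <= 1 -> Rabs (x * y) <= b).
    { intros x y Hx Hy. rewrite Rabs_mult. rewrite <- (Rmult_1_r b).
      apply Rmult_le_compat; try apply Rabs_pos; assumption. }
    assert (U1 : Rabs (C n * cs + D n * sn) <= 2 * b).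
    { eapply Rle_trans; [apply Rabs_triang|]. assert (q1 := T1 _ _ Ca Hcs). assert (q2 := T1 _ _ Da Hsn). lra. }
    assert (U2 : Rabs (D n * cs - C n * sn) <= 2 * b).
    { eapply Rle_trans; [apply Rabs_triang|]. rewrite Rabs_Ropp. assert (q1 := T1 _ _ Da Hcs). assert (q2 := T1 _ _ Ca Hsn). lra. }
    rewrite Rabs_mult, (Rabs_pos_eq (r ^ S n)) by lra.
    apply Rle_trans with (1 * (E * c * (2 * b) + Q * c * (2 * b))).
    - apply Rmult_le_compat; [lra|apply Rabs_pos|lra|].
      eapply Rle_trans; [apply Rabs_triang|]. rewrite !Rabs_mult.
      apply Rplus_le_compat; apply Rmult_le_compat; try apply Rabs_pos; assumption.
    - apply Req_le. unfold b. ring. }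
  destruct (series_inv_sq_bound _ _ Bd) as [_ X].
  assert (X' : Rabs (minus ((P1 - 2 * PI * k) / 2) (scal ky (P2 / 2))) <= 2 * (E + Q) * c * B * zeta2)
    by (eapply Rle_trans; [|exact X]; apply Req_le, f_equal; symmetry; exact (is_series_unique _ _ S4)).
  clear X. rename X' into X.
  unfold minus, plus, opp, scal in X; simpl in X; unfold mult in X; simpl in X.
  assert (Hz : w z = g (u z)) by reflexivity.
  apply Rabs_le_between in X. apply Rabs_le_between in A1. rewrite Hz in A1.
  assert (K1 : 2 * PI * ((1 + L / 4) * e) <= Rabs (2 * PI * (1 + L / 4)) * e).
  { replace (2 * PI * ((1 + L / 4) * e)) with (2 * PI * (1 + L / 4) * e) by ring.
    apply Rmult_le_compat_r; [lra|apply Rle_abs]. }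
  apply Rabs_le. nra.
Qed.

End OneTrace.

End Estimates.

(** * Monotonicity and stability *)


(** The bounded deviation from the identity localizes the solution of [u z = s] in [[s - B, s + B]].
    Differentiability of the inverse is not claimed, since [u'] may vanish. *)
Lemma increasing_inverse (u : R -> R) (B : R) :
  (forall z, continuous u z) -> (forall y z, y < z -> u y < u z) ->
  (forall z, Rabs (u z - z) <= B) ->
  exists a : R -> R, (forall s, u (a s) = s) /\ (forall z, a (u z) = z) /\
    (forall s t, s <= t -> a s <= a t) /\ (forall s, continuous a s).
Proof.
  intros Hc Hi HB.
  (* A sigma type, from which the inverse is defined by projection. *)
  assert (ex : forall s, {z | u z = s}).
  { intros s. destruct (IVT_gen u (s - B) (s + B) s) as [z [_ Hz]].
    - intros z. apply continuity_pt_filterlim, Hc.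
    - assert (H1 := HB (s - B)). assert (H2 := HB (s + B)).
      apply Rabs_le_between in H1. apply Rabs_le_between in H2.
      split.
      + eapply Rle_trans; [apply Rmin_l|]. lra.
      + eapply Rle_trans; [|apply Rmax_r]. lra.
    - now exists z. }
  set (a := fun s => proj1_sig (ex s)).
  assert (Ha : forall s, u (a s) = s) by (intros s; unfold a; destruct (ex s); assumption).
  assert (Hlt : forall y z, u y < u z -> y < z).
  { intros y z H. apply Rnot_le_lt; intros Hn. destruct (Req_dec z y) as [->|]; [lra|].
    assert (u z < u y) by (apply Hi; lra). lra. }
  exists a. split; [exact Ha|split; [|split]].
  - intros z. destruct (Rtotal_order (a (u z)) z) as [H|[H|H]]; [|exact H|]; apply Hi in H; rewrite Ha in H; lra.
  - intros s t Hst. apply Rnot_lt_le; intros H. apply Hi in H. rewrite !Ha in H. lra.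
  - intros s. apply continuity_pt_filterlim. intros e He.
    assert (L1 : u (a s - e) < s) by (rewrite <- (Ha s) at 2; apply Hi; lra).
    assert (L2 : s < u (a s + e)) by (rewrite <- (Ha s) at 1; apply Hi; lra).
    exists (Rmin (s - u (a s - e)) (u (a s + e) - s)). split; [apply Rmin_case; lra|].
    intros t [_ Ht]. simpl in *. unfold R_dist in *.
    assert (M1 := Rmin_l (s - u (a s - e)) (u (a s + e) - s)).
    assert (M2 := Rmin_r (s - u (a s - e)) (u (a s + e) - s)).
    apply Rabs_def2 in Ht.
    assert (a s - e < a t) by (apply Hlt; rewrite Ha; lra).
    assert (a t < a s + e) by (apply Hlt; rewrite Ha; lra).
    apply Rabs_def1; lra.
Qed.

(** [u] is the lift of a circle map of degree one, so the image of a period is a period. *)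
Lemma rint_comp_lift (f u u' : R -> R) :
  (forall s, continuous f s) -> (forall s, f (s + 2 * PI) = f s) ->
  (forall z, is_derive u z (u' z)) -> (forall z, continuous u' z) ->
  (forall z, u (z + 2 * PI) = u z + 2 * PI) ->
  RInt (fun z => f (u z) * u' z) 0 (2 * PI) = RInt f 0 (2 * PI).
Proof.
  intros Hf Hp Hu Hc Hs. rewrite rint_comp by auto.
  replace (u (2 * PI)) with (u 0 + 2 * PI) by (rewrite <- Hs; f_equal; ring).
  now apply rint_period.
Qed.

Lemma ct_eta (r t : R) : 0 <= r < 1 -> continuous (eta r) t.
Proof.
  intros Hr; unfold eta; unfold Rdiv. apply ct_mult; [ctn|]. apply ct_inv; [apply ct_pden|].
  apply Rgt_not_eq, pden_pos, Hr.
Qed.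

Lemma pden_periodic (r t : R) : pden r (t - 2 * PI) = pden r t.
Proof.
  unfold pden. rewrite <- (cos_period (t - 2 * PI) 1).
  replace (t - 2 * PI + 2 * INR 1 * PI) with t by (simpl; ring). reflexivity.
Qed.

Lemma cpois_periodic (r t : R) : cpois r (t - 2 * PI) = cpois r t.
Proof.
  unfold cpois. rewrite pden_periodic, <- (sin_period (t - 2 * PI) 1).
  replace (t - 2 * PI + 2 * INR 1 * PI) with t by (simpl; ring). reflexivity.
Qed.

Lemma eta_periodic (r t : R) : eta r (t - 2 * PI) = eta r t.
Proof. unfold eta. now rewrite pden_periodic. Qed.

(** Cauchy-Schwarz, obtained from the variance of $|f|$ about its mean [m / T], gives $m^2 \le T\int
    f^2 \le TMm$. *)
Lemma rint_abs_le_sqr (f : R -> R) (M T : R) : 0 < T -> 0 <= M ->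
  (forall x, continuous f x) ->
  RInt (fun s => f s ^ 2) 0 T <= M * RInt (fun s => Rabs (f s)) 0 T ->
  RInt (fun s => Rabs (f s)) 0 T <= M * T.
Proof.
  intros HT HM Hf H.
  set (m := RInt (fun s => Rabs (f s)) 0 T) in *.
  assert (P : 0 <= RInt (fun s => f s ^ 2 - (2 * (m / T)) * Rabs (f s) + (m / T) ^ 2) 0 T).
  { apply RInt_ge_0; [lra|apply rint_ex; ctn|]. intros x _.
    replace (f x ^ 2) with (Rabs (f x) ^ 2) by apply pow2_abs.
    replace (Rabs (f x) ^ 2 - 2 * (m / T) * Rabs (f x) + (m / T) ^ 2) with ((Rabs (f x) - m / T) ^ 2) by ring.
    apply pow2_ge_0. }
  rewrite rint_plus, rint_minus, rint_scal, rint_const in P by ctn. fold m in P.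
  replace (RInt (fun s => f s ^ 2) 0 T - 2 * (m / T) * m + (T - 0) * (m / T) ^ 2)
    with (RInt (fun s => f s ^ 2) 0 T - m * m / T) in P by (field; lra).
  assert (m * m / T <= M * m) by lra.
  assert (m * m <= M * m * T).
  { apply Rmult_le_reg_r with (/ T); [now apply Rinv_0_lt_compat|].
    replace (M * m * T * / T) with (M * m) by (field; lra). exact H0. }
  assert (0 <= m).
  { apply RInt_ge_0; [lra|apply rint_ex; ctn|]. intros; apply Rabs_pos. }
  destruct (Req_dec m 0) as [->|]; nra.
Qed.

(** * Strong monotonicity of the conjugate operator in the inverse *)

Section Monotonicity.

Variables (a b : R -> R).
Hypothesis (ct_a : forall s, continuous a s) (ct_b : forall s, continuous b s).
Hypothesis (a_mono : forall s t, s <= t -> a s <= a t) (b_mono : forall s t, s <= t -> b s <= b t).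
Hypothesis (a_shift : forall s, a (s + 2 * PI) = a s + 2 * PI).
Hypothesis (b_shift : forall s, b (s + 2 * PI) = b s + 2 * PI).
Hypothesis (mean_zero : RInt (fun s => a s - b s) 0 (2 * PI) = 0).

Let d (s : R) : R := a s - b s.

(** Increments over part of a period stay in [[0, 2 PI]], the range in which
    [cpois_strongly_decreasing] holds. *)
Let lift_range (f : R -> R) s t : (forall s t, s <= t -> f s <= f t) -> (forall s, f (s + 2 * PI) = f s + 2 * PI) ->
  0 <= t <= s -> s <= 2 * PI -> 0 <= f s - f t <= 2 * PI.
Proof.
  intros Hm Hs Ht Hs2. assert (M1 := Hm t s ltac:(lra)). assert (M2 := Hm s (t + 2 * PI) ltac:(lra)).
  rewrite Hs in M2. lra.
Qed.

(** The kernel is odd and [eta] even, so both sides are symmetric in [(s, t)] and the case [t <= s]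
    suffices. *)
Let pointwise r s t : 0 < r < 1 -> 0 <= s <= 2 * PI -> 0 <= t <= 2 * PI ->
  (cpois r (a s - a t) - cpois r (b s - b t)) * (d s - d t) <=
  38 * (eta r (a s - a t) + eta r (b s - b t)) - (d s - d t) ^ 2 / 2.
Proof.
  intros Hr.
  assert (K : forall s t, 0 <= s <= 2 * PI -> 0 <= t <= 2 * PI -> t <= s ->
    (cpois r (a s - a t) - cpois r (b s - b t)) * (d s - d t) <=
    38 * (eta r (a s - a t) + eta r (b s - b t)) - (d s - d t) ^ 2 / 2).
  { clear s t. intros s t Hs Ht Hts.
    assert (A := lift_range a s t a_mono a_shift ltac:(lra) ltac:(lra)).
    assert (A' := lift_range b s t b_mono b_shift ltac:(lra) ltac:(lra)).
    unfold d. set (al := a s - a t) in *. set (be := b s - b t) in *.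
    replace (a s - b s - (a t - b t)) with (al - be) by (unfold al, be; ring).
    destruct (Rle_dec al be) as [H|H].
    - assert (P := cpois_strongly_decreasing r al be Hr ltac:(lra) ltac:(lra)). nra.
    - assert (P := cpois_strongly_decreasing r be al Hr ltac:(lra) ltac:(lra)). nra. }
  intros Hs Ht. destruct (Rle_dec t s) as [H|H]; [now apply K|].
  assert (P := K t s Ht Hs ltac:(lra)).
  replace (a s - a t) with (- (a t - a s)) by ring.
  replace (b s - b t) with (- (b t - b s)) by ring.
  rewrite !cpois_odd, !eta_even.
  replace (d s - d t) with (- (d t - d s)) by ring. nra.
Qed.

Let ct_d s : continuous d s.
Proof. unfold d; ctn. Qed.

(* The pairing with [d] is symmetrized in [(s, t)], so that the pointwise bound
   applies; as [d] has mean zero, the double integral of [(d s - d t)^2] is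
   [4 PI] times the integral of [d^2]. *)
Lemma conjugate_monotone (r : R) : 0 < r < 1 ->
  2 * PI * RInt (fun s => d s ^ 2) 0 (2 * PI) <=
  - (2 * RInt (fun s => RInt (fun t => cpois r (a s - a t)) 0 (2 * PI) * d s - RInt (fun t => cpois r (b s - b t)) 0 (2 * PI) * d s) 0 (2 * PI))
  + 38 * (RInt (fun s => RInt (fun t => eta r (a s - a t)) 0 (2 * PI)) 0 (2 * PI)
        + RInt (fun s => RInt (fun t => eta r (b s - b t)) 0 (2 * PI)) 0 (2 * PI)).
Proof.
  intros Hr. assert (Hr' : 0 <= r < 1) by lra. assert (H2 := two_pi_pos).
  assert (Hc := fun t => ct_cpois r t Hr'). assert (He := fun t => ct_eta r t Hr').
  set (Fd := fun p : R * R => (cpois r (a (fst p) - a (snd p)) - cpois r (b (fst p) - b (snd p))) * d (fst p)).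
  assert (CFd : forall p, continuous Fd p) by (intros p; unfold Fd; ctn).
  assert (E1 : RInt (fun s => RInt (fun t => cpois r (a s - a t)) 0 (2 * PI) * d s - RInt (fun t => cpois r (b s - b t)) 0 (2 * PI) * d s) 0 (2 * PI)
    = RInt (fun s => RInt (fun t => Fd (s, t)) 0 (2 * PI)) 0 (2 * PI)).
  { apply rint_ext; intros s. unfold Fd; simpl. symmetry.
    rewrite (rint_ext _ (fun t => d s * cpois r (a s - a t) - d s * cpois r (b s - b t))) by (intros; ring).
    rewrite rint_minus, !rint_scal by ctn. ring. }
  assert (E2 : RInt (fun s => RInt (fun t => Fd (s, t)) 0 (2 * PI)) 0 (2 * PI) =
     RInt (fun s => RInt (fun t => (cpois r (b s - b t) - cpois r (a s - a t)) * d t) 0 (2 * PI)) 0 (2 * PI)).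
  { rewrite rint_fubini by (try lra; exact CFd).
    apply rint_ext; intros s. apply rint_ext; intros t. unfold Fd; simpl.
    replace (a t - a s) with (- (a s - a t)) by ring. replace (b t - b s) with (- (b s - b t)) by ring.
    rewrite !cpois_odd. ring. }
  set (Gd := fun p : R * R => 38 * (eta r (a (fst p) - a (snd p)) + eta r (b (fst p) - b (snd p))) - (d (fst p) - d (snd p)) ^ 2 / 2).
  assert (CGd : forall p, continuous Gd p) by (intros p; unfold Gd, Rdiv; ctn).
  set (Sd := fun p : R * R => (cpois r (a (fst p) - a (snd p)) - cpois r (b (fst p) - b (snd p))) * (d (fst p) - d (snd p))).
  assert (CSd : forall p, continuous Sd p) by (intros p; unfold Sd; ctn).
  assert (E3 : 2 * RInt (fun s => RInt (fun t => Fd (s, t)) 0 (2 * PI)) 0 (2 * PI) = RInt (fun s => RInt (fun t => Sd (s, t)) 0 (2 * PI)) 0 (2 * PI)).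
  { replace (2 * RInt (fun s => RInt (fun t => Fd (s, t)) 0 (2 * PI)) 0 (2 * PI)) with
     (RInt (fun s => RInt (fun t => Fd (s, t)) 0 (2 * PI)) 0 (2 * PI) +
      RInt (fun s => RInt (fun t => (cpois r (b s - b t) - cpois r (a s - a t)) * d t) 0 (2 * PI)) 0 (2 * PI)) by (rewrite <- E2; ring).
    rewrite <- rint_plus.
    - apply rint_ext; intros s. rewrite <- rint_plus by (unfold Fd; simpl; ctn).
      apply rint_ext; intros t. unfold Fd, Sd; simpl. ring.
    - intros s. apply ct_rint_param; [lra|exact CFd].
    - intros s. apply (ct_rint_param (fun p => (cpois r (b (fst p) - b (snd p)) - cpois r (a (fst p) - a (snd p))) * d (snd p))); [lra|ctn]. }
  assert (L : RInt (fun s => RInt (fun t => Sd (s, t)) 0 (2 * PI)) 0 (2 * PI) <= RInt (fun s => RInt (fun t => Gd (s, t)) 0 (2 * PI)) 0 (2 * PI)).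
  { apply rint_le; [lra| | |].
    - intros s. now apply ct_rint_param; [lra|].
    - intros s. now apply ct_rint_param; [lra|].
    - intros s Hs. apply rint_le; [lra|unfold Sd; simpl; ctn|unfold Gd, Rdiv; simpl; ctn|].
      intros t Ht. now apply pointwise. }
  assert (E4 : RInt (fun s => RInt (fun t => Gd (s, t)) 0 (2 * PI)) 0 (2 * PI) =
    38 * (RInt (fun s => RInt (fun t => eta r (a s - a t)) 0 (2 * PI)) 0 (2 * PI)
        + RInt (fun s => RInt (fun t => eta r (b s - b t)) 0 (2 * PI)) 0 (2 * PI))
    - 2 * PI * RInt (fun s => d s ^ 2) 0 (2 * PI)).
  { assert (Ca : forall s, continuous (fun s => RInt (fun t => eta r (a s - a t)) 0 (2 * PI)) s).
    { intros s. apply (ct_rint_param (fun p => eta r (a (fst p) - a (snd p)))); [lra|ctn]. }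
    assert (Cb : forall s, continuous (fun s => RInt (fun t => eta r (b s - b t)) 0 (2 * PI)) s).
    { intros s. apply (ct_rint_param (fun p => eta r (b (fst p) - b (snd p)))); [lra|ctn]. }
    rewrite (rint_ext _ (fun s => 38 * RInt (fun t => eta r (a s - a t)) 0 (2 * PI) + 38 * RInt (fun t => eta r (b s - b t)) 0 (2 * PI)
      - (PI * d s ^ 2 + / 2 * RInt (fun t => d t ^ 2) 0 (2 * PI)))).
    - set (D2 := RInt (fun t => d t ^ 2) 0 (2 * PI)).
      rewrite rint_minus, !rint_plus, !rint_scal, rint_const by ctn. fold D2. toR. field.
    - intros s. unfold Gd; simpl fst; simpl snd.
      rewrite (rint_ext _ (fun t => 38 * eta r (a s - a t) + 38 * eta r (b s - b t) - (/ 2 * d s ^ 2 - d s * d t + / 2 * d t ^ 2))) by (intros; toR; field).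
      rewrite rint_minus, !rint_plus, rint_minus, !rint_scal, rint_const by ctn.
      rewrite (mean_zero : RInt d 0 (2 * PI) = 0). toR. field. }
  rewrite E1. lra.
Qed.

End Monotonicity.

(** After the substitution [t = u z] the weight [u'] is at most [U], and [eta] is
    [(1 - r) / (1 + r)] times the Poisson kernel, of integral [2 PI]. With [1 - r = e^2] that factor
    is at most [e]. *)
Lemma rint_eta_bound (u u' a : R -> R) (U e s : R) : 0 < e < 1 ->
  (forall z, is_derive u z (u' z)) -> (forall z, continuous u' z) ->
  (forall z, 0 <= u' z) -> (forall z, Rabs (u' z) <= U) ->
  (forall z, u (z + 2 * PI) = u z + 2 * PI) ->
  (forall s, continuous a s) -> (forall z, a (u z) = z) -> (forall s, a (s + 2 * PI) = a s + 2 * PI) ->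
  RInt (fun t => eta (1 - e ^ 2) (a s - a t)) 0 (2 * PI) <= 2 * PI * U * e.
Proof.
  intros He Hu Hc H0 HU Hs Ca Hau Has. set (r := 1 - e ^ 2). assert (H2 := two_pi_pos).
  assert (Hr : 0 <= r < 1) by (unfold r; nra).
  assert (Ce := fun t => ct_eta r t Hr). assert (Cp := fun t => ct_pois r t Hr).
  rewrite <- (rint_comp_lift (fun t => eta r (a s - a t)) u u'); auto.
  - assert (Cu : forall z, continuous u z) by (intros; eapply ct_derive, Hu).
    apply Rle_trans with (RInt (fun z => U * ((1 - r) / (1 + r)) * pois r (a s - z)) 0 (2 * PI)).
    + apply rint_le; [lra|ctn|ctn|]. intros z _. rewrite Hau.
      assert (E : eta r (a s - z) = (1 - r) / (1 + r) * pois r (a s - z)).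
      { unfold eta, pois. assert (P := pden_pos r (a s - z) Hr). field. lra. }
      rewrite E. assert (P := pois_pos r (a s - z) Hr).
      assert (0 <= (1 - r) / (1 + r)) by (apply Rdiv_le_0_compat; lra).
      specialize (HU z). rewrite Rabs_pos_eq in HU by apply H0.
      replace (U * ((1 - r) / (1 + r)) * pois r (a s - z)) with ((1 - r) / (1 + r) * pois r (a s - z) * U) by ring.
      apply Rmult_le_compat_l; [apply Rmult_le_pos; assumption|exact HU].
    + rewrite rint_scal, rint_pois by first [exact Hr|ctn].
      assert (0 <= U) by (eapply Rle_trans; [apply Rabs_pos|apply (HU 0)]).
      assert ((1 - r) / (1 + r) <= e).
      { apply Rmult_le_reg_r with (1 + r); [lra|]. unfold Rdiv. rewrite Rmult_assoc, Rinv_l by lra. unfold r in *. nra. }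
      replace (2 * PI * U * e) with (U * e * (2 * PI)) by ring.
      apply Rmult_le_compat_r; [lra|]. apply Rmult_le_compat_l; lra.
  - ctn.
  - intros t. rewrite Has. replace (a s - (a t + 2 * PI)) with (a s - a t - 2 * PI) by ring. apply eta_periodic.
Qed.

Lemma shift_inverse (u a : R -> R) :
  (forall s, u (a s) = s) -> (forall z, a (u z) = z) ->
  (forall z, u (z + 2 * PI) = u z + 2 * PI) -> forall s, a (s + 2 * PI) = a s + 2 * PI.
Proof. intros H1 H2 H s. rewrite <- (H1 s) at 1. now rewrite <- H, H2. Qed.

(** * Distance between the inverses of two traces *)

Section Stability.

Variables (g : R -> R) (ky c k c0 k0 : R) (u u' v v' a b : R -> R) (M : R).
Hypothesis (ct_g : forall s, continuous g s).
Hypothesis (ky_pos : 0 < ky).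
Hypothesis (Tu : boundary_trace g ky c k u u').
Hypothesis (Tv : boundary_trace g ky c0 k0 v v').
Hypothesis (ua : forall s, u (a s) = s) (au : forall z, a (u z) = z).
Hypothesis (vb : forall s, v (b s) = s) (bv : forall z, b (v z) = z).
Hypothesis (a_mono : forall s t, s <= t -> a s <= a t) (ct_a : forall s, continuous a s).
Hypothesis (b_mono : forall s t, s <= t -> b s <= b t) (ct_b : forall s, continuous b s).
Hypothesis (M_ge : 0 <= M).
Hypothesis (conj_u : exists K, 0 <= K /\ forall e z, 0 < e < 1 ->
   Rabs (2 * PI * (g (u z) - k) - ky * RInt (fun y => cpois (1 - e ^ 2) (z - y) * u' y) 0 (2 * PI)) <= M + K * e).
Hypothesis (conj_v : exists K, 0 <= K /\ forall e z, 0 < e < 1 ->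
   Rabs (2 * PI * (g (v z) - k0) - ky * RInt (fun y => cpois (1 - e ^ 2) (z - y) * v' y) 0 (2 * PI)) <= K * e).

Let a_shift : forall s, a (s + 2 * PI) = a s + 2 * PI.
Proof. exact (shift_inverse u a ua au (trace_shift _ _ _ _ _ _ Tu)). Qed.

Let b_shift : forall s, b (s + 2 * PI) = b s + 2 * PI.
Proof. exact (shift_inverse v b vb bv (trace_shift _ _ _ _ _ _ Tv)). Qed.

(** Pulled back along [f], the integrand is [(f - id) f' = (f - id)(f' - 1) + (f - id)]: an exact
    derivative of a periodic function plus a function of mean zero. *)
Lemma inverse_mean (g1 : R -> R) (ky1 c1 k1 : R) (f f' h : R -> R) :
  boundary_trace g1 ky1 c1 k1 f f' -> (forall z, h (f z) = z) ->
  (forall s, continuous h s) -> (forall s, h (s + 2 * PI) = h s + 2 * PI) ->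
  RInt (fun s => s - h s) 0 (2 * PI) = 0.
Proof.
  intros T Hh Ch Hs.
  assert (df := trace_derive _ _ _ _ _ _ T). assert (cf := trace_ct _ _ _ _ _ _ T).
  assert (cf0 : forall z, continuous f z) by (intros; eapply ct_derive, df).
  rewrite <- (rint_comp_lift (fun s => s - h s) f f'); auto.
  - rewrite (rint_ext _ (fun z => (f z - z) * (f' z - 1) + (f z - z))) by (intros; rewrite Hh; ring).
    rewrite rint_plus, (trace_mean _ _ _ _ _ _ T) by ctn.
    rewrite (rint_derive (fun z => (f z - z) ^ 2 / 2) (fun z => (f z - z) * (f' z - 1))).
    + assert (E := trace_shift _ _ _ _ _ _ T 0). rewrite Rplus_0_l in E. rewrite E. toR; field.
    + intros z. specialize (df z). assert (E := is_derive_unique _ _ _ df).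
      auto_derive; [repeat split; eexists; eassumption|].
      change (Derive (fun x => f x) z) with (Derive f z). rewrite E. field.
    + ctn.
  - ctn.
  - intros s. rewrite Hs. ring.
  - apply (trace_shift _ _ _ _ _ _ T).
Qed.

Let conj_inverse (f f' h : R -> R) (r s : R) : 0 <= r < 1 ->
  (forall z, is_derive f z (f' z)) -> (forall z, continuous f' z) ->
  (forall z, f (z + 2 * PI) = f z + 2 * PI) ->
  (forall z, h (f z) = z) -> (forall s, continuous h s) -> (forall s, h (s + 2 * PI) = h s + 2 * PI) ->
  RInt (fun y => cpois r (h s - y) * f' y) 0 (2 * PI) = RInt (fun t => cpois r (h s - h t)) 0 (2 * PI).
Proof.
  intros Hr Hd Hc Hs Hh Ch Hhs. assert (Cc := fun t => ct_cpois r t Hr).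
  rewrite <- (rint_comp_lift (fun t => cpois r (h s - h t)) f f'); auto.
  - apply rint_ext; intros y. now rewrite Hh.
  - ctn.
  - intros t. rewrite Hhs. replace (h s - (h t + 2 * PI)) with (h s - h t - 2 * PI) by ring. apply cpois_periodic.
Qed.

(** Strong monotonicity turns the defect [M] of the boundary condition into $k_y\pi\int d^2 \le
    M\int|d|$ for the difference [d] of the inverses; [rint_abs_le_sqr] then bounds the $L^1$
    norm. *)
Lemma inverse_distance : ky * RInt (fun s => Rabs (a s - b s)) 0 (2 * PI) <= 2 * M.
Proof.
  destruct conj_u as [K1 [K1p H1]]. destruct conj_v as [K2 [K2p H2]]. assert (P2 := two_pi_pos).
  assert (du := trace_derive _ _ _ _ _ _ Tu). assert (cu' := trace_ct _ _ _ _ _ _ Tu).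
  assert (su := trace_shift _ _ _ _ _ _ Tu). assert (pu := trace_nonneg _ _ _ _ _ _ Tu).
  assert (dv := trace_derive _ _ _ _ _ _ Tv). assert (cv' := trace_ct _ _ _ _ _ _ Tv).
  assert (sv := trace_shift _ _ _ _ _ _ Tv). assert (pv := trace_nonneg _ _ _ _ _ _ Tv).
  assert (cu : forall z, continuous u z) by (intros; eapply ct_derive, du).
  assert (cv : forall z, continuous v z) by (intros; eapply ct_derive, dv).
  assert (bdd : forall f f' : R -> R, (forall z, is_derive f z (f' z)) -> (forall z, continuous f' z) ->
     (forall z, f (z + 2 * PI) = f z + 2 * PI) -> exists U, 0 <= U /\ forall z, Rabs (f' z) <= U).
  { intros f f' Hd Hc Hs. apply (periodic_bounded f' (2 * PI) P2 Hc). intros z.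
    assert (H := periodic_derive (fun z => f z - z) (fun z => f' z - 1) (2 * PI)).
    cut (f' (z + 2 * PI) - 1 = f' z - 1); [lra|]. apply H.
    - intros y. apply (is_derive_minus (K := R_AbsRing) (V := R_NormedModule) f (fun z => z) y _ 1 (Hd y)).
      apply (is_derive_id (K := R_AbsRing)).
    - intros y. rewrite Hs. ring. }
  destruct (bdd u u' du cu' su) as [U1 [U1p HU1]]. destruct (bdd v v' dv cv' sv) as [U2 [U2p HU2]].
  set (d := fun s => a s - b s).
  assert (cd : forall s, continuous d s) by (intros; unfold d; ctn).
  assert (mz : RInt d 0 (2 * PI) = 0).
  { assert (Z1 := inverse_mean _ _ _ _ u u' a Tu au ct_a a_shift).
    assert (Z2 := inverse_mean _ _ _ _ v v' b Tv bv ct_b b_shift).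
    rewrite (rint_ext d (fun s => (s - b s) - (s - a s))) by (intros; unfold d; ring).
    rewrite rint_minus, Z1, Z2 by ctn. toR; ring. }
  set (D1 := RInt (fun s => Rabs (d s)) 0 (2 * PI)). set (D2 := RInt (fun s => d s ^ 2) 0 (2 * PI)).
  assert (D1p : 0 <= D1) by (apply RInt_ge_0; [lra|apply rint_ex; ctn|intros; apply Rabs_pos]).
  (* The trace-dependent constants [K1], [K2], [U1] and [U2] all come with a factor [e] and
     disappear here. *)
  assert (Key : ky * PI * D2 - M * D1 <= 0).
  { apply le_0_of_small with ((K1 + K2) * D1 + ky * 19 * (2 * PI * (2 * PI * U1) + 2 * PI * (2 * PI * U2))).
    intros e He. set (r := 1 - e ^ 2). assert (Hr : 0 < r < 1) by (unfold r; nra). assert (Hr' : 0 <= r < 1) by lra.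
    assert (Cc := fun t => ct_cpois r t Hr'). assert (Ce := fun t => ct_eta r t Hr').
    set (Ka := fun s => RInt (fun t => cpois r (a s - a t)) 0 (2 * PI)).
    set (Kb := fun s => RInt (fun t => cpois r (b s - b t)) 0 (2 * PI)).
    assert (Mono : 2 * PI * D2 <= - (2 * RInt (fun s => Ka s * d s - Kb s * d s) 0 (2 * PI))
      + 38 * (RInt (fun s => RInt (fun t => eta r (a s - a t)) 0 (2 * PI)) 0 (2 * PI)
            + RInt (fun s => RInt (fun t => eta r (b s - b t)) 0 (2 * PI)) 0 (2 * PI)))
      by exact (conjugate_monotone a b ct_a ct_b a_mono b_mono a_shift b_shift mz r Hr).
    assert (CKa : forall s, continuous Ka s).
    { intros s. apply (ct_rint_param (fun p => cpois r (a (fst p) - a (snd p)))); [lra|ctn]. }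
    assert (CKb : forall s, continuous Kb s).
    { intros s. apply (ct_rint_param (fun p => cpois r (b (fst p) - b (snd p)))); [lra|ctn]. }
    assert (Ba : forall s, Rabs (2 * PI * (g s - k) - ky * Ka s) <= M + K1 * e).
    { intros s. specialize (H1 e (a s) He). fold r in H1.
      rewrite (conj_inverse u u' a r s Hr' du cu' su au ct_a a_shift), ua in H1. exact H1. }
    assert (Bb : forall s, Rabs (2 * PI * (g s - k0) - ky * Kb s) <= K2 * e).
    { intros s. specialize (H2 e (b s) He). fold r in H2.
      rewrite (conj_inverse v v' b r s Hr' dv cv' sv bv ct_b b_shift), vb in H2. exact H2. }
    assert (Ea : RInt (fun s => RInt (fun t => eta r (a s - a t)) 0 (2 * PI)) 0 (2 * PI) <= 2 * PI * (2 * PI * U1 * e)).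
    { apply Rle_trans with (RInt (fun _ => 2 * PI * U1 * e) 0 (2 * PI)).
      - apply rint_le; [lra| |ctn|].
        + intros s. apply (ct_rint_param (fun p => eta r (a (fst p) - a (snd p)))); [lra|ctn].
        + intros s _. now apply (rint_eta_bound u u' a).
      - rewrite rint_const. lra. }
    assert (Eb : RInt (fun s => RInt (fun t => eta r (b s - b t)) 0 (2 * PI)) 0 (2 * PI) <= 2 * PI * (2 * PI * U2 * e)).
    { apply Rle_trans with (RInt (fun _ => 2 * PI * U2 * e) 0 (2 * PI)).
      - apply rint_le; [lra| |ctn|].
        + intros s. apply (ct_rint_param (fun p => eta r (b (fst p) - b (snd p)))); [lra|ctn].
        + intros s _. now apply (rint_eta_bound v v' b).
      - rewrite rint_const. lra. }
    assert (J : Rabs (ky * RInt (fun s => Ka s * d s - Kb s * d s) 0 (2 * PI)) <= (M + (K1 + K2) * e) * D1).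
    (* The added multiple of [d] has integral zero. It makes the integrand the difference of the two
       boundary conditions times [d], in which [g s] cancels. *)
    { replace (ky * RInt (fun s => Ka s * d s - Kb s * d s) 0 (2 * PI)) with
       (RInt (fun s => (ky * (Ka s * d s - Kb s * d s)) + 2 * PI * (k - k0) * d s) 0 (2 * PI)).
      2: { rewrite rint_plus, !rint_scal, mz by ctn. toR; ring. }
      unfold D1. rewrite <- rint_scal by ctn.
      apply rint_abs_le; [lra|ctn|ctn|]. intros s _.
      replace (ky * (Ka s * d s - Kb s * d s) + 2 * PI * (k - k0) * d s) with
       ((2 * PI * (g s - k0) - ky * Kb s - (2 * PI * (g s - k) - ky * Ka s)) * d s) by ring.
      rewrite Rabs_mult. apply Rmult_le_compat_r; [apply Rabs_pos|].
      eapply Rle_trans; [apply Rabs_triang|]. rewrite Rabs_Ropp. specialize (Ba s). specialize (Bb s). lra. }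
    apply Rabs_le_between in J. set (JJ := RInt (fun s => Ka s * d s - Kb s * d s) 0 (2 * PI)) in *.
    assert (Mono' : 2 * PI * D2 <= - (2 * JJ) + 38 * (2 * PI * (2 * PI * U1 * e) + 2 * PI * (2 * PI * U2 * e))) by lra.
    apply (Rmult_le_compat_l ky) in Mono'; [|lra]. nra. }
  assert (Fin := rint_abs_le_sqr d (M / (ky * PI)) (2 * PI) P2).
  fold D1 D2 in Fin.
  assert (Pp := PI_RGT_0).
  assert (D1 <= M / (ky * PI) * (2 * PI)).
  { apply Fin; auto.
    - apply Rdiv_le_0_compat; [exact M_ge|nra].
    - apply Rmult_le_reg_l with (ky * PI); [nra|].
      replace (ky * PI * (M / (ky * PI) * D1)) with (M * D1) by (field; lra). lra. }
  change (ky * D1 <= 2 * M).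
  replace (2 * M) with (ky * (M / (ky * PI) * (2 * PI))) by (field; lra).
  apply Rmult_le_compat_l; lra.
Qed.

End Stability.

(* Change of variables [s = u z] after integrating the exact derivative of
   [(u - id)^2 g(u) / 2]. *)
Lemma energy_inverse (g g' u u' a : R -> R) :
  (forall s, is_derive g s (g' s)) -> (forall s, continuous g' s) ->
  (forall s, g (s + 2 * PI) = g s) ->
  (forall z, is_derive u z (u' z)) -> (forall z, continuous u' z) ->
  (forall z, u (z + 2 * PI) = u z + 2 * PI) ->
  (forall s, continuous a s) -> (forall z, a (u z) = z) -> (forall s, a (s + 2 * PI) = a s + 2 * PI) ->
  RInt (fun z => (u z - z) * g (u z)) 0 (2 * PI) =
  RInt (fun s => (s - a s) * g s + (s - a s) ^ 2 / 2 * g' s) 0 (2 * PI).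
Proof.
  intros Hg Cg' Hp Hu Cu' Hs Ca Hau Has.
  assert (Cg : forall s, continuous g s) by (intros; eapply ct_derive, Hg).
  assert (Cu : forall s, continuous u s) by (intros; eapply ct_derive, Hu).
  assert (Hp' := periodic_derive g g' (2 * PI) Hg Hp).
  rewrite <- (rint_comp_lift (fun s => (s - a s) * g s + (s - a s) ^ 2 / 2 * g' s) u u'); auto.
  - assert (Z : RInt (fun z => ((u z - z) * g (u z) + (u z - z) ^ 2 / 2 * g' (u z)) * u' z - (u z - z) * g (u z)) 0 (2 * PI) = 0).
    { rewrite (rint_derive (fun z => (u z - z) ^ 2 / 2 * g (u z))).
      - assert (E := Hs 0). rewrite Rplus_0_l in E. rewrite E, Hp. toR. field.
      - intros z. specialize (Hu z). specialize (Hg (u z)).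
        assert (E1 := is_derive_unique _ _ _ Hu). assert (E2 := is_derive_unique _ _ _ Hg).
        auto_derive; [repeat split; eexists; eassumption|].
        change (Derive (fun x => u x) z) with (Derive u z). change (Derive (fun x => g x) (u z)) with (Derive g (u z)).
        rewrite E1, E2. field.
      - unfold Rdiv; ctn. }
    rewrite rint_minus in Z by (unfold Rdiv; ctn).
    rewrite (rint_ext (fun z => ((u z - a (u z)) * g (u z) + (u z - a (u z)) ^ 2 / 2 * g' (u z)) * u' z)
      (fun z => ((u z - z) * g (u z) + (u z - z) ^ 2 / 2 * g' (u z)) * u' z)) by (intros; now rewrite Hau).
    lra.
  - unfold Rdiv; ctn.
  - intros s. rewrite Has, Hp, Hp'. replace (s + 2 * PI - (a s + 2 * PI)) with (s - a s) by ring. reflexivity.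
Qed.

(** * Expansion of the wavenumber *)


Lemma Cmod_sqr (z : C) : Cmod z ^ 2 = fst z ^ 2 + snd z ^ 2.
Proof. unfold Cmod. apply pow2_sqrt. assert (H1 := pow2_ge_0 (fst z)). assert (H2 := pow2_ge_0 (snd z)). lra. Qed.

Lemma fourier_coef_sq (f : R -> R) (l : Z) : (forall z, continuous f z) ->
  Cmod (fourier_coef f l) ^ 2 =
  (RInt (fun z => f z * cos (IZR l * z)) 0 (2 * PI) ^ 2 +
   RInt (fun z => f z * sin (IZR l * z)) 0 (2 * PI) ^ 2) / (4 * PI ^ 2).
Proof.
  intros Hf. assert (H0 := PI_RGT_0). unfold fourier_coef.
  rewrite (is_RInt_unique (V := C_R_CompleteNormedModule) _ _ _
    (RInt (fun z => f z * cos (IZR l * z)) 0 (2 * PI), - RInt (fun z => f z * sin (IZR l * z)) 0 (2 * PI))).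
  - rewrite Cmod_sqr. unfold scal; simpl; unfold prod_scal, scal; simpl; unfold mult; simpl. field. lra.
  - apply (is_RInt_fct_extend_pair (U := R_NormedModule) (V := R_NormedModule)); simpl.
    + apply (RInt_correct (V := R_CompleteNormedModule)), rint_ex. ctn.
    + apply (is_RInt_opp (V := R_NormedModule)), (RInt_correct (V := R_CompleteNormedModule)), rint_ex. ctn.
Qed.

Lemma Hhalf_term_pos (f : R -> R) (n : nat) : (forall z, continuous f z) ->
  Hhalf_term f (Z.of_nat n) = INR n * (fcos f n ^ 2 + fsin f n ^ 2) / (4 * PI ^ 2).
Proof.
  intros Hf. unfold Hhalf_term. rewrite fourier_coef_sq by exact Hf.
  rewrite Z.abs_eq by lia. rewrite <- INR_IZR_INZ. unfold fcos, fsin, Rdiv. ring.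
Qed.

Lemma Hhalf_term_neg (f : R -> R) (n : nat) : (forall z, continuous f z) ->
  Hhalf_term f (- Z.of_nat n) = INR n * (fcos f n ^ 2 + fsin f n ^ 2) / (4 * PI ^ 2).
Proof.
  intros Hf. unfold Hhalf_term. rewrite fourier_coef_sq by exact Hf.
  rewrite Z.abs_opp, Z.abs_eq by lia. rewrite opp_IZR, <- INR_IZR_INZ.
  rewrite (rint_ext (fun z => f z * cos (- INR n * z)) (fun z => f z * cos (INR n * z))).
  2: { intros z. rewrite <- cos_neg. f_equal. f_equal. ring. }
  rewrite (rint_ext (fun z => f z * sin (- INR n * z)) (fun z => - 1 * (f z * sin (INR n * z)))).
  2: { intros z. replace (- INR n * z) with (- (INR n * z)) by ring. rewrite sin_neg. ring. }
  rewrite rint_scal by ctn. unfold fcos, fsin, Rdiv. ring.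
Qed.

(** The indices [l] and [- l] contribute equally, which turns the [4 PI^2] of [fourier_coef_sq] into
    [2 PI^2]. *)
Lemma Hhalf_of_modes (f : R -> R) : (forall z, continuous f z) ->
  ex_series (fun n => INR (S n) * (fcos f (S n) ^ 2 + fsin f (S n) ^ 2)) ->
  in_Hhalf f /\
  Hhalf_norm_sq f = Series (fun n => INR (S n) * (fcos f (S n) ^ 2 + fsin f (S n) ^ 2)) / (2 * PI ^ 2).
Proof.
  intros Hf Hs. assert (H0 := PI_RGT_0).
  set (x := fun n => INR n * (fcos f n ^ 2 + fsin f n ^ 2) / (4 * PI ^ 2)).
  assert (E0 : x 0%nat = 0) by (unfold x; simpl; field; lra).
  assert (Es : ex_series (fun n => x (S n))).
  { apply (ex_series_ext (fun n => / (4 * PI ^ 2) * (INR (S n) * (fcos f (S n) ^ 2 + fsin f (S n) ^ 2)))).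
    - intros n; unfold x, Rdiv; toR; ring.
    - now apply ex_series_cmul. }
  assert (Ex : ex_series x) by (now apply (ex_series_incr_1 (K := R_AbsRing) (V := R_NormedModule))).
  assert (Sx : Series (fun n => x (S n)) = Series (fun n => INR (S n) * (fcos f (S n) ^ 2 + fsin f (S n) ^ 2)) / (4 * PI ^ 2)).
  { unfold Rdiv. rewrite <- Series_scal_r. reflexivity. }
  split.
  - split.
    + apply (ex_series_ext x); [|exact Ex]. intros n; symmetry; now apply Hhalf_term_pos.
    + apply (ex_series_ext (fun n => x (S n))); [|exact Es]. intros n; symmetry; now apply Hhalf_term_neg.
  - unfold Hhalf_norm_sq, SeriesZ.
    rewrite (Series_ext _ x) by (intros n; now apply Hhalf_term_pos).
    rewrite (Series_ext (fun n => Hhalf_term f (- Z.of_nat (S n))) (fun n => x (S n))) by (intros n; now apply Hhalf_term_neg).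
    (* The sum over nonnegative indices starts at [l = 0], whose term is zero. *)
    rewrite (Series_incr_1 x Ex), E0, Sx. field. lra.
Qed.

(** * Comparison of the traces for [c] and for 0 *)

Section Expansion.

Variables (g g' : R -> R) (G0 G1 ky : R).
Hypothesis (g_derive : forall s, is_derive g s (g' s)).
Hypothesis (ct_g' : forall s, continuous g' s).
Hypothesis (g_bound : forall s, Rabs (g s) <= G0).
Hypothesis (g'_bound : forall s, Rabs (g' s) <= G1).
Hypothesis (g_periodic : forall s, g (s + 2 * PI) = g s).
Hypothesis (ky_pos : 0 < ky).
Variables (k0 : R) (v v' : R -> R).
Hypothesis (Tv : boundary_trace g ky 0 k0 v v').

Let ct_g s : continuous g s.
Proof. eapply ct_derive, g_derive. Qed.

(** At [c = 0] both the main term and the error of [wavenumber_defect] vanish. *)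
Lemma wavenumber_at_0 : k0 = / (2 * PI) * RInt g 0 (2 * PI).
Proof.
  assert (H0 := PI_RGT_0).
  assert (H := wavenumber_defect g g' G0 G1 ky g_derive ct_g' g_bound g'_bound g_periodic ky_pos 0 k0 v v' ltac:(lra) Tv).
  match type of H with Rabs (_ - ?t * trace_energy v) <= ?r =>
    replace t with 0 in H by (field; lra); replace r with 0 in H by (field; lra) end.
  apply Rabs_le_between in H.
  apply Rmult_eq_reg_l with (2 * PI); [|lra].
  rewrite <- Rmult_assoc, Rinv_r, Rmult_1_l by lra.
  assert (Hm : PI * (RInt g 0 (2 * PI) - 2 * PI * k0) = 0) by lra.
  apply Rmult_integral in Hm as [Hm|Hm]; lra.
Qed.

(** Up to O(c), [ky] times each energy is [PI] times one and the same functional of the inverse,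
    which is Lipschitz for the $L^1$ distance. *)
Lemma energy_lipschitz : exists K, 0 <= K /\ forall c k u u', 0 <= c <= ky ->
  boundary_trace g ky c k u u' -> Rabs (trace_energy u - trace_energy v) <= K * c.
Proof.
  set (Q := G0 / (2 * ky)). set (E := 3 / 4 + Q ^ 2). set (B := 6 * PI * G1 / ky).
  set (C1 := 4 * (E + Q) * B * zeta2).
  assert (H0 := PI_RGT_0).
  assert (G0p : 0 <= G0) by (eapply Rle_trans; [apply Rabs_pos|apply (g_bound 0)]).
  assert (G1p : 0 <= G1) by (eapply Rle_trans; [apply Rabs_pos|apply (g'_bound 0)]).
  assert (Qp : 0 <= Q) by (apply Rdiv_le_0_compat; lra).
  assert (Ep : 0 <= E) by (unfold E; nra).
  assert (Bp : 0 <= B) by (apply Rdiv_le_0_compat; nra).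
  assert (Zp : 0 <= zeta2).
  { rewrite <- (Rmult_1_l zeta2). eapply Rle_trans; [apply Rabs_pos|].
    apply (series_inv_sq_bound (fun _ => 0) 1). intros n. rewrite Rabs_R0.
    rewrite Rmult_1_l. left. apply Rinv_0_lt_compat, pow_lt, lt_0_INR. lia. }
  assert (C1p : 0 <= C1) by (apply Rmult_le_pos; [apply Rmult_le_pos; [lra|exact Bp]|exact Zp]).
  exists ((E * B ^ 2 * zeta2 + PI * ((G0 + 2 * PI * G1) * (2 * C1 / ky))) / ky).
  split.
  { apply Rdiv_le_0_compat; [|exact ky_pos]. apply Rplus_le_le_0_compat.
    - apply Rmult_le_pos; [|exact Zp]. apply Rmult_le_pos; [exact Ep|apply pow2_ge_0].
    - apply Rmult_le_pos; [lra|]. apply Rmult_le_pos; [nra|]. apply Rdiv_le_0_compat; lra. }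
  intros c k u u' Hc Tu.
  assert (du := trace_derive _ _ _ _ _ _ Tu). assert (cu' := trace_ct _ _ _ _ _ _ Tu).
  assert (su := trace_shift _ _ _ _ _ _ Tu).
  assert (dv := trace_derive _ _ _ _ _ _ Tv). assert (cv' := trace_ct _ _ _ _ _ _ Tv).
  assert (sv := trace_shift _ _ _ _ _ _ Tv).
  assert (cu : forall z, continuous u z) by (intros; eapply ct_derive, du).
  assert (cv : forall z, continuous v z) by (intros; eapply ct_derive, dv).
  assert (bu := trace_dev_bound g ky c k u u' Tu). assert (bv0 := trace_dev_bound g ky 0 k0 v v' Tv).
  destruct (increasing_inverse u _ cu (trace_incr _ _ _ _ _ _ Tu) bu) as [a [ua [au [am ca]]]].
  destruct (increasing_inverse v _ cv (trace_incr _ _ _ _ _ _ Tv) bv0) as [b [vb [bv [bm cb]]]].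
  assert (Dist : ky * RInt (fun s => Rabs (a s - b s)) 0 (2 * PI) <= 2 * (C1 * c)).
  { apply (inverse_distance g ky c k 0 k0 u u' v v' a b (C1 * c)); auto.
    - apply Rmult_le_pos; lra.
    - exact (trace_conjugate g g' G0 G1 ky g_derive ct_g' g_bound g'_bound g_periodic ky_pos c k u u' Hc Tu).
    (* For the reference trace the O(c) part of the error is zero, so only [K * e] is left, as the
       hypothesis [conj_v] of [Stability] requires. *)
    - destruct (trace_conjugate g g' G0 G1 ky g_derive ct_g' g_bound g'_bound g_periodic ky_pos 0 k0 v v' ltac:(lra) Tv) as [K [K0 HK]].
      exists K; split; [exact K0|]. intros e z He. specialize (HK e z He). rewrite Rmult_0_r, Rplus_0_l in HK. exact HK. }
  set (D1 := RInt (fun s => Rabs (a s - b s)) 0 (2 * PI)) in *.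
  assert (Pu := energy_pairing g g' G0 G1 ky g_derive ct_g' g_bound g'_bound g_periodic ky_pos c k u u' Hc Tu).
  assert (Pv := energy_pairing g g' G0 G1 ky g_derive ct_g' g_bound g'_bound g_periodic ky_pos 0 k0 v v' ltac:(lra) Tv).
  fold Q E B in Pu, Pv.
  replace (E * 0 * B ^ 2 * zeta2) with 0 in Pv by ring.
  rewrite (energy_inverse g g' u u' a) in Pu by (auto; exact (shift_inverse u a ua au su)).
  rewrite (energy_inverse g g' v v' b) in Pv by (auto; exact (shift_inverse v b vb bv sv)).
  set (Iu := RInt (fun s => (s - a s) * g s + (s - a s) ^ 2 / 2 * g' s) 0 (2 * PI)) in *.
  set (Iv := RInt (fun s => (s - b s) * g s + (s - b s) ^ 2 / 2 * g' s) 0 (2 * PI)) in *.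
  assert (DI : Rabs (Iu - Iv) <= (G0 + 2 * PI * G1) * D1).
  { unfold Iu, Iv, D1. rewrite <- rint_minus, <- rint_scal by (unfold Rdiv; ctn).
    apply rint_abs_le; [lra|unfold Rdiv; ctn|ctn|]. intros s _.
    assert (A1 := bu (a s)). rewrite ua in A1. assert (A2 := bv0 (b s)). rewrite vb in A2.
    (* With $x = s - a$ and $y = s - b$, the difference factors as $(x-y)(g + (x+y)g'/2)$, and
       $|x+y|/2 \le 2\pi$ by [trace_dev_bound]. *)
    replace ((s - a s) * g s + (s - a s) ^ 2 / 2 * g' s - ((s - b s) * g s + (s - b s) ^ 2 / 2 * g' s))
      with (- (g s + ((s - a s) + (s - b s)) / 2 * g' s) * (a s - b s)) by field.
    rewrite Rabs_mult, Rabs_Ropp. apply Rmult_le_compat_r; [apply Rabs_pos|].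
    eapply Rle_trans; [apply Rabs_triang|]. apply Rplus_le_compat; [apply g_bound|].
    rewrite Rabs_mult. apply Rmult_le_compat; try apply Rabs_pos; [|apply g'_bound].
    apply Rabs_le_between in A1. apply Rabs_le_between in A2. apply Rabs_le. lra. }
  assert (D1b : D1 <= 2 * C1 / ky * c).
  { apply Rmult_le_reg_l with ky; [exact ky_pos|]. replace (ky * (2 * C1 / ky * c)) with (2 * (C1 * c)) by (field; lra). exact Dist. }
  assert (DI' : Rabs (Iu - Iv) <= (G0 + 2 * PI * G1) * (2 * C1 / ky) * c).
  { eapply Rle_trans; [exact DI|]. rewrite (Rmult_assoc (G0 + _)). apply Rmult_le_compat_l; [nra|exact D1b]. }
  apply Rmult_le_reg_l with ky; [exact ky_pos|].
  rewrite <- (Rabs_pos_eq ky) at 1 by lra. rewrite <- Rabs_mult.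
  apply Rabs_le_between in Pu. apply Rabs_le_between in Pv. apply Rabs_le_between in DI'.
  match goal with |- _ <= ?r => replace r with (E * c * B ^ 2 * zeta2 + PI * ((G0 + 2 * PI * G1) * (2 * C1 / ky) * c)) by (field; lra) end.
  set (R1 := (G0 + 2 * PI * G1) * (2 * C1 / ky) * c) in *.
  assert (- (PI * R1) <= PI * (Iu - Iv) <= PI * R1) by (split; nra).
  apply Rabs_le. lra.
Qed.

(** [wavenumber_defect] is an expansion with [k] and the energy of [u] on its right-hand side.
    Replacing them by [k0] and the energy of [v] costs O(c) each, and both stand behind a factor
    [c]. *)
Lemma wavenumber_expansion : exists M, forall c k u u', 0 <= c <= ky ->
  boundary_trace g ky c k u u' ->
  Rabs (k - (k0 - k0 / ky * (trace_energy v / (2 * PI ^ 2)) * (c / 2))) <= M * c ^ 2.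
Proof.
  assert (H0 := PI_RGT_0).
  destruct energy_lipschitz as [K [Kp HK]].
  set (Z := (6 * PI * G1 / ky) ^ 2 * zeta2).
  set (A := G0 / (2 * ky) * (1 / 4 + (G0 / (2 * ky)) ^ 2) / ky * Z).
  assert (G0p : 0 <= G0) by (eapply Rle_trans; [apply Rabs_pos|apply (g_bound 0)]).
  assert (HZv : Rabs (trace_energy v) <= Z).
  { exact (proj2 (trace_energy_summable g g' G0 G1 ky g_derive ct_g' g_bound g'_bound g_periodic ky_pos 0 k0 v v' ltac:(lra) Tv)). }
  assert (Zp : 0 <= Z) by (eapply Rle_trans; [apply Rabs_pos|exact HZv]).
  assert (Ap : 0 <= A).
  { unfold A. apply Rmult_le_pos; [|exact Zp]. apply Rdiv_le_0_compat; [|lra].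
    apply Rmult_le_pos; [apply Rdiv_le_0_compat; lra|]. assert (q := pow2_ge_0 (G0 / (2 * ky))). lra. }
  (* The constant in the first-order bound [Dk]; the term [A * ky] comes from $c^2 \le k_y c$. *)
  set (K6 := (G0 / (2 * ky) * Z + A * ky) / (2 * PI ^ 2)).
  assert (Pp : 0 < 2 * PI ^ 2) by (assert (q := pow_lt PI 2 H0); lra).
  assert (K6p : 0 <= K6).
  { unfold K6. apply Rdiv_le_0_compat; [|exact Pp]. apply Rplus_le_le_0_compat; apply Rmult_le_pos; try lra.
    apply Rdiv_le_0_compat; lra. }
  exists ((A + (G0 * K + K6 * Z) / (2 * ky)) / (2 * PI ^ 2)).
  intros c k u u' Hc Tu.
  assert (Hk := trace_wavenumber_bound g g' G0 ky g_derive g_bound c k u u' Tu).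
  assert (HS := HK c k u u' Hc Tu).
  assert (HZu : Rabs (trace_energy u) <= Z).
  { exact (proj2 (trace_energy_summable g g' G0 G1 ky g_derive ct_g' g_bound g'_bound g_periodic ky_pos c k u u' Hc Tu)). }
  assert (W := wavenumber_defect g g' G0 G1 ky g_derive ct_g' g_bound g'_bound g_periodic ky_pos c k u u' Hc Tu).
  replace (RInt g 0 (2 * PI)) with (2 * PI * k0) in W by (rewrite wavenumber_at_0; field; lra).
  match type of W with _ <= ?r => replace r with (A * c ^ 2) in W by (unfold A, Z; ring) end.
  set (Su := trace_energy u) in *. set (Sv := trace_energy v) in *.
  replace (PI * (2 * PI * k0 - 2 * PI * k)) with (2 * PI ^ 2 * (k0 - k)) in W by ring.
  assert (Dk : Rabs (k0 - k) <= K6 * c).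
  { apply Rmult_le_reg_l with (2 * PI ^ 2); [exact Pp|].
    rewrite <- (Rabs_pos_eq (2 * PI ^ 2)) at 1 by lra. rewrite <- Rabs_mult.
    replace (2 * PI ^ 2 * (K6 * c)) with (G0 / (2 * ky) * c * Z + A * ky * c) by (unfold K6; field; lra).
    replace (2 * PI ^ 2 * (k0 - k)) with (k * (c / (2 * ky) * Su) + (2 * PI ^ 2 * (k0 - k) - k * c / (2 * ky) * Su)) by (field; lra).
    eapply Rle_trans; [apply Rabs_triang|]. apply Rplus_le_compat.
    - rewrite !Rabs_mult.
      assert (Hcy : 0 <= c / (2 * ky)) by (apply Rdiv_le_0_compat; lra).
      rewrite (Rabs_pos_eq (c / (2 * ky))) by exact Hcy.
      replace (G0 / (2 * ky) * c * Z) with (G0 * (c / (2 * ky) * Z)) by (field; lra).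
      apply Rmult_le_compat; [apply Rabs_pos|apply Rmult_le_pos; [exact Hcy|apply Rabs_pos]|exact Hk|].
      apply Rmult_le_compat_l; assumption.
    - eapply Rle_trans; [exact W|]. replace (A * c ^ 2) with (A * c * c) by ring.
      replace (A * ky * c) with (A * c * ky) by ring. apply Rmult_le_compat_l; [apply Rmult_le_pos; lra|lra]. }
  assert (Main : Rabs (2 * PI ^ 2 * (k0 - k) - k0 * c / (2 * ky) * Sv) <= (A + (G0 * K + K6 * Z) / (2 * ky)) * c ^ 2).
  { replace (2 * PI ^ 2 * (k0 - k) - k0 * c / (2 * ky) * Sv) with
     ((2 * PI ^ 2 * (k0 - k) - k * c / (2 * ky) * Su) + c / (2 * ky) * (k * (Su - Sv) - (k0 - k) * Sv)) by (field; lra).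
    eapply Rle_trans; [apply Rabs_triang|].
    replace ((A + (G0 * K + K6 * Z) / (2 * ky)) * c ^ 2) with (A * c ^ 2 + c / (2 * ky) * (G0 * (K * c) + K6 * c * Z)) by (field; lra).
    apply Rplus_le_compat; [exact W|].
    assert (Hcy : 0 <= c / (2 * ky)) by (apply Rdiv_le_0_compat; lra).
    rewrite Rabs_mult, (Rabs_pos_eq (c / (2 * ky))) by exact Hcy.
    apply Rmult_le_compat_l; [exact Hcy|].
    eapply Rle_trans; [apply Rabs_triang|]. rewrite Rabs_Ropp, !Rabs_mult.
    apply Rplus_le_compat; apply Rmult_le_compat; try apply Rabs_pos; assumption. }
  apply Rmult_le_reg_l with (2 * PI ^ 2); [exact Pp|].
  rewrite <- (Rabs_pos_eq (2 * PI ^ 2)) at 1 by lra. rewrite <- Rabs_mult, <- Rabs_Ropp.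
  replace (- (2 * PI ^ 2 * (k - (k0 - k0 / ky * (Sv / (2 * PI ^ 2)) * (c / 2)))))
    with (2 * PI ^ 2 * (k0 - k) - k0 * c / (2 * ky) * Sv) by (field; lra).
  eapply Rle_trans; [exact Main|]. apply Req_le. field. lra.
Qed.

End Expansion.

Theorem mainTheorem2 (g : R -> R) (ky : R) (Kx : R -> R -> R)
    (phis : R -> R -> R)
    (g_smooth : forall (n : nat) (s : R), ex_derive_n g n s)
    (g_periodic : forall s : R, g (s + 2 * PI) = g s)
    (g_pos : forall s : R, 0 < g s)
    (ky_pos : 0 < ky)
    (Kx_spec : forall cx : R, 0 <= cx -> stripe_wavenumber g ky cx (Kx ky cx))
    (phis_sol : monotone_stripe_solution g ky 0 (Kx ky 0) phis) :
  let psis := fun z : R => phis 0 z - z in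
  let kx0 := / (2 * PI) * RInt g 0 (2 * PI) in
  (forall z : R, psis (z + 2 * PI) = psis z) /\
  RInt psis 0 (2 * PI) = 0 /\
  in_Hhalf psis /\
  Kx ky 0 = kx0 /\
  exists M delta : R, 0 < delta /\
    forall cx : R, 0 <= cx < delta ->
      Rabs (Kx ky cx - (kx0 - kx0 / ky * Hhalf_norm_sq psis * (cx / 2)))
        <= M * cx ^ 2.
Proof.
  intros psis kx0.
  assert (g_derive : forall s, is_derive g s (Derive g s)) by (intros s; apply Derive_correct, (g_smooth 1%nat)).
  assert (ct_g : forall s, continuous g s) by (intros s; eapply ct_derive, g_derive).
  assert (ct_g' : forall s, continuous (Derive g) s).
  { intros s. apply (ex_derive_continuous (K := R_AbsRing) (V := R_NormedModule)), (g_smooth 2%nat). }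
  destruct (periodic_bounded g (2 * PI) two_pi_pos ct_g g_periodic) as [G0 [_ g_bound]].
  destruct (periodic_bounded (Derive g) (2 * PI) two_pi_pos ct_g') as [G1 [_ g'_bound]].
  { now apply periodic_derive with g. }
  destruct (solution_boundary_trace g ky 0 (Kx ky 0) phis ky_pos (Rle_refl 0) phis_sol) as [v' Tv].
  assert (ct_v : forall z, continuous (phis 0) z) by (intros z; eapply ct_derive, (trace_derive _ _ _ _ _ _ Tv)).
  destruct (trace_energy_summable g (Derive g) G0 G1 ky g_derive ct_g' g_bound g'_bound g_periodic ky_pos
    0 (Kx ky 0) (phis 0) v' ltac:(lra) Tv) as [sum _].
  destruct (Hhalf_of_modes psis ltac:(unfold psis; ctn) sum) as [Hh HN].
  assert (E0 : Kx ky 0 = kx0).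
  { exact (wavenumber_at_0 g (Derive g) G0 G1 ky g_derive ct_g' g_bound g'_bound g_periodic ky_pos _ _ _ Tv). }
  split; [|split; [|split; [|split]]].
  - intros z. unfold psis. rewrite (trace_shift _ _ _ _ _ _ Tv). ring.
  - exact (trace_mean _ _ _ _ _ _ Tv).
  - exact Hh.
  - exact E0.
  - destruct (wavenumber_expansion g (Derive g) G0 G1 ky g_derive ct_g' g_bound g'_bound g_periodic ky_pos _ _ _ Tv) as [M HM].
    (* The estimates on the mode rates hold for all [c] up to [ky], so [delta] can be [ky]. *)
    exists M, ky. split; [exact ky_pos|]. intros cx Hcx.
    destruct (Kx_spec cx ltac:(lra)) as [phi Hphi].
    destruct (solution_boundary_trace g ky cx (Kx ky cx) phi ky_pos ltac:(lra) Hphi) as [u' Tu].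
    rewrite HN, <- E0. exact (HM cx (Kx ky cx) (phi 0) u' ltac:(lra) Tu).
Qed.
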